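(* Let $1<p<\infty$ with $p\neq2$. The algebra $\mathcal{L}(L_p)$ of bounded linear operators on $L_p$ contains exactly $2^{\mathfrak{c}}$ closed ideals.
   Context: $\mathfrak{c}$ is the cardinality of the continuum, and $L_p=L_p[0,1]$ with Lebesgue measure. Closed ideals are norm-closed two-sided ideals. *)

(* Defs.v *)
From HB Require Import structures.
From mathcomp Require Import all_boot all_order all_algebra.
From mathcomp Require Import generic_quotient.
From mathcomp Require Import all_classical all_reals all_analysis.
From mathcomp Require Import measurable_realfun ess_sup_inf.

Set Implicit Arguments.
Unset Strict Implicit.
Unset Printing Implicit Defensive.

Import Order.TTheory GRing.Theory Num.Theory.
Import numFieldNormedType.Exports.

Local Open Scope classical_set_scope.
Local Open Scope ring_scope.

(** [LspaceType mu p1] is the library's space of almost-everywhere classes of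
    measurable functions with finite L_p-norm. The library puts no vector space
    structure on it; it is transported here from representatives. *)

Lemma ae_eq_Lnorm d (T : measurableType d) (R : realType)
    (mu : {measure set T -> \bar R}) (p : \bar R) (f g : T -> R) :
  (0 < p)%E ->
  measurable_fun setT f -> measurable_fun setT g ->
  f = g %[ae mu] -> Lnorm mu p (EFin \o f) = Lnorm mu p (EFin \o g).
Proof.
move=> p0 mf mg fg; rewrite unlock /Lnorm; case: p p0 => [r||]// r0.
- have m (h : T -> R) : measurable_fun setT h ->
      measurable_fun setT ((fun x => `|(EFin \o h) x| `^ r)%E : T -> \bar R).
    move=> mh; apply: (measurableT_comp (measurable_poweR _)).
    exact/measurableT_comp/measurable_EFinP.
  congr (_ `^ _)%E; apply: ge0_ae_eq_integral => //; do ?exact: m.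
  + by move=> x _; exact: poweR_ge0.
  + by move=> x _; exact: poweR_ge0.
  + by apply: filterS fg => x /(_ I) /= fgx _; rewrite fgx.
- case: ifPn => // _; apply: eq_ess_sup.
  by apply: filterS fg => x /(_ I) /= ->.
Qed.

Section Lspace_quotient.
Context d (T : measurableType d) (R : realType).
Variables (mu : {measure set T -> \bar R}) (p : \bar R) (p1 : (1 <= p)%E).
Local Open Scope quotient_scope.

Local Notation Q := {mfun_ mu, T >-> measurableTypeR R}.

Let p0 : (0 < p)%E. Proof. exact: lt_le_trans p1. Qed.

Let measurable_repr (q : Q) : measurable_fun [set: T] (q : T -> R).
Proof. exact: (@measurable_funPT _ _ T (measurableTypeR R) (repr q)). Qed.

Section class.
Variable f : LfunType mu p1.

Let f' : {mfun T >-> measurableTypeR R} :=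
  HB.pack (f : T -> measurableTypeR R)
    (isMeasurableFun.Build d _ T (measurableTypeR R) f (measurable_funPT f)).

Let q : Q := \pi_Q f'.

Let qf : (q : T -> R) = f %[ae mu].
Proof.
have : repr q == f' %[mod Q].
  by rewrite reprK.
by rewrite eqmodE => /asboolP.
Qed.

Let finite_norm_q : finite_norm mu p q.
Proof.
rewrite /finite_norm (ae_eq_Lnorm p0 _ _ qf); first exact: Lfunction_finite.
- exact: measurable_repr.
- exact: measurable_funPT.
Qed.

Definition Lclass : LspaceType mu p1 :=
  HB.pack q (isFinLebesgue.Build d T R mu p p1 q finite_norm_q).

Lemma Lclass_ae : (Lclass : T -> R) = f %[ae mu].
Proof. exact: qf. Qed.

End class.

Section representative.
Variable x : LspaceType mu p1.

Let Lrepr_subproof : (x : T -> R) \in Lfun mu p.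
Proof.
rewrite inE; apply/andP; split; rewrite inE.
- exact: measurable_repr.
- exact: Lebesgue_finite.
Qed.

Definition Lrepr : LfunType mu p1 := Lfun_Sub p1 Lrepr_subproof.

End representative.

Let Lspace_inj (x y : LspaceType mu p1) :
  (x : Q) = y -> x = y.
Proof.
case: x y => [x [[hx]]] [y [[hy]]] /= xy; case: _ / xy in hy *.
by rewrite (Prop_irrelevance hx hy).
Qed.

Lemma LclassP (f g : LfunType mu p1) :
  Lclass f = Lclass g <-> (f : T -> R) = g %[ae mu].
Proof.
split=> [fg|fg].
  apply: ae_eq_trans (Lclass_ae g); rewrite -fg.
  exact/ae_eq_sym/Lclass_ae.
apply: Lspace_inj => /=; apply/eqmodP; exact/asboolP.
Qed.

Lemma LreprK : cancel Lrepr Lclass.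
Proof.
move=> x; apply: Lspace_inj => /=; rewrite -[RHS]reprK.
by apply/eqmodP/asboolP; exact: aeW.
Qed.

Lemma LclassK (f : LfunType mu p1) : (Lrepr (Lclass f) : T -> R) = f %[ae mu].
Proof. by apply/LclassP; rewrite LreprK. Qed.

HB.instance Definition _ := gen_eqMixin (LspaceType mu p1).
HB.instance Definition _ := gen_choiceMixin (LspaceType mu p1).

Implicit Types (x y z : LspaceType mu p1) (f g : LfunType mu p1) (a b : R).

Definition Ladd x y := Lclass (Lrepr x + Lrepr y).
Definition Lopp x := Lclass (- Lrepr x).
Definition Lscale a x := Lclass (a *: Lrepr x).
Definition Lpnorm x : R := fine (Lnorm mu p (EFin \o (Lrepr x : T -> R))).

Lemma LclassD f g : Ladd (Lclass f) (Lclass g) = Lclass (f + g).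
Proof.
apply/LclassP; have := LclassK f; have := LclassK g.
apply: filterS2 => t /(_ I) gE /(_ I) fE _.
by rewrite -[LHS]/(Lrepr (Lclass f) t + Lrepr (Lclass g) t) fE gE.
Qed.

Lemma LclassN f : Lopp (Lclass f) = Lclass (- f).
Proof.
apply/LclassP; have := LclassK f.
apply: filterS => t /(_ I) fE _.
by rewrite -[LHS]/(- Lrepr (Lclass f) t) fE.
Qed.

Lemma LclassZ a f : Lscale a (Lclass f) = Lclass (a *: f).
Proof.
apply/LclassP; have := LclassK f.
apply: filterS => t /(_ I) fE _.
by rewrite -[LHS]/(a * Lrepr (Lclass f) t) fE.
Qed.

Lemma Lpnorm_class f :
  Lpnorm (Lclass f) = fine (Lnorm mu p (EFin \o (f : T -> R))).
Proof. by rewrite /Lpnorm (ae_eq_Lnorm p0 _ _ (LclassK f)). Qed.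

Let LclassW (P : LspaceType mu p1 -> Prop) :
  (forall f, P (Lclass f)) -> forall x, P x.
Proof. by move=> Pf x; rewrite -(LreprK x). Qed.

Let addA : associative Ladd.
Proof.
elim/LclassW=> f; elim/LclassW=> g; elim/LclassW=> h.
by rewrite !LclassD addrA.
Qed.

Let addC : commutative Ladd.
Proof. by elim/LclassW=> f; elim/LclassW=> g; rewrite !LclassD addrC. Qed.

Let add0 : left_id (Lclass 0) Ladd.
Proof. by elim/LclassW=> f; rewrite LclassD add0r. Qed.

Let addN : left_inverse (Lclass 0) Lopp Ladd.
Proof. by elim/LclassW=> f; rewrite LclassN LclassD addNr. Qed.

HB.instance Definition _ :=
  GRing.isZmodule.Build (LspaceType mu p1) addA addC add0 addN.

Let addE x y : x + y = Ladd x y. Proof. by []. Qed.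

Let scaleA a b x : Lscale a (Lscale b x) = Lscale (a * b) x.
Proof. by elim/LclassW: x => f; rewrite !LclassZ scalerA. Qed.

Let scale1 : left_id 1 Lscale.
Proof. by elim/LclassW=> f; rewrite LclassZ scale1r. Qed.

Let scaleDr : right_distributive Lscale +%R.
Proof.
move=> a; elim/LclassW=> f; elim/LclassW=> g.
by rewrite !addE LclassD !LclassZ LclassD scalerDr.
Qed.

Let scaleDl x : {morph Lscale^~ x : a b / a + b}.
Proof.
move=> a b; elim/LclassW: x => f.
by rewrite addE !LclassZ LclassD scalerDl.
Qed.

HB.instance Definition _ := GRing.Zmodule_isLmodule.Build R
  (LspaceType mu p1) scaleA scale1 scaleDr scaleDl.

Let normD x y : Lpnorm (x + y) <= Lpnorm x + Lpnorm y.
Proof.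
elim/LclassW: x => f; elim/LclassW: y => g.
rewrite addE LclassD !Lpnorm_class; exact: ler_LnormD.
Qed.

Let normZ a x : Lpnorm (a *: x) = `|a| * Lpnorm x.
Proof.
elim/LclassW: x => f; rewrite -[a *: _]/(Lscale a _) LclassZ !Lpnorm_class.
by rewrite (LnormZ f a) fineM// -finite_norm_fine.
Qed.

Let norm0_eq0 x : Lpnorm x = 0 -> x = 0.
Proof.
elim/LclassW: x => f; rewrite Lpnorm_class => /fine_Lnormr_eq0 f0.
by apply/LclassP.
Qed.

HB.instance Definition _ := Lmodule_isNormed.Build R (LspaceType mu p1)
  normD normZ norm0_eq0.

End Lspace_quotient.

Section bounded_operators.
Context (R : realType) (V : normedModType R).

Definition bounded_operator : {pred V -> V} := fun f =>
  `[< linear f /\ exists M, forall x, `|f x| <= M * `|x| >].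

Record bop := Bop {
  bop_fun :> V -> V;
  bop_subproof : bop_fun \in bounded_operator }.

HB.instance Definition _ := [isSub for bop_fun].
HB.instance Definition _ := [Choice of bop by <:].

Implicit Types (S T : bop) (x y : V) (a : R).

Lemma bopP S T : S = T <-> S =1 T.
Proof. by split=> [->//|ST]; exact/val_inj/funext. Qed.

Lemma bop_linear T : linear T.
Proof. by have /asboolP[] := bop_subproof T. Qed.

Lemma bop_bounded T : exists M, forall x, `|T x| <= M * `|x|.
Proof. by have /asboolP[] := bop_subproof T. Qed.

HB.instance Definition _ T :=
  GRing.isLinear.Build R V V *:%R T (bop_linear T).

Let bop_submod_closed : submod_closed bounded_operator.
Proof.
split.
  apply/asboolP; split=> [a x y|].
    by rewrite -[RHS]/(a *: 0 + 0) scaler0 addr0.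
  by exists 0 => x; rewrite normr0 mul0r.
move=> a f g /asboolP[lf [M fM]] /asboolP[lg [N gN]]; apply/asboolP; split.
  move=> b x y; rewrite !fctE lf lg !scalerDr !scalerA [b * a]mulrC.
  by rewrite addrACA.
exists (`|a| * M + N) => x; rewrite !fctE mulrDl.
rewrite (le_trans (ler_normD _ _))// lerD// normrZ -mulrA.
by rewrite ler_wpM2l.
Qed.

HB.instance Definition _ :=
  GRing.isSubmodClosed.Build R (V -> V) bounded_operator bop_submod_closed.
HB.instance Definition _ := [SubChoice_isSubLmodule of bop by <:].

Lemma bopDE S T x : (S + T) x = S x + T x. Proof. by []. Qed.
Lemma bopZE a T x : (a *: T) x = a *: T x. Proof. by []. Qed.
Lemma bop0E x : (0 : bop) x = 0. Proof. by []. Qed.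

Let opnorm_set T := [set `|T x| | x in [set x | `|x| <= 1]].

Definition opnorm T : R := sup (opnorm_set T).

Let opnorm_has_sup T : has_sup (opnorm_set T).
Proof.
split; first by exists `|T 0|; exists 0 => //=; rewrite normr0.
have [M TM] := bop_bounded T; exists `|M| => _ [x /= x1 <-].
rewrite (le_trans (TM x))// (le_trans (ler_wpM2r _ (ler_norm M)))//.
by rewrite ler_piMr.
Qed.

Let opnorm_ub T x : `|x| <= 1 -> `|T x| <= opnorm T.
Proof. by move=> x1; apply: ub_le_sup; [case: (opnorm_has_sup T)|exists x]. Qed.

Let opnorm_lub T a :
  (forall x, `|x| <= 1 -> `|T x| <= a) -> opnorm T <= a.
Proof.
move=> Ta; apply: ge_sup; first by case: (opnorm_has_sup T).
by move=> _ [x /= x1 <-]; exact: Ta.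
Qed.

Lemma opnorm_ge0 T : 0 <= opnorm T.
Proof.
by apply: (le_trans (normr_ge0 (T 0))); apply: opnorm_ub; rewrite normr0.
Qed.

Lemma le_opnorm T x : `|T x| <= opnorm T * `|x|.
Proof.
have [->|x0] := eqVneq x 0; first by rewrite linear0 !normr0 mulr0.
have := @opnorm_ub T (`|x|^-1 *: x).
rewrite linearZ/= !normrZ normfV normr_id mulVf ?normr_eq0// => /(_ (lexx _)).
by rewrite mulrC ler_pdivrMr ?normr_gt0.
Qed.

Let opnormD S T : opnorm (S + T) <= opnorm S + opnorm T.
Proof.
apply: opnorm_lub => x x1; rewrite bopDE (le_trans (ler_normD _ _))//.
by rewrite lerD// opnorm_ub.
Qed.

Let opnormZ_le a T : opnorm (a *: T) <= `|a| * opnorm T.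
Proof.
apply: opnorm_lub => x x1; rewrite bopZE normrZ.
by rewrite ler_wpM2l// opnorm_ub.
Qed.

Let opnormZ a T : opnorm (a *: T) = `|a| * opnorm T.
Proof.
apply/eqP; rewrite eq_le opnormZ_le/=.
have [->|a0] := eqVneq a 0; first by rewrite normr0 mul0r opnorm_ge0.
rewrite -ler_pdivlMl ?normr_gt0// -normfV.
by have := opnormZ_le a^-1 (a *: T); rewrite scalerA mulVf// scale1r.
Qed.

Let opnorm0_eq0 T : opnorm T = 0 -> T = 0.
Proof.
move=> T0; apply/bopP => x; apply/eqP; rewrite bop0E -normr_le0.
by rewrite (le_trans (le_opnorm T x))// T0 mul0r.
Qed.

HB.instance Definition _ :=
  Lmodule_isNormed.Build R bop opnormD opnormZ opnorm0_eq0.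

Let bop_comp_subproof S T : (S \o T) \in bounded_operator.
Proof.
apply/asboolP; split=> [a x y|]; first by rewrite /= !linearP.
exists (opnorm S * opnorm T) => x /=; rewrite (le_trans (le_opnorm S _))//.
by rewrite -mulrA ler_wpM2l ?opnorm_ge0 ?le_opnorm.
Qed.

Let bop_id_subproof : (idfun : V -> V) \in bounded_operator.
Proof. by apply/asboolP; split=> //; exists 1 => x; rewrite mul1r. Qed.

Definition bop_comp S T : bop := Bop (bop_comp_subproof S T).
Definition bop_id : bop := Bop bop_id_subproof.

Let compA : associative bop_comp. Proof. by move=> ? ? ?; apply/bopP. Qed.
Let comp1l : left_id bop_id bop_comp. Proof. by move=> ?; apply/bopP. Qed.
Let comp1r : right_id bop_id bop_comp. Proof. by move=> ?; apply/bopP. Qed.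
Let compDl : left_distributive bop_comp +%R.
Proof. by move=> ? ? ?; apply/bopP. Qed.
Let compDr : right_distributive bop_comp +%R.
Proof. by move=> S ? ?; apply/bopP => x; exact: (linearD S). Qed.

HB.instance Definition _ :=
  GRing.Zmodule_isPzRing.Build bop compA comp1l comp1r compDl compDr.

Definition closed_ideals : set (set bop) := [set I |
  [/\ closed I,
      I 0, forall S T, I S -> I T -> I (S + T),
      forall a T, I T -> I (a *: T)
    & forall S T, I T -> I (S * T) /\ I (T * S)]].

End bounded_operators.
Arguments closed_ideals {R} V.

(* Lebesgue measure on [0,1], as a measure on the Borel sets of the line that
   ignores the complement of [0,1]: values outside [0,1] do not affect the
   class of a function. *)
Definition lebesgue01 (R : realType) :
    {measure set (measurableTypeR R) -> \bar R} :=
  mrestr (@lebesgue_measure R) (measurable_itv `[0%R, 1%R]).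

Definition Lp01 (R : realType) (p : R) (p1 : 1 <= p) : normedModType R :=
  LspaceType (lebesgue01 R) (p1 : (1%:E <= p%:E)%E).

(* Main.v *)
(* Let q > 2 be the larger of p and its conjugate exponent. Take Rademacher
   functions r_{n,j} and, on disjoint intervals for different n, independent
   sparse signs f_{n,j} (j < k_n), normalised in L_q and nonzero with probability
   1/s_n there, where s_n grows very fast and k_n = s_n^2; let g_{n,j} be the
   multiples of the f_{n,j} biorthogonal to them. For N a set of naturals, let
   T_N = \sum_{n in N, j} <., r_{n,j}> f_{n,j} if p > 2, and its transpose if
   p < 2. The means Phi_m(V) = k_m^-1 \sum_i <V r_{m,i}, g_{m,i}> (with r and g
   exchanged if p < 2) are uniformly bounded in m, and Phi_m(T_N) = 1 for m in N,
   whereas Phi_m(U T_N W) tends to 0 as m tends to infinity outside N, for all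
   operators U and W. Given almost disjoint sets N_a (a real), each set A of
   reals yields the closed ideal of those V such that Phi_m(U V W) tends to 0
   along N_a for all a in A and all U and W; it contains T_{N_b} exactly when b
   is not in A, so there are at least 2^c closed ideals.

   Conversely L_p is separable, so an operator is determined by countably many
   reals and there are at most 2^c sets of operators. *)
Require Import Defs.
From mathcomp Require Import all_boot all_order all_algebra.
From mathcomp Require Import all_classical all_reals all_analysis.
From mathcomp Require Import measurable_realfun ring lra.
Import Order.TTheory GRing.Theory Num.Theory.
Import numFieldNormedType.Exports.
Set Implicit Arguments.
Unset Strict Implicit.
Unset Printing Implicit Defensive.
Local Open Scope classical_set_scope.
Local Open Scope card_scope.
Local Open Scope ring_scope.

(** * Averages of independent sparse signs *)

(** Each [T_N] factors through l_2, so the off-diagonal estimate concerns two matrices: b, bounded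
    on l_2 and coming from the Rademacher side, and c, from the sparse side. The sum of the products
    b c over the blocks n other than m has to be small against k_m. For n < m the blocks are few:
    s_m dominates their total dimension. For n > m independent signs e are inserted. The vector
    sum_i e_i b_i has l_2 norm at most a multiple of sqrt k_m = s_m, but a block of density 1/s_n
    with s_n enormous does not see that norm: the L_q norm of the sparse sum is on average at most
    of order k_m^(1/q) instead of k_m^(1/2). Against it stands the L_q' norm, of order s_m^(1/q' +
    1/2), of a signed sum over the whole block m. The product is k_m s_m^(1/q - 1/2), and q > 2
    makes the last exponent negative. Moments of order q are obtained by comparing |x|^q with cosh x
    - 1, whose mean over independent signs is an explicit product; this serves at once as a Khinchin
    and as a Rosenthal inequality. For p < 2 it is the other of the two operators around [T_N] that
    produces b. *)

Section averages.
Context {R : realType}.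
Implicit Types (N b k s : nat) (f g : nat -> R).

Definition avg N f : R := N%:R^-1 * \sum_(c < N) f c.

Lemma eq_avg N f g : (forall c, (c < N)%N -> f c = g c) -> avg N f = avg N g.
Proof. by move=> fg; rewrite /avg; under eq_bigr do rewrite fg//. Qed.

Lemma avgD N f g : avg N (fun c => f c + g c) = avg N f + avg N g.
Proof. by rewrite /avg big_split mulrDr. Qed.

Lemma avgZ N (a : R) f : avg N (fun c => a * f c) = a * avg N f.
Proof. by rewrite /avg -mulr_sumr mulrCA. Qed.

Lemma avg_sum N k (F : nat -> nat -> R) :
  avg N (fun c => \sum_(j < k) F c j) = \sum_(j < k) avg N (fun c => F c j).
Proof. by rewrite /avg exchange_big/= mulr_sumr. Qed.

Lemma avg_cst N (a : R) : (0 < N)%N -> avg N (fun=> a) = a.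
Proof.
move=> N0; rewrite /avg sumr_const card_ord -[a *+ N]mulr_natl mulrA mulVf ?mul1r//.
by rewrite pnatr_eq0 -lt0n.
Qed.

Lemma ler_avg N f g : (forall c, (c < N)%N -> f c <= g c) -> avg N f <= avg N g.
Proof.
by move=> fg; rewrite ler_wpM2l ?invr_ge0//; apply: ler_sum => c _; exact: fg.
Qed.

Lemma ler_norm_avg N f : `|avg N f| <= avg N (fun c => `|f c|).
Proof.
by rewrite normrM ger0_norm ?invr_ge0// ler_wpM2l ?invr_ge0// ler_norm_sum.
Qed.

Lemma avg_ge0 N f : (forall c, (c < N)%N -> 0 <= f c) -> 0 <= avg N f.
Proof.
by move=> f0; rewrite mulr_ge0 ?invr_ge0//; apply: sumr_ge0 => c _; exact: f0.
Qed.

(** Independence of the base [b] digits of a uniform [c]: the induction splits off the leading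
    digit, [c = d * b ^ k + e]. *)
Lemma avg_digits b k (F : nat -> nat -> R) : (0 < b)%N ->
  avg (b ^ k) (fun c => \prod_(j < k) F j ((c %/ b ^ j) %% b)%N) =
  \prod_(j < k) avg b (F j).
Proof.
move=> b0; elim: k => [|k IH].
  by rewrite /avg expn0 big_ord1 !big_ord0 invr1 mul1r.
rewrite big_ord_recr/= -IH /avg.
set G := fun c => \prod_(j < k) F j ((c %/ b ^ j) %% b)%N.
have -> : \sum_(c < b ^ k.+1) \prod_(j < k.+1) F j ((c %/ b ^ j) %% b)%N =
    (\sum_(d < b) F k d) * \sum_(e < b ^ k) G e.
  rewrite big_distrlr/= expnS.
  rewrite -(big_mkord xpredT (fun c => \prod_(j < k.+1) F j ((c %/ b ^ j) %% b)%N)).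
  rewrite big_nat_mul big_mkord; apply: eq_bigr => d _.
  rewrite mulSn -{1}[(d * b ^ k)%N]add0n big_addn addnK big_mkord.
  apply: eq_bigr => e _; rewrite big_ord_recr/= mulrC; congr (_ * _).
    by rewrite divnDr ?dvdn_mull// mulnK ?expn_gt0 ?b0// divn_small// add0n modn_small.
  apply: eq_bigr => j _; congr (F _ _).
  (* For [j < k] the leading part [d * b ^ k] is a multiple of [b ^ j.+1], so it does not affect
     digit [j]. *)
  rewrite divnDr; last by rewrite dvdn_mull// dvdn_exp2l// ltnW.
  have -> : (d * b ^ k)%N = (d * b ^ (k - j.+1) * b * b ^ j)%N.
    by rewrite -!mulnA -expnS -expnD subnK.
  by rewrite mulnK ?expn_gt0 ?b0// addnC modnMDl.
by rewrite expnS natrM invfM; ring.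
Qed.

End averages.

(** * Sparse signs and their exponential moments *)

Section sparse_signs.
Context {R : realType}.
Implicit Types (b c j k s : nat) (x y : R).

Definition sgn3 d : R := match d with 0%N => 1 | 1%N => -1 | _ => 0 end.

(* As c ranges over [0, (2s)^k[, these are k independent variables with values
   1, -1, 0 taken with probabilities 1/2s, 1/2s, 1-1/s. *)
Definition xi s c j : R := sgn3 ((c %/ (2 * s) ^ j) %% (2 * s))%N.

Lemma avg_sgn3 s (f : R -> R) : (0 < s)%N ->
  avg (2 * s) (fun d => f (sgn3 d)) = f 0 + s%:R^-1 * ((f 1 + f (-1)) / 2 - f 0).
Proof.
move=> s0; have sN0 : s%:R != 0 :> R by rewrite pnatr_eq0 -lt0n.
rewrite /avg (_ : 2 * s = (2 * s).-2.+2)%N; last by case: s s0 {sN0} => // s _; rewrite mulnS.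
rewrite !big_ord_recl/= [X in _ + (_ + X)](_ : _ = (2 * s).-2%:R * f 0); last first.
  by rewrite mulr_natl -[in RHS](card_ord (2 * s).-2) -sumr_const.
have -> : (2 * s).-2.+2%:R = 2 * s%:R :> R.
  by rewrite -natrM; case: s s0 {sN0} => // s _; rewrite mulnS.
have -> : (2 * s).-2%:R = 2 * s%:R - 2 :> R.
  by rewrite -natrM; case: s s0 {sN0} => // s _; rewrite mulnS natrD (_ : (2 + 2 * s).-2 = 2 * s)%N//; ring.
by field.
Qed.

Lemma avg_xi s k (F : nat -> R -> R) : (0 < s)%N ->
  avg ((2 * s) ^ k) (fun c => \prod_(j < k) F j (xi s c j)) =
  \prod_(j < k) (F j 0 + s%:R^-1 * ((F j 1 + F j (-1)) / 2 - F j 0)).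
Proof.
move=> s0; rewrite (@avg_digits _ _ _ (fun j d => F j (sgn3 d))) ?muln_gt0//.
by apply: eq_bigr => j _; rewrite (avg_sgn3 (F j)).
Qed.

Lemma avg_xi2 s k (i j : 'I_k) : (0 < s)%N ->
  avg ((2 * s) ^ k) (fun c => xi s c i * xi s c j) = s%:R^-1 * (i == j)%:R.
Proof.
(* Padding with factors 1 turns the two coordinates into a product over all [l]; for [i = j] both
   nontrivial factors meet at one index and give a square. *)
move=> s0; pose F l x := (if l == i :> nat then x else 1) *
  (if l == j :> nat then x else 1) : R.
transitivity (avg ((2 * s) ^ k) (fun c => \prod_(l < k) F l (xi s c l))).
  by apply: eq_avg => c _; rewrite big_split/= -!big_mkcond/= !big_pred1_eq.
have sN0 : s%:R != 0 :> R by rewrite pnatr_eq0 -lt0n.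
rewrite avg_xi//; have [ij|] := eqVneq i j.
  rewrite /F ij (bigD1 j)//= big1 ?eqxx; first by field.
  by move=> l; rewrite -val_eqE => /negbTE ->; field.
rewrite -val_eqE => /negbTE ij; rewrite (bigD1 i)//= /F eqxx ij.
by rewrite !mulr1 !mulr0 subrr !mul0r add0r subr0 !mulr0 mul0r.
Qed.

Lemma avg_xi_sqr s k (x : nat -> R) : (0 < s)%N ->
  avg ((2 * s) ^ k) (fun c => (\sum_(j < k) x j * xi s c j) ^+ 2) =
  s%:R^-1 * \sum_(j < k) x j ^+ 2.
Proof.
move=> s0; pose F i c j : R := (x i * x j) * (xi s c i * xi s c j).
transitivity (avg ((2 * s) ^ k) (fun c => \sum_(i < k) \sum_(j < k) F i c j)).
  apply: eq_avg => c _.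
  by rewrite expr2 big_distrlr/=; do 2!apply: eq_bigr => ? _; rewrite /F; ring.
rewrite (avg_sum _ _ (fun c i => \sum_(j < k) F i c j)).
under eq_bigr do rewrite avg_sum.
rewrite mulr_sumr; apply: eq_bigr => i _; rewrite (bigD1 i)//= big1.
  by rewrite avgZ avg_xi2// eqxx mulr1 addr0; ring.
by move=> j ji; rewrite avgZ avg_xi2// eq_sym (negbTE ji) !mulr0.
Qed.

(** Hyperbolic cosine. It stands in for even powers: its mean over independent signs is again a
    product, and [ch x - 1] dominates every [|x|^q] with [q >= 2] up to a constant. *)
Definition ch x : R := (expR x + expR (- x)) / 2.

Lemma avg_expR_xi s k (x : nat -> R) : (0 < s)%N ->
  avg ((2 * s) ^ k) (fun c => expR (\sum_(j < k) x j * xi s c j)) =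
  \prod_(j < k) (1 + s%:R^-1 * (ch (x j) - 1)).
Proof.
move=> s0; pose F j y := expR (x j * y).
transitivity (avg ((2 * s) ^ k) (fun c => \prod_(j < k) F j (xi s c j))).
  by apply: eq_avg => c _; rewrite expR_sum.
rewrite avg_xi//; apply: eq_bigr => j _.
by rewrite /F mulr0 expR0 mulr1 mulrN1.
Qed.

Lemma chN x : ch (- x) = ch x.
Proof. by rewrite /ch opprK addrC. Qed.

(** Half-angle formula [cosh x - 1 = 2 sinh(x/2)^2]: bounds on [ch x - 1] reduce to bounds on a
    difference of exponentials. *)
Lemma chB1 x : ch x - 1 = (expR (x / 2) - expR (- (x / 2))) ^+ 2 / 2.
Proof.
have -> : ch x = (expR (x / 2) * expR (x / 2) +
    expR (- (x / 2)) * expR (- (x / 2))) / 2.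
  by rewrite -!expRD -opprD -splitr.
have := expRxMexpNx_1 (x / 2).
set u := expR _; set v := expR _ => uv.
by rewrite -[X in _ - X = _]uv; field.
Qed.

Lemma ch_ge1 x : 1 <= ch x.
Proof. by rewrite -subr_ge0 chB1 divr_ge0// sqr_ge0. Qed.

End sparse_signs.

(** * Moments of sums of sparse signs *)

Section moments.
Context {R : realType}.
Implicit Types (k s : nat) (x y q t : R) (a : nat -> R).

Lemma expR_le_half y : 0 <= y <= 1 / 2 -> expR y <= 1 + 2 * y.
Proof.
move=> /andP[y0 y1]; have := expR_ge1Dx (- y); rewrite expRN => e.
have e0 : 0 < expR y := expR_gt0 y.
have : (1 - y) * expR y <= 1 by rewrite -ler_pdivlMr// div1r.
nra.
Qed.

Lemma ch_le x : ch x - 1 <= x ^+ 2 * expR `|x| / 2.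
Proof.
wlog x0 : x / 0 <= x.
  move=> H; have [|x0] := leP 0 x; first exact: H.
  by rewrite -chN -normrN -sqrrN; apply: H; rewrite oppr_ge0 ltW.
rewrite chB1 ger0_norm// ler_wpM2r//.
have -> : expR x = expR (x / 2) ^+ 2 by rewrite expr2 -expRD -splitr.
rewrite -exprMn.
have e0 := expR_gt0 (x / 2).
have e1 := expR_ge1Dx (- (x / 2) - x / 2); rewrite expRD expRN in e1.
(* This is [1 - exp(-x) <= x], multiplied by [exp(x/2)]. *)
have : expR (x / 2) - (expR (x / 2))^-1 <= x * expR (x / 2).
  rewrite -subr_ge0; set u := expR _ in e0 e1 *.
  have -> : x * u - (u - u^-1) = u * (u^-1 * u^-1 - (1 + (- (x / 2) - x / 2))).
    by field; rewrite gt_eqF.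
  by rewrite mulr_ge0 ?subr_ge0// ltW.
rewrite expRN; apply: lerXn2r; rewrite nnegrE; last by rewrite mulr_ge0// ltW.
rewrite subr_ge0 -expRN ler_expR; lra.
Qed.

Lemma ch_le1 x : `|x| <= 1 -> ch x - 1 <= 2 * x ^+ 2.
Proof.
move=> x1; apply: (le_trans (ch_le x)).
have : expR `|x| <= 4.
  apply: (@le_trans _ _ (expR (1 / 2 + 1 / 2))); first by rewrite ler_expR; lra.
  rewrite expRD; have := @expR_le_half (1 / 2).
  have := expR_gt0 (1 / 2 : R); nra.
have := sqr_ge0 x; nra.
Qed.

Lemma ch_le_expR x : `|x| <= 1 -> ch x <= expR (2 * x ^+ 2).
Proof.
by move=> /ch_le1 h; have := expR_ge1Dx (2 * x ^+ 2); lra.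
Qed.

Lemma sqr_le_ch x : x ^+ 2 <= 8 * (ch x - 1).
Proof.
wlog x0 : x / 0 <= x.
  move=> H; have [|x0] := leP 0 x; first exact: H.
  by rewrite -chN -sqrrN; apply: H; rewrite oppr_ge0 ltW.
have e1 := expR_ge1Dx (x / 2).
have e0 := expR_gt0 (x / 2).
have : x / 2 <= expR (x / 2) - expR (- (x / 2)).
  rewrite expRN; set u := expR _ in e0 e1 *.
  have : u^-1 <= 1 by rewrite invf_le1//; lra.
  lra.
rewrite chB1 => h.
have : (x / 2) ^+ 2 <= (expR (x / 2) - expR (- (x / 2))) ^+ 2.
  by apply: lerXn2r; rewrite ?nnegrE; lra.
nra.
Qed.

Lemma expR_le_ch x : 1 <= `|x| -> expR `|x| <= 8 * (ch x - 1).
Proof.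
wlog x0 : x / 0 <= x.
  move=> H; have [|x0] := leP 0 x; first exact: H.
  by rewrite -chN -normrN; apply: H; rewrite oppr_ge0 ltW.
rewrite ger0_norm// => x1.
have e1 := expR_ge1Dx x.
have e0 := expR_gt0 (x / 2).
have xE : expR x = expR (x / 2) * expR (x / 2) by rewrite -expRD -splitr.
rewrite xE in e1 *.
rewrite chB1 expRN; set u := expR _ in e0 e1 *.
have : u^-1 <= u / 2 by rewrite -[u^-1]mul1r ler_pdivrMr//; lra.
set v := u^-1 => uv.
have : (u / 2) ^+ 2 <= (u - v) ^+ 2 by apply: lerXn2r; rewrite ?nnegrE; lra.
nra.
Qed.

(** For [|x| < 1] the condition [q >= 2] gives [|x|^q <= x^2]; for [|x| >= 1] the power is at most
    [|x|^(N+1)], hence at most [(N+1)! exp |x|]. The factor 8 is that of [sqr_le_ch] and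
    [expR_le_ch]. *)
Lemma powR_le_ch q : 2 <= q ->
  exists2 C, 0 < C & forall x, `|x| `^ q <= C * (ch x - 1).
Proof.
move=> q2; have [N qN] : exists N, q <= N.+1%:R.
  exists (Num.trunc q); have /ltW := truncnS_gt q; exact.
exists (8 * N.+1`!%:R); first by rewrite mulr_gt0// ltr0n fact_gt0.
move=> x; have f1 : 1 <= N.+1`!%:R :> R by rewrite ler1n fact_gt0.
have [x1|x1] := leP 1 `|x|; last first.
  have [->|x0] := eqVneq x 0.
    rewrite normr0 powR0 ?gt_eqF//; last by lra.
    by rewrite mulr_ge0 ?subr_ge0 ?ch_ge1// mulr_ge0.
  apply: (@le_trans _ _ (x ^+ 2)).
    rewrite -real_normK ?num_real// -powR_mulrn//.
    by apply: ger_powR; rewrite // normr_gt0 x0 ltW.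
  apply: (le_trans (sqr_le_ch x)); rewrite -mulrA ler_wpM2l//.
  by rewrite ler_peMl ?subr_ge0 ?ch_ge1.
apply: (@le_trans _ _ (`|x| ^+ N.+1)).
  by rewrite -powR_mulrn//; apply: ler_powR.
have := @expR_ge1Dxn _ `|x| N (normr_ge0 x) => e.
apply: (@le_trans _ _ (N.+1`!%:R * expR `|x|)).
  rewrite mulrC -ler_pdivrMr ?ltr0n ?fact_gt0//; apply: le_trans e; lra.
by rewrite mulrAC [leRHS]mulrC ler_wpM2l// ?(le_trans ler01)// expR_le_ch.
Qed.

Lemma powR_le_sqr r x : 0 <= r <= 2 -> `|x| `^ r <= 1 + x ^+ 2.
Proof.
move=> /andP[r0 r2]; have x2 := sqr_ge0 x; have [x1|x1] := leP 1 `|x|.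
  have : `|x| `^ r <= `|x| `^ 2 by apply: ler_powR.
  by rewrite powR_mulrn// real_normK ?num_real//; lra.
have : `|x| `^ r <= 1 `^ r.
  by apply: ge0_ler_powR; rewrite ?nnegrE// ltW.
by rewrite powR1; lra.
Qed.

(** Let [y] be the quantity assumed to be at most 1/2. By independence the mean of [ch] is a
    product, at most [exp y <= 1 + 2 * y], and the factor [s] cancels the density in [y]. In this
    regime a sparse sum sees its coefficients one at a time. *)
Lemma moment_sparse q C s k a : (0 < s)%N ->
  (forall x, `|x| `^ q <= C * (ch x - 1)) -> 0 < C ->
  s%:R^-1 * \sum_(j < k) (ch (a j) - 1) <= 1 / 2 ->
  s%:R * avg ((2 * s) ^ k) (fun c => `|\sum_(j < k) a j * xi s c j| `^ q) <=
  2 * C * \sum_(j < k) (ch (a j) - 1).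
Proof.
move=> s0 qC C0 small; set S := \sum_(j < k) _ in small *.
have S0 : 0 <= S by apply: sumr_ge0 => j _; rewrite subr_ge0 ch_ge1.
have sR : 0 < s%:R :> R by rewrite ltr0n.
pose P := \prod_(j < k) (1 + s%:R^-1 * (ch (a j) - 1)).
have PS : P <= 1 + 2 * (s%:R^-1 * S).
  apply: le_trans (expR_le_half _); last first.
    by rewrite small mulr_ge0// invr_ge0 ltW.
  rewrite mulr_sumr expR_sum; apply: ler_prod => j _.
  by rewrite expR_ge1Dx andbT addr_ge0// mulr_ge0 ?invr_ge0 ?subr_ge0 ?ch_ge1 ?ltW.
have avgE : avg ((2 * s) ^ k)
    (fun c => ch (\sum_(j < k) a j * xi s c j) - 1) = P - 1.
  rewrite avgD avg_cst ?expn_gt0 ?muln_gt0 ?s0//; congr (_ - _).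
  under eq_avg do rewrite /ch mulrC.
  rewrite avgZ avgD avg_expR_xi//.
  rewrite (@eq_avg _ _ (fun c => expR (- _)) (fun c => expR (\sum_(j < k) (- a j) * xi s c j))).
    rewrite (avg_expR_xi _ (fun j => - a j))//.
    under [X in _ + X]eq_bigr do rewrite chN.
    by rewrite -/P; field.
  by move=> c _; rewrite -sumrN; under eq_bigr do rewrite -mulNr.
apply: (@le_trans _ _ (s%:R * (C * (P - 1)))).
  rewrite ler_wpM2l// -avgE -avgZ; apply: ler_avg => c _; exact: qC.
have -> : 2 * C * S = s%:R * (C * (2 * (s%:R^-1 * S))).
  by field; rewrite gt_eqF.
do 2!(apply: ler_wpM2l; first exact: ltW); lra.
Qed.

(** Dividing the coefficients by [2 * t] brings the sum of their squares below 1/4, hence the sum of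
    the [ch - 1] below 1/2, and [moment_sparse] applies; scaling back produces [(2 * t) ^ q]. At
    [s = 1] this is a Khinchin inequality. *)
Lemma moment_gaussian q C s k a t : (0 < s)%N -> 0 <= q ->
  (forall x, `|x| `^ q <= C * (ch x - 1)) -> 0 < C -> 0 < t ->
  \sum_(j < k) a j ^+ 2 <= t ^+ 2 ->
  s%:R * avg ((2 * s) ^ k) (fun c => `|\sum_(j < k) a j * xi s c j| `^ q) <=
  C * (2 * t) `^ q.
Proof.
move=> s0 q0 qC C0 t0 at1; pose b j := a j / (2 * t).
have t2 : 0 < 2 * t by rewrite mulr_gt0.
have bS : \sum_(j < k) b j ^+ 2 <= 1 / 4.
  under eq_bigr do rewrite /b exprMn; rewrite -mulr_suml.
  rewrite exprVn ler_pdivrMr ?exprn_gt0//; apply: (le_trans at1).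
  by lra.
have b1 j : (j < k)%N -> `|b j| <= 1.
  move=> jk; rewrite -(@ler_pXn2r _ 2) ?nnegrE// expr1n real_normK ?num_real//.
  have : b j ^+ 2 <= \sum_(j < k) b j ^+ 2.
    rewrite (bigD1 (Ordinal jk))//= lerDl; apply: sumr_ge0 => i _; exact: sqr_ge0.
  lra.
have chS : \sum_(j < k) (ch (b j) - 1) <= 1 / 2.
  apply: (@le_trans _ _ (\sum_(j < k) 2 * b j ^+ 2)).
    by apply: ler_sum => j _; apply: ch_le1; exact: b1.
  by rewrite -mulr_sumr; lra.
have chS0 : 0 <= \sum_(j < k) (ch (b j) - 1).
  by apply: sumr_ge0 => j _; rewrite subr_ge0 ch_ge1.
have sV : s%:R^-1 <= 1 :> R by rewrite invf_le1 ?ltr0n// ler1n.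
have sV0 : 0 <= s%:R^-1 :> R by rewrite invr_ge0.
have := @moment_sparse q C s k b s0 qC C0.
have -> : s%:R^-1 * \sum_(j < k) (ch (b j) - 1) <= 1 / 2 by nra.
move=> /(_ isT) H.
rewrite (@eq_avg _ _ _ (fun c => (2 * t) `^ q * `|\sum_(j < k) b j * xi s c j| `^ q)).
  rewrite avgZ mulrCA mulrC ler_wpM2r ?powR_ge0//.
  by apply: (le_trans H); nra.
move=> c _; rewrite -[X in X `^ q * _](gtr0_norm t2) -powRM// -normrM.
rewrite mulr_sumr; congr (`|_| `^ q); apply: eq_bigr => j _.
by rewrite /b mulrA [2 * t * _]mulrC divfK// gt_eqF.
Qed.

(** Up to exponent 2 the variance suffices: for the sum divided by [t], [|y|^r <= 1 + y^2], and the
    mean of [y^2] is at most 1. *)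
Lemma moment_le2 r s k a t : (0 < s)%N -> 0 <= r <= 2 -> 0 < t ->
  \sum_(j < k) a j ^+ 2 <= s%:R * t ^+ 2 ->
  avg ((2 * s) ^ k) (fun c => `|\sum_(j < k) a j * xi s c j| `^ r) <= 2 * t `^ r.
Proof.
move=> s0 r02 t0 at1; have sR : 0 < s%:R :> R by rewrite ltr0n.
apply: (@le_trans _ _ (avg ((2 * s) ^ k) (fun c => t `^ r *
    (1 + (t ^+ 2)^-1 * (\sum_(j < k) a j * xi s c j) ^+ 2)))).
  apply: ler_avg => c _; set y := \sum_(j < k) _.
  have -> : `|y| = t * `|y / t|.
    by rewrite normrM normfV (gtr0_norm t0) mulrC divfK// gt_eqF.
  rewrite powRM ?(ltW t0)// ler_wpM2l ?powR_ge0//.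
  by apply: (le_trans (powR_le_sqr _ r02)); rewrite exprMn exprVn mulrC.
rewrite avgZ avgD avg_cst ?expn_gt0 ?muln_gt0 ?s0// avgZ avg_xi_sqr//.
rewrite mulrC ler_wpM2r ?powR_ge0// -lerBrDl mulrA -invfM ler_pdivrMl.
  by apply: (le_trans at1); lra.
by rewrite mulr_gt0// exprn_gt0.
Qed.

End moments.

(** * The trace estimate *)

Section matrix_estimate.
Context {R : realType}.
Variables (q q' C : R) (s : nat -> nat).
Hypotheses (q2 : 2 < q) (qq' : q^-1 + q'^-1 = 1).
Hypotheses (C0 : 0 < C) (qC : forall x : R, `|x| `^ q <= C * (ch x - 1)).
Hypothesis s0 : forall n, (0 < s n)%N.
Hypothesis s_fast : forall m n, (m < n)%N ->
  (s m)%:R ^+ 2 * expR (s m)%:R <= (s n)%:R :> R.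

Let k n := (s n ^ 2)%N.

Let q0 : 0 < q. Proof. exact: lt_trans q2. Qed.

Let q'12 : 1 < q' < 2.
Proof.
have := qq'; have qV0 : 0 < q^-1 by rewrite invr_gt0 q0.
have qV2 : q^-1 < 2^-1 by rewrite ltf_pV2 ?posrE.
move=> eq1; have q'0 : 0 < q' by rewrite -invr_gt0; lra.
have q'1 : q'^-1 < 1^-1 by rewrite invr1; lra.
have q'2 : 2^-1 < q'^-1 by lra.
by move: q'1 q'2; rewrite !ltf_pV2 ?posrE// => -> ->.
Qed.

Let sR n : 1 <= (s n)%:R :> R. Proof. by rewrite ler1n. Qed.

(** Take [u = sqrt S]. This reads an l_2 bound off a bilinear form: tested on its own coefficients,
    the form has value [S], and [S] is also the squared norm of the test vector. *)
Lemma le_sqr_of_selfbound (S M : R) : 0 <= M -> 0 <= S ->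
  (forall u, 0 < u -> S <= u ^+ 2 -> S <= M * u) -> S <= M ^+ 2.
Proof.
move=> M0 S0 H; have [->|Sn0] := eqVneq S 0; first exact: sqr_ge0.
have Sp : 0 < S by rewrite lt_neqAle eq_sym Sn0.
have r0 : 0 < Num.sqrt S by rewrite sqrtr_gt0.
have := H _ r0; rewrite sqr_sqrtr// lexx => /(_ isT).
rewrite -{1}(sqr_sqrtr S0) expr2 ler_pM2r// => h.
by rewrite -(sqr_sqrtr S0); apply: lerXn2r; rewrite ?nnegrE// ltW.
Qed.

Section one_block.
Variables (m L : nat) (K : R) (b c : nat -> nat -> nat -> R).
Hypothesis K0 : 0 < K.
(** [b] is bounded on l_2 x l_2; [c] is bounded for the L_q' norm on the sparse functions of block
    [m] and the L_q norm on those of all blocks. Upper bounds [t] and [u] replace the norms, which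
    avoids roots and vanishing norms. [L] truncates the sum over the blocks and enters no
    constant. *)
Hypothesis bK : forall (x : nat -> R) (y : nat -> nat -> R) (t u : R),
  0 < t -> 0 < u ->
  \sum_(i < k m) x i ^+ 2 <= t ^+ 2 ->
  \sum_(n < L) \sum_(j < k n) y n j ^+ 2 <= u ^+ 2 ->
  `|\sum_(i < k m) \sum_(n < L) \sum_(j < k n) x i * y n j * b i n j|
    <= K * (t * u).
Hypothesis cK : forall (x : nat -> R) (y : nat -> nat -> R) (t u : R),
  0 < t -> 0 < u ->
  (s m)%:R * avg ((2 * s m) ^ k m)
    (fun w => `|\sum_(i < k m) x i * xi (s m) w i| `^ q') <= t `^ q' ->
  \sum_(n < L) (s n)%:R * avg ((2 * s n) ^ k n)
    (fun w => `|\sum_(j < k n) y n j * xi (s n) w j| `^ q) <= u `^ q ->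
  `|\sum_(i < k m) \sum_(n < L) \sum_(j < k n) x i * y n j * c i n j|
    <= K * (t * u).

Let pick (f : nat -> nat -> R) n0 j0 : (n0 < L)%N -> (j0 < k n0)%N ->
  \sum_(n < L) \sum_(j < k n) ((n == n0 :> nat) && (j == j0 :> nat))%:R * f n j
  = f n0 j0.
Proof.
move=> n0L j0k; rewrite (bigD1 (Ordinal n0L))//= (bigD1 (Ordinal j0k))//= !eqxx.
rewrite mul1r big1 ?addr0; last first.
  by move=> j; rewrite -val_eqE/= => /negbTE ->; rewrite mul0r.
rewrite big1 ?addr0// => n; rewrite -val_eqE/= => /negbTE -> /=.
by rewrite big1// => j _; rewrite mul0r.
Qed.

(** The form is tested on the column itself and a unit vector, as [le_sqr_of_selfbound] requires;
    [row] and [signed] follow the same pattern. *)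
Let column n j : (n < L)%N -> (j < k n)%N ->
  \sum_(i < k m) b i n j ^+ 2 <= K ^+ 2.
Proof.
move=> nL jk; apply: le_sqr_of_selfbound => [||u u0 bu]; first exact: ltW.
  by apply: sumr_ge0 => i _; exact: sqr_ge0.
pose y n' j' : R := ((n' == n) && (j' == j))%:R.
have := @bK (b^~ n ^~ j) y u 1 u0 ltr01 bu.
rewrite mulr1 expr1n => H; apply: le_trans (H _); last first.
  rewrite (eq_bigr (fun n' : 'I_L => \sum_(j' < k n')
     ((n' == n :> nat) && (j' == j :> nat))%:R * 1)).
    by rewrite (pick (fun _ _ => 1)).
  by move=> n' _; apply: eq_bigr => j' _; rewrite /y; case: andP; rewrite ?expr1n ?mulr1// expr0n.
apply: le_trans (ler_norm _); apply: ler_sum => i _.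
rewrite (eq_bigr (fun n' : 'I_L => \sum_(j' < k n')
   ((n' == n :> nat) && (j' == j :> nat))%:R * (b i n j * b i n' j'))).
  by rewrite (pick (fun n' j' => b i n j * b i n' j'))// expr2.
by move=> n' _; apply: eq_bigr => j' _; rewrite /y mulrCA mulrA.
Qed.

Let row i : (i < k m)%N ->
  \sum_(n < L) \sum_(j < k n) b i n j ^+ 2 <= K ^+ 2.
Proof.
move=> ik; apply: le_sqr_of_selfbound => [||u u0 bu]; first exact: ltW.
  by apply: sumr_ge0 => n _; apply: sumr_ge0 => j _; exact: sqr_ge0.
have := @bK (fun i' => (i' == i)%:R) (b i) 1 u ltr01 u0.
rewrite mul1r expr1n => H; apply: le_trans (H _ bu); last first.
  rewrite (bigD1 (Ordinal ik))//= eqxx expr1n big1 ?addr0// => i'.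
  by rewrite -val_eqE/= => /negbTE ->; rewrite expr0n.
apply: le_trans (ler_norm _).
rewrite [leRHS](bigD1 (Ordinal ik))//= eqxx [X in _ + X]big1 ?addr0; last first.
  move=> i'; rewrite -val_eqE/= => /negbTE ->.
  by apply: big1 => n _; apply: big1 => j _; rewrite !mul0r.
apply: ler_sum => n _; apply: ler_sum => j _.
by rewrite mul1r expr2.
Qed.

(** A sign vector has l_2 norm [sqrt (k m)], which is [s m] by the choice [k = s ^ 2]. *)
Let signed (e : nat -> R) : (forall i, (i < k m)%N -> e i ^+ 2 = 1) ->
  \sum_(n < L) \sum_(j < k n) (\sum_(i < k m) e i * b i n j) ^+ 2
  <= (K * (s m)%:R) ^+ 2.
Proof.
move=> e1; apply: le_sqr_of_selfbound => [||u u0 bu].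
- by rewrite mulr_ge0// ltW.
- by apply: sumr_ge0 => n _; apply: sumr_ge0 => j _; exact: sqr_ge0.
have sm0 : 0 < (s m)%:R :> R by apply: lt_le_trans (sR m).
have := @bK e (fun n j => \sum_(i < k m) e i * b i n j) (s m)%:R u sm0 u0.
rewrite mulrA => H; apply: le_trans (H _ bu).
  apply: le_trans (ler_norm _); rewrite exchange_big/=; apply: ler_sum => n _.
  rewrite exchange_big/=; apply: ler_sum => j _.
  by rewrite expr2 mulr_suml; apply: ler_sum => i _; rewrite mulrAC.
rewrite (eq_bigr (fun=> 1)) ?sumr_const ?card_ord /k ?natrX//.
by move=> i _; exact: e1.
Qed.

(* A block n < m has dimension k n, negligible compared with k m. *)
Lemma low_blocks u : 0 < u -> C * 2 `^ q <= u `^ q ->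
  (forall i n j, (m <= n)%N -> b i n j = 0) ->
  `|\sum_(i < k m) \sum_(n < L) \sum_(j < k n) b i n j * c i n j| <=
  K ^+ 2 * (2 * u) * (s m)%:R * (\sum_(n < m) k n)%:R.
Proof.
move=> u0 uC bm.
have entry n j : (n < L)%N -> (j < k n)%N ->
    `|\sum_(i < k m) b i n j * c i n j| <= K ^+ 2 * (2 * u) * (s m)%:R.
  move=> nL jk; pose y n' j' : R := ((n' == n) && (j' == j))%:R.
  (* The column has l_2 norm at most [K], so by [moment_le2] its moment of order [q'] is at most
     [2 * s m * K ^ q']; as [2 * s m >= 1] and [q' >= 1], this is below the power [q'] of
     [2 * s m * K]. *)
  have t0 : 0 < 2 * (s m)%:R * K.
    by rewrite !mulr_gt0// (lt_le_trans ltr01).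
  have := @cK (b^~ n ^~ j) y _ u t0 u0.
  have -> : K * (2 * (s m)%:R * K * u) = K ^+ 2 * (2 * u) * (s m)%:R by ring.
  have -> : \sum_(i < k m) \sum_(n' < L) \sum_(j' < k n')
      b i n j * y n' j' * c i n' j' = \sum_(i < k m) b i n j * c i n j.
    apply: eq_bigr => i _; rewrite -[RHS](pick (fun n' j' => b i n j * c i n' j') nL jk).
    by apply: eq_bigr => n' _; apply: eq_bigr => j' _; rewrite /y mulrCA mulrA.
  apply.
    have /andP[q'1 q'2] := q'12.
    have K2 : \sum_(i < k m) b i n j ^+ 2 <= (s m)%:R * K ^+ 2.
      apply: (le_trans (column nL jk)); rewrite ler_peMl ?sqr_ge0//.
    have r : 0 <= q' <= 2 by rewrite !ltW// (lt_trans ltr01).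
    have H := moment_le2 (a := b^~ n ^~ j) (s0 m) r K0 K2.
    apply: le_trans (ler_wpM2l (ler0n _ _) H) _.
    rewrite [in leRHS]powRM ?(ltW K0) ?mulr_ge0// mulrA [_ * 2]mulrC.
    rewrite ler_wpM2r ?powR_ge0//; apply: le1r_powR; last exact: ltW.
    by have := sR m; lra.
  apply: le_trans uC.
  rewrite (bigD1 (Ordinal nL))//= [X in _ + X]big1 ?addr0; last first.
    move=> n'; rewrite -val_eqE/= => /negbTE nn'.
    rewrite (@eq_avg _ _ _ (fun=> 0)) ?avg_cst ?mulr0 ?expn_gt0 ?muln_gt0 ?s0//.
    move=> w _; rewrite big1 ?normr0 ?powR0 ?gt_eqF//.
    by move=> i _; rewrite /y nn' mul0r.
  (* A single sparse function has coefficient 1, so [t = 1]. *)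
  rewrite -[2 in leRHS]mulr1; apply: moment_gaussian => //; first exact: ltW.
  rewrite (bigD1 (Ordinal jk))//= /y !eqxx big1 ?addr0// => j'.
  by rewrite -val_eqE/= => /negbTE ->; rewrite ?andbF expr0n.
rewrite exchange_big/=; under eq_bigr do rewrite exchange_big/=.
apply: (@le_trans _ _ (\sum_(n < L | (n < m)%N) \sum_(j < k n)
    K ^+ 2 * (2 * u) * (s m)%:R)).
  rewrite (bigID (fun n : 'I_L => (n < m)%N))/= [X in _ + X]big1 ?addr0; last first.
    move=> n; rewrite -leqNgt => mn; apply: big1 => j _; apply: big1 => i _.
    by rewrite bm// mul0r.
  apply: (le_trans (ler_norm_sum _ _ _)); apply: ler_sum => n _.
  apply: (le_trans (ler_norm_sum _ _ _)); apply: ler_sum => j _.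
  exact: entry.
under [leLHS]eq_bigr do rewrite sumr_const card_ord -[_ *+ k _]mulr_natr.
rewrite -mulr_sumr -natr_sum ler_wpM2l//.
  by rewrite !mulr_ge0// ltW// exprn_gt0.
rewrite ler_nat.
have [mL|Lm] := leqP m L; first by rewrite (big_ord_narrow mL).
apply: (@leq_trans (\sum_(n < L) k n)%N).
  by rewrite big_mkcond/=; apply: leq_sum => n _; case: ifP.
rewrite (big_ord_widen m k (ltnW Lm)) big_mkcond/=.
by apply: leq_sum => n _; case: ifP.
Qed.

(* Pairing b with c is averaged over random signs e: the coefficients
   a = \sum_i e i * b i are then, block by block, so small compared with the
   sparsity s n >= s m ^ 2 * exp (s m) that |x|^q <= C (cosh x - 1) computes the
   L_q norm of the sparse sums up to constants. *)
Lemma high_blocks :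
  (forall i n j, (n <= m)%N -> b i n j = 0) ->
  `|\sum_(i < k m) \sum_(n < L) \sum_(j < k n) b i n j * c i n j| <=
  K ^+ 2 * (2 * (s m)%:R `^ q'^-1 * (s m)%:R `^ 2^-1) *
  ((k m)%:R `^ q^-1 * (1 + 64 * C)).
Proof.
move=> bm; have /andP[q'1 q'2] := q'12.
have sm0 : 0 < (s m)%:R :> R by apply: lt_le_trans (sR m).
(* [T] bounds the L_q' norm of a signed sum of all functions of block [m]: the underlying sum of
   sparse signs has variance [k m / s m = s m]. *)
set T := 2 * _ * _; set v := (k m)%:R `^ q^-1.
have T0 : 0 < T by rewrite !mulr_gt0// powR_gt0.
have km0 : 0 < (k m)%:R :> R by rewrite ltr0n expn_gt0 s0.
have v0 : 0 < v by rewrite powR_gt0.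
have vq : v `^ q = (k m)%:R.
  by rewrite /v -powRrM mulVf ?gt_eqF// powRr1// ltW.
(* At [s = 1] the digits are 0 and 1 only, so [xi] never takes the value 0 and is a fair sign. *)
pose e w i : R := xi 1 w i.
pose a w n j := \sum_(i < k m) e w i * (b i n j / K).
pose W w := \sum_(n < L) (s n)%:R * avg ((2 * s n) ^ k n)
    (fun z => `|\sum_(j < k n) a w n j * xi (s n) z j| `^ q).
have e1 w i : e w i ^+ 2 = 1.
  rewrite /e /xi; move: (ltn_mod (w %/ (2 * 1) ^ i) (2 * 1)).
  by case: (_ %% _)%N => [|[|//]] _; rewrite /sgn3 ?sqrrN expr1n.
have aS w : \sum_(n < L) \sum_(j < k n) a w n j ^+ 2 <= (s m)%:R ^+ 2.
  have := signed (e := e w) (fun i _ => e1 w i).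
  rewrite exprMn mulrC -ler_pdivrMr ?exprn_gt0//; apply: le_trans.
  rewrite mulr_suml; apply: ler_sum => n _; rewrite mulr_suml.
  apply: ler_sum => j _; rewrite -expr_div_n mulr_suml /a.
  by under eq_bigr do rewrite mulrA.
have am w n j : (n <= m)%N -> a w n j = 0.
  by move=> nm; apply: big1 => i _; rewrite bm// mul0r mulr0.
(* Blocks [n <= m] vanish. For [n > m] the coefficients are at most [s m] in absolute value, and
   [s_fast] gives the smallness that [moment_sparse] asks for. *)
have WS w : W w <= 2 * C * \sum_(n < L) \sum_(j < k n) (ch (a w n j) - 1).
  rewrite mulr_sumr; apply: ler_sum => n _; apply: moment_sparse => //.
  have [nm|mn] := leqP n m.
    rewrite big1 ?mulr0// => j _.
    by rewrite am// /ch oppr0 expR0 -[1 + 1]/(2%:R) divff// subrr.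
  have aj (j : 'I_(k n)) : `|a w n j| <= (s m)%:R.
    rewrite -(@ler_pXn2r _ 2) ?nnegrE// real_normK ?num_real//.
    apply: le_trans (aS w).
    rewrite (bigD1 n)//= (bigD1 j)//= -addrA lerDl addr_ge0//.
      by apply: sumr_ge0 => ? _; exact: sqr_ge0.
    by apply: sumr_ge0 => ? _; apply: sumr_ge0 => ? _; exact: sqr_ge0.
  rewrite mulrC ler_pdivrMr ?(lt_le_trans ltr01)//.
  apply: (@le_trans _ _ (\sum_(j < k n) a w n j ^+ 2 * (expR (s m)%:R / 2))).
    apply: ler_sum => j _; apply: (le_trans (ch_le _)).
    by rewrite -mulrA ler_wpM2l ?sqr_ge0// ler_wpM2r// ler_expR.
  rewrite -mulr_suml mulrA mul1r [leRHS]mulrC ler_wpM2r//.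
  apply: le_trans (s_fast mn); rewrite ler_wpM2r ?expR_ge0//.
  apply: le_trans (aS w); rewrite (bigD1 n)//= lerDl.
  by apply: sumr_ge0 => ? _; apply: sumr_ge0 => ? _; exact: sqr_ge0.
have W0 w : 0 <= W w.
  apply: sumr_ge0 => n _; rewrite mulr_ge0//; apply: avg_ge0 => z _.
  exact: powR_ge0.
(* For a column with normalised sum of squares [S <= 1], the mean of [ch] is a product, at most
   [exp (2 * S) <= 1 + 32 * S]. Summing [S] over the columns is summing over the rows, each
   contributing at most 1; hence [64 = 2 * 32]. *)
have avgW : avg ((2 * 1) ^ k m) W <= 64 * C * (k m)%:R.
  apply: (le_trans (ler_avg (fun w _ => WS w))).
  rewrite avgZ (_ : 64 * C * (k m)%:R = 2 * C * (32 * (k m)%:R)); last by ring.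
  rewrite ler_wpM2l ?mulr_ge0 ?(ltW C0)//.
  rewrite (avg_sum _ _ (fun w n => \sum_(j < k n) (ch (a w n j) - 1))).
  have chb n j : (n < L)%N -> (j < k n)%N ->
      avg ((2 * 1) ^ k m) (fun w => ch (a w n j) - 1) <=
      32 * \sum_(i < k m) (b i n j / K) ^+ 2.
    move=> nL jk; rewrite avgD avg_cst ?expn_gt0//.
    set S := \sum_(i < k m) _.
    have S1 : S <= 1.
      rewrite /S; under eq_bigr do rewrite expr_div_n; rewrite -mulr_suml.
      by rewrite ler_pdivrMr ?exprn_gt0// mul1r column.
    have S0 : 0 <= S by apply: sumr_ge0 => i _; exact: sqr_ge0.
    have -> : avg ((2 * 1) ^ k m) (fun w => ch (a w n j)) =
        \prod_(i < k m) ch (b i n j / K).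
      rewrite (@eq_avg _ _ _ (fun w => 2^-1 *
        (expR (\sum_(i < k m) (b i n j / K) * xi 1 w i) +
         expR (\sum_(i < k m) (- (b i n j / K)) * xi 1 w i)))); last first.
        move=> w _; rewrite /ch mulrC /a; congr (_ * (expR _ + expR _)).
          by apply: eq_bigr => i _; rewrite mulrC.
        by rewrite -sumrN; apply: eq_bigr => i _; rewrite mulrC mulNr.
      rewrite avgZ avgD (avg_expR_xi _ (fun i => b i n j / K))//.
      rewrite (avg_expR_xi _ (fun i => - (b i n j / K)))//.
      under eq_bigr do rewrite invr1 mul1r addrC subrK.
      under [X in _ + X]eq_bigr do rewrite invr1 mul1r addrC subrK chN.
      by field.
    apply: (@le_trans _ _ (expR (2 * S) - 1)).
      rewrite lerB// /S mulr_sumr expR_sum; apply: ler_prod => i _.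
      rewrite (le_trans ler01 (ch_ge1 _))/=; apply: ch_le_expR.
      rewrite -(@ler_pXn2r _ 2) ?nnegrE// expr1n real_normK ?num_real//.
      apply: le_trans S1; rewrite /S (bigD1 i)//= lerDl.
      by apply: sumr_ge0 => ? _; exact: sqr_ge0.
    have e16 : expR (2 * S) <= 16.
      apply: (@le_trans _ _ (expR (1 / 2 + 1 / 2 + (1 / 2 + 1 / 2)))).
        by rewrite ler_expR; lra.
      have : expR (1 / 2 : R) <= 2 by apply: (le_trans (expR_le_half _)); lra.
      have := expR_gt0 (1 / 2 : R); rewrite !expRD; set u := expR _ => u0 u2.
      have uu4 : u * u <= 4 by nra.
      have uu0 : 0 <= u * u by rewrite mulr_ge0// ltW.
      nra.
    (* [exp y - 1 <= y * exp y] at [y = 2 * S], with [exp y <= 16]. *)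
    have := expR_ge1Dx (- (2 * S)); rewrite expRN => eN.
    have eV : expR (2 * S) * (expR (2 * S))^-1 = 1 by rewrite divff// gt_eqF// expR_gt0.
    have := expR_gt0 (2 * S); nra.
  apply: (@le_trans _ _ (\sum_(n < L) \sum_(j < k n)
      32 * \sum_(i < k m) (b i n j / K) ^+ 2)).
    apply: ler_sum => n _; rewrite (avg_sum _ _ (fun w j => ch (a w n j) - 1)).
    by apply: ler_sum => j _; exact: chb.
  under eq_bigr do rewrite -mulr_sumr; rewrite -mulr_sumr ler_wpM2l//.
  under eq_bigr do rewrite exchange_big/=; rewrite exchange_big/=.
  rewrite -[X in _ <= X%:R](card_ord (k m)) -sum1_card natr_sum.
  apply: ler_sum => i _.
  under eq_bigr do (under eq_bigr do rewrite expr_div_n; rewrite -mulr_suml).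
  by rewrite -mulr_suml ler_pdivrMr ?exprn_gt0// mul1r row.
have form w : `|\sum_(i < k m) \sum_(n < L) \sum_(j < k n)
    e w i * (K * a w n j) * c i n j| <= K ^+ 2 * T * v * (1 + (k m)%:R^-1 * W w).
  (* [u ^ q >= k m + W w], so [u] dominates the q-th root of [W w]; being affine in [W w], it can be
     averaged directly through [avgW]. *)
  pose u := v * (1 + (k m)%:R^-1 * W w).
  have u1 : 1 <= 1 + (k m)%:R^-1 * W w by rewrite lerDl mulr_ge0// invr_ge0 ltW.
  have u0 : 0 < u by rewrite mulr_gt0// (lt_le_trans ltr01).
  have -> : K ^+ 2 * T * v * (1 + (k m)%:R^-1 * W w) = K * (K * (T * u)).
    by rewrite /u; ring.
  have H := @cK (e w) (a w) T u T0 u0.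
  have {}H : `|\sum_(i < k m) \sum_(n < L) \sum_(j < k n)
      e w i * a w n j * c i n j| <= K * (T * u).
    apply: H.
      have r : 0 <= q' <= 2 by rewrite !ltW// (lt_trans ltr01).
      have t0 : 0 < (s m)%:R `^ 2^-1 :> R by rewrite powR_gt0.
      have K2 : \sum_(i < k m) e w i ^+ 2 <= (s m)%:R * ((s m)%:R `^ 2^-1) ^+ 2.
        rewrite powR12_sqrt ?(ltW sm0)// sqr_sqrtr ?(ltW sm0)//.
        rewrite (eq_bigr (fun=> 1)) => [|i _]; last exact: e1.
        by rewrite sumr_const card_ord -expr2 -natrX.
      have H := moment_le2 (s0 m) r t0 K2.
      apply: le_trans (ler_wpM2l (ler0n _ _) H) _.
      rewrite /T powRM ?mulr_ge0 ?powR_ge0// mulrA ler_wpM2r ?powR_ge0//.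
      have q'0 : q' != 0 by rewrite gt_eqF// (lt_trans ltr01).
      have sq' : ((s m)%:R `^ q'^-1) `^ q' = (s m)%:R :> R.
        by rewrite -powRrM mulVf// powRr1// ltW.
      rewrite (powRM _ (ler0n R 2) (powR_ge0 _ _)) sq'.
      rewrite [leRHS]mulrC ler_wpM2l ?(ltW sm0)//.
      by apply: le1r_powR; rewrite ?ler1n// ltW.
    rewrite /u powRM ?(ltW v0) ?(le_trans ler01 u1)// vq.
    apply: (@le_trans _ _ ((k m)%:R * (1 + (k m)%:R^-1 * W w))).
      by rewrite mulrDr mulr1 mulrA divff ?gt_eqF// mul1r lerDr ltW.
    rewrite ler_wpM2l ?(ltW km0)//; apply: le1r_powR => //.
    by apply: ltW; apply: lt_trans q2; rewrite ltr1n.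
  rewrite (_ : \sum_(i < k m) _ = K * \sum_(i < k m) \sum_(n < L)
    \sum_(j < k n) e w i * a w n j * c i n j).
    by rewrite normrM (gtr0_norm K0) ler_wpM2l// ltW.
  rewrite mulr_sumr; apply: eq_bigr => i _.
  rewrite mulr_sumr; apply: eq_bigr => n _.
  by rewrite mulr_sumr; apply: eq_bigr => j _; ring.
(* Orthogonality of the signs: in the average of [e i * e l] only [l = i] survives. *)
have -> : \sum_(i < k m) \sum_(n < L) \sum_(j < k n) b i n j * c i n j =
  avg ((2 * 1) ^ k m) (fun w => \sum_(i < k m) \sum_(n < L) \sum_(j < k n)
    e w i * (K * a w n j) * c i n j).
  pose F w i := \sum_(n < L) \sum_(j < k n) e w i * (K * a w n j) * c i n j.
  rewrite (avg_sum _ _ F); apply: eq_bigr => i _.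
  rewrite (avg_sum _ _ (fun w n => \sum_(j < k n) e w i * (K * a w n j) * c i n j)).
  apply: eq_bigr => n _.
  rewrite (avg_sum _ _ (fun w j => e w i * (K * a w n j) * c i n j)).
  apply: eq_bigr => j _.
  pose G w l := (b l n j * c i n j) * (xi 1 w i * xi 1 w l) : R.
  rewrite (@eq_avg _ _ _ (fun w => \sum_(l < k m) G w l)); last first.
    move=> w _; rewrite /a !mulr_sumr mulr_suml; apply: eq_bigr => l _.
    by rewrite /G /e; field; rewrite gt_eqF.
  rewrite avg_sum (bigD1 i)//= big1 => [|l li].
    by rewrite /G avgZ avg_xi2// eqxx invr1 !mulr1 addr0.
  by rewrite /G avgZ avg_xi2// eq_sym (negbTE li) !mulr0.
apply: (le_trans (ler_norm_avg _ _)).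
apply: (le_trans (ler_avg (fun w _ => form w))).
have -> : K ^+ 2 * T * (v * (1 + 64 * C)) = K ^+ 2 * T * v * (1 + 64 * C) by ring.
rewrite avgZ; apply: ler_wpM2l.
  by rewrite (mulr_ge0 (mulr_ge0 (exprn_ge0 _ _) (ltW T0)) (ltW v0))// ltW.
rewrite avgD avg_cst ?expn_gt0// lerD2l avgZ mulrC ler_pdivrMr//.
Qed.

End one_block.

(** Blocks below and above [m] are treated apart, block [m] being zero. The high blocks contribute
    [s m] to the power [1/q' + 1/2 + 2/q = 2 + (1/q - 1/2)], and [s ^ 2 = k]. *)
Lemma matrix_estimate (u : R) : 0 < u -> C * 2 `^ q <= u `^ q ->
  forall m L (K : R) (b c : nat -> nat -> nat -> R), 0 < K ->
  (forall (x : nat -> R) (y : nat -> nat -> R) (t u : R),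
    0 < t -> 0 < u ->
    \sum_(i < k m) x i ^+ 2 <= t ^+ 2 ->
    \sum_(n < L) \sum_(j < k n) y n j ^+ 2 <= u ^+ 2 ->
    `|\sum_(i < k m) \sum_(n < L) \sum_(j < k n) x i * y n j * b i n j|
      <= K * (t * u)) ->
  (forall (x : nat -> R) (y : nat -> nat -> R) (t u : R),
    0 < t -> 0 < u ->
    (s m)%:R * avg ((2 * s m) ^ k m)
      (fun w => `|\sum_(i < k m) x i * xi (s m) w i| `^ q') <= t `^ q' ->
    \sum_(n < L) (s n)%:R * avg ((2 * s n) ^ k n)
      (fun w => `|\sum_(j < k n) y n j * xi (s n) w j| `^ q) <= u `^ q ->
    `|\sum_(i < k m) \sum_(n < L) \sum_(j < k n) x i * y n j * c i n j|
      <= K * (t * u)) ->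
  (forall i j, b i m j = 0) ->
  `|\sum_(i < k m) \sum_(n < L) \sum_(j < k n) b i n j * c i n j| <=
  (k m)%:R * (K ^+ 2 * (2 * u + 2 * (1 + 64 * C)) *
    ((\sum_(n < m) k n)%:R / (s m)%:R + (s m)%:R `^ (q^-1 - 2^-1))).
Proof.
move=> u0 uC m L K b c K0 bK cK bm.
pose bl i n j := (n < m)%:R * b i n j.
pose bh i n j := (m < n)%:R * b i n j.
have -> : \sum_(i < k m) \sum_(n < L) \sum_(j < k n) b i n j * c i n j =
    \sum_(i < k m) \sum_(n < L) \sum_(j < k n) bl i n j * c i n j +
    \sum_(i < k m) \sum_(n < L) \sum_(j < k n) bh i n j * c i n j.
  rewrite -big_split/=; apply: eq_bigr => i _.
  rewrite -big_split/=; apply: eq_bigr => n _.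
  rewrite -big_split/=; apply: eq_bigr => j _.
  rewrite -mulrDl -mulrDl; case: ltngtP => nm; rewrite ?addr0 ?add0r ?mul1r//.
  have H n' (j' : nat) : n' = m -> b i n' j' = 0 by move=> ->; exact: bm.
  by rewrite (H _ _ nm) !mulr0.
(* Erasing blocks of [b] amounts to erasing them from [y], which does not increase the norm of
   [y]. *)
have restrict (P : pred nat) (x : nat -> R) (y : nat -> nat -> R) (t u' : R) : 0 < t -> 0 < u' ->
    \sum_(i < k m) x i ^+ 2 <= t ^+ 2 ->
    \sum_(n < L) \sum_(j < k n) y n j ^+ 2 <= u' ^+ 2 ->
    `|\sum_(i < k m) \sum_(n < L) \sum_(j < k n)
       x i * y n j * ((P n)%:R * b i n j)| <= K * (t * u').
  move=> t0 u'0 xt yu; have := bK x (fun n j => (P n)%:R * y n j) t u' t0 u'0 xt.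
  have yu' : \sum_(n < L) \sum_(j < k n) ((P n)%:R * y n j) ^+ 2 <= u' ^+ 2.
    apply: le_trans yu; apply: ler_sum => n _; apply: ler_sum => j _.
    by case: (P n); rewrite ?mul1r// mul0r expr0n sqr_ge0.
  move=> /(_ yu'); apply: le_trans; rewrite le_eqVlt; apply/orP; left; apply/eqP.
  congr `|_|; do 3![apply: eq_bigr => ? _]; ring.
have low : `|\sum_(i < k m) \sum_(n < L) \sum_(j < k n) bl i n j * c i n j| <=
    K ^+ 2 * (2 * u) * (s m)%:R * (\sum_(n < m) k n)%:R.
  apply: (low_blocks K0 (restrict (fun n => n < m)%N) cK u0 uC).
  by move=> i n j mn; rewrite /bl ltnNge mn mul0r.
have high : `|\sum_(i < k m) \sum_(n < L) \sum_(j < k n) bh i n j * c i n j| <=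
    K ^+ 2 * (2 * (s m)%:R `^ q'^-1 * (s m)%:R `^ 2^-1) *
    ((k m)%:R `^ q^-1 * (1 + 64 * C)).
  apply: (high_blocks K0 (restrict (fun n => m < n)%N) cK).
  by move=> i n j nm; rewrite /bh ltnNge nm mul0r.
apply: (le_trans (ler_normD _ _)); apply: (le_trans (lerD low high)).
have sm0 : 0 < (s m)%:R :> R by apply: lt_le_trans (sR m).
have kE : (k m)%:R = (s m)%:R ^+ 2 :> R by rewrite natrX.
set S := (s m)%:R in sm0 kE *; set r := (\sum_(n < m) k n)%:R.
rewrite kE.
have -> : (S ^+ 2) `^ q^-1 = S `^ (2 * q^-1).
  by rewrite -powR_mulrn ?(ltW sm0)// -powRrM.
have -> : K ^+ 2 * (2 * S `^ q'^-1 * S `^ 2^-1) * (S `^ (2 * q^-1) * (1 + 64 * C))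
   = K ^+ 2 * (2 * (1 + 64 * C)) * (S `^ q'^-1 * S `^ 2^-1 * S `^ (2 * q^-1)) by ring.
have SS (x y : R) : S `^ x * S `^ y = S `^ (x + y).
  by rewrite powRD// (gt_eqF sm0) implybT.
have -> : S `^ q'^-1 * S `^ 2^-1 * S `^ (2 * q^-1) = S ^+ 2 * S `^ (q^-1 - 2^-1).
  rewrite !SS -powR_mulrn ?(ltW sm0)// SS; congr (_ `^ _).
  by have := qq'; lra.
set z := S `^ (_ - _); have z0 : 0 <= z by exact: powR_ge0.
have r0 : 0 <= r by rewrite ler0n.
have K20 : 0 <= K ^+ 2 by rewrite sqr_ge0.
rewrite -subr_ge0.
have -> : S ^+ 2 * (K ^+ 2 * (2 * u + 2 * (1 + 64 * C)) * (r / S + z)) -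
   (K ^+ 2 * (2 * u) * S * r + K ^+ 2 * (2 * (1 + 64 * C)) * (S ^+ 2 * z)) =
   K ^+ 2 * (2 * u * (S ^+ 2 * z) + 2 * (1 + 64 * C) * (S * r)).
  by field; rewrite gt_eqF.
have S20 : 0 <= S ^+ 2 by rewrite sqr_ge0.
have C1 : 0 <= 1 + 64 * C by have := C0; lra.
by rewrite mulr_ge0// addr_ge0// mulr_ge0// ?mulr_ge0 ?(ltW u0) ?(ltW sm0)//.
Qed.

End matrix_estimate.

(** * Ideals indexed by an almost disjoint family *)

Lemma inj_card_leP (T U : Type) (A : set T) (B : set U) (f : T -> U) :
  {in A &, injective f} -> (forall x, A x -> B (f x)) -> A #<= B.
Proof.
move=> finj fB; have := inj_card_eq finj; rewrite card_eq_sym => /card_eqPle[+ _].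
by move=> /card_le_trans; apply; apply: subset_card_le => _ [x Ax <-]; exact: fB.
Qed.

Section almost_disjoint.
Context {R : realType}.

(** Codes of the lattice points just below the line of slope [a] through the origin. Lines of
    different slopes drift apart, so these sets form an almost disjoint family indexed by all
    reals. *)
Definition slope_set (a : R) : set nat :=
  [set pickle (n, Num.floor (n%:R * a)) | n in [set: nat]].

Lemma slope_set_unbounded (a : R) n0 : exists2 m, (n0 <= m)%N & slope_set a m.
Proof.
have /injective_gtn/(_ n0)[n n0n] :
    injective (fun n => pickle (n, Num.floor (n%:R * a))).
  by move=> x y /(pcan_inj pickleK)[].
by exists (pickle (n, Num.floor (n%:R * a))); [exact: ltnW|exists n].
Qed.

Lemma slope_set_disjoint (a b : R) : a != b ->
  exists n0, forall m, (n0 <= m)%N -> slope_set a m -> ~ slope_set b m.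
Proof.
move=> ab; have ab0 : 0 < `|a - b| by rewrite normr_gt0 subr_eq0.
(* A common point has an abscissa [n] with [n * |a - b| < 1], hence [n < M]; the sum of the codes
   over [n < M] bounds each of them. *)
pose M := (Num.trunc `|a - b|^-1).+1.
exists (\sum_(n < M) pickle (n : nat, Num.floor (n%:R * a))).+1%N => m mM.
move=> [n _ nm] [n' _]; rewrite -nm => /(pcan_inj pickleK)[n'n].
subst n' => fl.
have nM : (n < M)%N.
  have : n%:R * `|a - b| < 1.
    rewrite -[n%:R]normr_nat -normrM mulrBr ltr_norml.
    have := Num.Theory.floor_itv (n%:R * a); have := Num.Theory.floor_itv (n%:R * b).
    rewrite fl intrD1.
    move=> /andP[h1 h2] /andP[h3 h4].
    by apply/andP; split; lra.
  rewrite -ltr_pdivlMr// div1r => h; rewrite /M -(ltr_nat R).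
  by apply: (lt_trans h); exact: truncnS_gt.
move: mM; rewrite -nm ltnNge => /negP; apply.
by rewrite (bigD1 (Ordinal nM))//= leq_addr.
Qed.

End almost_disjoint.

(** * Ideals defined by vanishing diagonal means *)

Section many_ideals.
Context {R : realType} {X : normedModType R}.
Variables (k : nat -> nat) (u : nat -> nat -> X) (v : nat -> nat -> X -> R) (C : R).
Hypothesis k0 : forall m, (0 < k m)%N.
Hypothesis v_lin : forall m i a x y, v m i (a *: x + y) = a * v m i x + v m i y.
Hypothesis v_le : forall m i x, (i < k m)%N -> `|v m i x| <= C * `|x|.
Hypothesis u_le : forall m i, (i < k m)%N -> `|u m i| <= C.

Definition diag_mean m (V : bop X) : R :=
  (k m)%:R^-1 * \sum_(i < k m) v m i (V (u m i)).

Let vD m i x y : v m i (x + y) = v m i x + v m i y.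
Proof. by have := v_lin m i 1 x y; rewrite scale1r mul1r. Qed.

Let v0 m i : v m i 0 = 0.
Proof. by have := vD m i 0 0; rewrite addr0 => /eqP; rewrite -subr_eq subrr eq_sym => /eqP. Qed.

Let vZ m i a x : v m i (a *: x) = a * v m i x.
Proof. by have := v_lin m i a x 0; rewrite v0 !addr0. Qed.

Lemma diag_meanD m V W : diag_mean m (V + W) = diag_mean m V + diag_mean m W.
Proof.
by rewrite /diag_mean -mulrDr -big_split/=; congr (_ * _); apply: eq_bigr => i _; exact: vD.
Qed.

Lemma diag_meanZ m a V : diag_mean m (a *: V) = a * diag_mean m V.
Proof.
rewrite /diag_mean mulrCA; congr (_ * _); rewrite mulr_sumr.
by apply: eq_bigr => i _; exact: vZ.
Qed.

Let C0 : 0 <= C. Proof. exact: le_trans (u_le (k0 0)). Qed.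

Lemma diag_mean_le m V : `|diag_mean m V| <= C ^+ 2 * `|V|.
Proof.
rewrite normrM normfV normr_nat ler_pdivrMl ?ltr0n//.
apply: (le_trans (ler_norm_sum _ _ _)).
apply: (@le_trans _ _ (\sum_(i < k m) C ^+ 2 * `|V|)); last first.
  by rewrite sumr_const card_ord -[leLHS]mulr_natl.
apply: ler_sum => i _; apply: (le_trans (v_le _ (ltn_ord i))).
rewrite expr2 -mulrA ler_wpM2l//; apply: (le_trans (le_opnorm V _)).
by rewrite mulrC ler_wpM2r ?opnorm_ge0// u_le.
Qed.

Definition vanishing_ideal (A : set R) : set (bop X) :=
  [set V | forall a, A a -> forall (S T : bop X) e, 0 < e ->
    exists n0, forall m, (n0 <= m)%N -> slope_set a m ->
      `|diag_mean m (S * V * T)| <= e].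

(** Topological closedness rests on [diag_mean_le], whose constant does not depend on [m]; the
    factors [S] and [T] in the definition absorb multiplication on either side. *)
Lemma vanishing_ideal_closed A : closed_ideals X (vanishing_ideal A).
Proof.
split.
- rewrite closure_id; apply/seteqP; split; first exact: subset_closure.
  move=> V clV a Aa S T e e0.
  pose M := C ^+ 2 * (`|S| * `|T|) + 1.
  have M0 : 0 < M by rewrite ltr_pwDr// mulr_ge0 ?sqr_ge0// mulr_ge0.
  have : nbhs V (ball V (e / 2 / M)).
    by apply: nbhsx_ballx; rewrite !divr_gt0.
  move=> /clV[W [AW]]; rewrite -ball_normE/= => WV.
  have [n0 n0P] := AW a Aa S T (e / 2) (divr_gt0 e0 (ltr0n _ 2)).
  exists n0 => m /n0P mP /mP{}mP.
  have -> : V = W + (V - W) by rewrite addrC subrK.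
  rewrite mulrDr mulrDl diag_meanD; apply: (le_trans (ler_normD _ _)).
  rewrite [leRHS](splitr e); apply: lerD => //.
  apply: (le_trans (diag_mean_le _ _)).
  have opM (P Q : bop X) : `|P * Q| <= `|P| * `|Q|.
    apply: ge_sup; first by exists `|(P * Q) 0|; exists 0 => //=; rewrite normr0.
    move=> _ [x /= x1 <-]; apply: (le_trans (le_opnorm P _)).
    rewrite ler_wpM2l ?opnorm_ge0//; apply: (le_trans (le_opnorm Q _)).
    by rewrite ler_piMr// opnorm_ge0.
  apply: (@le_trans _ _ (C ^+ 2 * (`|S| * `|T|) * `|V - W|)).
    rewrite -[leRHS]mulrA ler_wpM2l ?sqr_ge0//; apply: (le_trans (opM _ _)).
    by rewrite [leRHS]mulrAC ler_wpM2r.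
  apply: (@le_trans _ _ (M * `|V - W|)); first by rewrite ler_wpM2r// lerDl.
  by rewrite mulrC -ler_pdivlMr// ltW.
- move=> a _ S T e e0; exists 0%N => m _ _.
  by rewrite mulr0 mul0r -(scale0r 0) diag_meanZ mul0r normr0 ltW.
- move=> V W AV AW a Aa S T e e0.
  have [n1 P1] := AV a Aa S T (e / 2) (divr_gt0 e0 (ltr0n _ 2)).
  have [n2 P2] := AW a Aa S T (e / 2) (divr_gt0 e0 (ltr0n _ 2)).
  exists (maxn n1 n2) => m; rewrite geq_max => /andP[/P1 m1 /P2 m2] am.
  rewrite mulrDr mulrDl diag_meanD; apply: (le_trans (ler_normD _ _)).
  by rewrite [leRHS](splitr e); apply: lerD; [exact: m1|exact: m2].
- move=> b V AV a Aa S T e e0.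
  have b0 : 0 < `|b| + 1 by rewrite ltr_wpDl.
  have [n1 P1] := AV a Aa S T (e / (`|b| + 1)) (divr_gt0 e0 b0).
  exists n1 => m /P1 m1 /m1{}m1.
  have -> : S * (b *: V) * T = b *: (S * V * T).
    by apply/bopP => x; rewrite /= linearZ.
  rewrite diag_meanZ normrM; apply: (@le_trans _ _ ((`|b| + 1) * `|diag_mean m (S * V * T)|)).
    by rewrite ler_wpM2r// lerDl.
  by rewrite mulrC -ler_pdivlMr.
- move=> P V AV; split=> a Aa S T e e0.
    by have := AV a Aa (S * P) T e e0; rewrite !mulrA.
  by have := AV a Aa S (P * T) e e0; rewrite !mulrA.
Qed.

Variable diag : set nat -> bop X.
Hypothesis diag1 : forall N m, N m -> diag_mean m (diag N) = 1.
Hypothesis diag0 : forall N (S T : bop X) e, 0 < e -> exists n0, forall m,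
  (n0 <= m)%N -> ~ N m -> `|diag_mean m (S * diag N * T)| <= e.

(** If [b] is in [A], then [S = T = 1] gives the mean 1 infinitely often. Otherwise the slope set of
    each [a] in [A] eventually avoids that of [b], where [diag0] applies. *)
Lemma diag_vanishing A (b : R) : vanishing_ideal A (diag (slope_set b)) <-> ~ A b.
Proof.
split=> [AV Ab|Ab a Aa S T e e0].
  have [n0 n0P] := AV b Ab 1 1 (1 / 2) (divr_gt0 ltr01 (ltr0n _ 2)).
  have [m /n0P mP bm] := slope_set_unbounded b n0.
  have := mP bm; rewrite mul1r mulr1 diag1// normr1; lra.
have /slope_set_disjoint[n1 P1] : a != b by apply/eqP => ab; apply: Ab; rewrite -ab.
have [n0 n0P] := diag0 (slope_set b) S T e0.
exists (maxn n0 n1) => m; rewrite geq_max => /andP[/n0P mP /P1 m1] /m1.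
exact: mP.
Qed.

Lemma closed_ideals_ge : [set: set R] #<= closed_ideals X.
Proof.
apply: (@inj_card_leP _ _ _ _ vanishing_ideal) => [A B _ _ AB|A _].
  apply/seteqP; split=> b; apply: contraPP.
    by move=> /(diag_vanishing B); rewrite -AB => /(diag_vanishing A).
  by move=> /(diag_vanishing A); rewrite AB => /(diag_vanishing B).
exact: vanishing_ideal_closed.
Qed.

End many_ideals.

(** * Block-diagonal operators factoring through l_2 *)

Section diagonal_operators.
Context {R : realType} {X : normedModType R}.
Hypothesis X_complete : forall w : nat -> X, cauchy (w n @[n --> \oo]) -> cvgn w.
Variables (k : nat -> nat) (al : nat -> nat -> X -> R) (be : nat -> nat -> X).
Variables (Ca Cb : R).
Hypotheses (Ca0 : 0 <= Ca) (Cb0 : 0 < Cb).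
Hypothesis al_lin : forall n j a x y,
  al n j (a *: x + y) = a * al n j x + al n j y.
Hypothesis al_le : forall L x,
  \sum_(n < L) \sum_(j < k n) al n j x ^+ 2 <= Ca * `|x| ^+ 2.
Hypothesis be_le : forall L (y : nat -> nat -> R),
  `|\sum_(n < L) \sum_(j < k n) y n j *: be n j| ^+ 2 <=
  Cb * \sum_(n < L) \sum_(j < k n) y n j ^+ 2.

Definition diag_term (N : set nat) x n : X :=
  \sum_(j < k n) ((n \in N)%:R * al n j x) *: be n j.

Let be_le' n1 n2 (y : nat -> nat -> R) :
  `|\sum_(n1 <= n < n2) \sum_(j < k n) y n j *: be n j| ^+ 2 <=
  Cb * \sum_(n1 <= n < n2) \sum_(j < k n) y n j ^+ 2.
Proof.
have [n12|n21] := leqP n1 n2; last first.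
  by rewrite !big_geq ?(ltnW n21)// normr0 expr0n mulr0.
have e (V : nmodType) (F : nat -> V) : (forall n, (n < n1)%N -> F n = 0) ->
    \sum_(n < n2) F n = \sum_(n1 <= n < n2) F n.
  move=> F0; rewrite -(big_mkord xpredT F) (big_cat_nat (leq0n _) n12)/=.
  rewrite big_nat_cond big1 ?add0r// => n; rewrite andbT => /andP[_]; exact: F0.
have := be_le n2 (fun n j => (n1 <= n)%N%:R * y n j).
rewrite (e _ (fun n => \sum_(j < k n) ((n1 <= n)%N%:R * y n j) *: be n j)); last first.
  by move=> n; rewrite ltnNge => /negbTE ->; apply: big1 => j _; rewrite mul0r scale0r.
rewrite (e _ (fun n => \sum_(j < k n) ((n1 <= n)%N%:R * y n j) ^+ 2)); last first.
  by move=> n; rewrite ltnNge => /negbTE ->; apply: big1 => j _; rewrite mul0r expr0n.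
rewrite (@eq_big_nat _ _ _ _ _ _ (fun n => \sum_(j < k n) y n j *: be n j)); last first.
  by move=> n /andP[-> _]; apply: eq_bigr => j _; rewrite mul1r.
rewrite (@eq_big_nat _ _ _ _ _ _ (fun n => \sum_(j < k n) y n j ^+ 2)); last first.
  by move=> n /andP[-> _]; apply: eq_bigr => j _; rewrite mul1r.
by [].
Qed.

Let term_le N x n1 n2 :
  `|\sum_(n1 <= n < n2) diag_term N x n| ^+ 2 <=
  Cb * \sum_(n1 <= n < n2) \sum_(j < k n) al n j x ^+ 2.
Proof.
apply: (le_trans (be_le' n1 n2 (fun n j => (n \in N)%:R * al n j x))).
rewrite ler_wpM2l ?(ltW Cb0)//; apply: ler_sum => n _; apply: ler_sum => j _.
by case: (n \in N); rewrite ?mul1r// mul0r expr0n sqr_ge0.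
Qed.

(** [al] maps boundedly into l_2 and [be] boundedly out of it, so a piece of the series is
    controlled by the same piece of a convergent series of squares. This holds for every [N], since
    [N] merely erases terms. *)
Lemma diag_series_cvg N x : cvgn (series (diag_term N x)).
Proof.
apply: X_complete; apply/cauchy_seriesP => e e0.
pose a n := \sum_(j < k n) al n j x ^+ 2.
have : cvgn (series a).
  apply: nondecreasing_is_cvgn.
    apply/nondecreasing_seqP => n; rewrite !seriesEnat/= big_nat_recr//= lerDl.
    by apply: sumr_ge0 => j _; exact: sqr_ge0.
  by exists (Ca * `|x| ^+ 2) => _ [n _ <-]; rewrite seriesEord; exact: al_le.
move=> /cvg_cauchy/cauchy_seriesP/(_ (e ^+ 2 / Cb) (divr_gt0 (exprn_gt0 2 e0) Cb0)).
apply: filterS => -[n1 n2]/=.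
rewrite ger0_norm; last first.
  by apply: sumr_ge0 => n _; apply: sumr_ge0 => j _; exact: sqr_ge0.
rewrite ltr_pdivlMr// mulrC => /(le_lt_trans (term_le N x n1 n2)).
by rewrite ltr_pXn2r// nnegrE// ltW.
Qed.

Definition diag_fun N x : X := limn (series (diag_term N x)).

Lemma diag_fun_cvg N x : series (diag_term N x) n @[n --> \oo] --> diag_fun N x.
Proof. exact: diag_series_cvg. Qed.

Lemma diag_fun_bounded N : diag_fun N \in bounded_operator (V := X).
Proof.
apply/asboolP; split=> [a x y|].
  apply: cvg_lim => //.
  have -> : series (diag_term N (a *: x + y)) =
      (fun n => a *: series (diag_term N x) n + series (diag_term N y) n).
    apply/funext => n; rewrite !seriesEord scaler_sumr -big_split/=.
    apply: eq_bigr => i _; rewrite scaler_sumr -big_split/=.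
    apply: eq_bigr => j _; rewrite al_lin scalerA -scalerDl; congr (_ *: _); ring.
  by apply: cvgD; [apply: cvgZr|]; exact: diag_fun_cvg.
exists (Num.sqrt (Cb * Ca)) => x.
have nT : `|series (diag_term N x) n| @[n --> \oo] --> `|diag_fun N x|.
  by apply: cvg_norm; exact: diag_fun_cvg.
have := limr_le (cvgP _ nT); rewrite (cvg_lim _ nT)//; apply.
near=> n; have := term_le N x 0 n; rewrite !big_mkord.
rewrite seriesEord/= => H.
have := le_trans H (ler_wpM2l (ltW Cb0) (al_le n x)).
rewrite mulrA => {}H.
rewrite -(@ler_pXn2r _ 2) ?nnegrE ?mulr_ge0 ?sqrtr_ge0// exprMn.
by rewrite sqr_sqrtr// mulr_ge0// ltW.
Unshelve. all: by end_near. Qed.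

Definition diag_op N : bop X := Bop (diag_fun_bounded N).

Variables (u : nat -> nat -> X) (v : nat -> nat -> X -> R) (C : R).
Hypothesis k0 : forall m, (0 < k m)%N.
Hypothesis v_lin : forall m i a x y, v m i (a *: x + y) = a * v m i x + v m i y.
Hypothesis v_le : forall m i x, (i < k m)%N -> `|v m i x| <= C * `|x|.
Hypothesis biorth : forall m i n j, (i < k m)%N -> (j < k n)%N ->
  al n j (u m i) * v m i (be n j) = ((n == m) && (j == i))%:R.

Let vD m i x y : v m i (x + y) = v m i x + v m i y.
Proof. by have := v_lin m i 1 x y; rewrite scale1r mul1r. Qed.

Let v0 m i : v m i 0 = 0.
Proof. by have := vD m i 0 0; rewrite addr0 => /eqP; rewrite -subr_eq subrr eq_sym => /eqP. Qed.

Let vZ m i a x : v m i (a *: x) = a * v m i x.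
Proof. by have := v_lin m i a x 0; rewrite v0 !addr0. Qed.

Let vN m i x : v m i (- x) = - v m i x.
Proof. by rewrite -scaleN1r vZ mulN1r. Qed.

Let v_sum m i (I : Type) (r : seq I) (P : pred I) (F : I -> X) :
  v m i (\sum_(l <- r | P l) F l) = \sum_(l <- r | P l) v m i (F l).
Proof. by apply: (big_morph (v m i)) => [x y|]; [exact: vD|exact: v0]. Qed.

(** [v] and [S] are continuous, so the mean is a limit of finite sums, to which a matrix estimate
    uniform in [L] applies. *)
Lemma diag_mean_series (N : set nat) (S T : bop X) m :
  (k m)%:R^-1 * (\sum_(i < k m) \sum_(n < L) \sum_(j < k n)
    ((n : nat) \in N)%:R * al n j (T (u m i)) * v m i (S (be n j)))
  @[L --> \oo] --> diag_mean k u v m (S * diag_op N * T).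
Proof.
apply: cvgMr.
have -> : (fun L => \sum_(i < k m) \sum_(n < L) \sum_(j < k n)
    ((n : nat) \in N)%:R * al n j (T (u m i)) * v m i (S (be n j))) =
  (fun L => \sum_(i < k m) v m i (S (series (diag_term N (T (u m i))) L))).
  apply/funext => L; apply: eq_bigr => i _; rewrite seriesEord/= linear_sum v_sum.
  apply: eq_bigr => n _; rewrite linear_sum v_sum; apply: eq_bigr => j _.
  by rewrite linearZ vZ.
apply: cvg_big => [|i _]; first exact: add_continuous. apply/cvgrPdist_le => e e0.
pose M := `|C| * opnorm S + 1.
have M0 : 0 < M by rewrite ltr_wpDl// mulr_ge0// opnorm_ge0.
have /cvgrPdist_le/(_ _ (divr_gt0 e0 M0)) := @diag_fun_cvg N (T (u m i)).
apply: filterS => L H.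
have -> : v m i ((S * diag_op N * T) (u m i)) -
    v m i (S (series (diag_term N (T (u m i))) L)) =
    v m i (S (diag_fun N (T (u m i)) - series (diag_term N (T (u m i))) L)).
  by rewrite linearB vD vN.
apply: (le_trans (v_le _ (ltn_ord i))).
apply: (@le_trans _ _ (M * `|diag_fun N (T (u m i)) - series (diag_term N (T (u m i))) L|)); last first.
  by rewrite mulrC -ler_pdivlMr.
apply: (@le_trans _ _ (`|C| * opnorm S * `|diag_fun N (T (u m i)) - series (diag_term N (T (u m i))) L|)).
  apply: (@le_trans _ _ (`|C| * `|S (diag_fun N (T (u m i)) -
      series (diag_term N (T (u m i))) L)|)); first by rewrite ler_wpM2r// ler_norm.
  by rewrite -mulrA ler_wpM2l//; exact: le_opnorm.
by rewrite ler_wpM2r// lerDl.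
Qed.

Lemma diag_mean_diag1 (N : set nat) m : N m -> diag_mean k u v m (diag_op N) = 1.
Proof.
move=> Nm; have := @diag_mean_series N 1 1 m; rewrite mul1r mulr1 => H.
rewrite -(cvg_lim _ H)//; apply: lim_near_cst => //.
(* From [L = m + 1] on, block [m] is present and biorthogonality kills all other blocks, so the
   sequence is constant. *)
exists m.+1 => // L /= mL.
rewrite (eq_bigr (fun=> 1)) => [|i _].
  by rewrite sumr_const card_ord mulVf// pnatr_eq0 -lt0n.
rewrite (bigD1 (Ordinal mL))//= (bigD1 i)//= mem_set// mul1r biorth// !eqxx.
rewrite big1 ?addr0 => [|j]; last first.
  by rewrite -val_eqE/= => /negbTE ji; rewrite mul1r biorth// ji andbF.
rewrite big1 ?addr0// => n; rewrite -val_eqE/= => /negbTE nm.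
by apply: big1 => j _; rewrite -mulrA biorth// nm mulr0.
Qed.

Hypothesis estimate : exists2 eta : nat -> R, eta n @[n --> \oo] --> 0 &
  forall S T : bop X, exists2 K : R, 0 <= K & forall m L (N : set nat), ~ N m ->
  `|\sum_(i < k m) \sum_(n < L) \sum_(j < k n)
    ((n : nat) \in N)%:R * al n j (T (u m i)) * v m i (S (be n j))| <=
  (k m)%:R * (K * eta m).

Lemma diag_mean_diag0 (N : set nat) (S T : bop X) e : 0 < e -> exists n0, forall m,
  (n0 <= m)%N -> ~ N m -> `|diag_mean k u v m (S * diag_op N * T)| <= e.
Proof.
move=> e0; have [eta eta0 /(_ S T)[K K0 H]] := estimate.
have K1 : 0 < K + 1 by rewrite ltr_wpDl.
have [n0 _ n0P] := (cvgrPdist_le eta 0).1 eta0 (e / (K + 1)) (divr_gt0 e0 K1).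
exists n0 => m /n0P /=; rewrite sub0r normrN ler_pdivlMr// => etae Nm.
have := @diag_mean_series N S T m; set f := (fun L => _ * _) => fT.
have nT : `|f L| @[L --> \oo] --> `|diag_mean k u v m (S * diag_op N * T)|.
  by apply: cvg_norm.
have := limr_le (cvgP _ nT); rewrite (cvg_lim _ nT)//; apply.
apply: nearW => L; rewrite /f normrM normfV normr_nat ler_pdivrMl ?ltr0n//.
apply: (le_trans (H _ _ _ Nm)); rewrite ler_wpM2l//.
apply: (le_trans (ler_norm _)); rewrite normrM (ger0_norm K0) mulrC.
by apply: le_trans etae; rewrite ler_wpM2l// lerDl.
Qed.

Hypothesis u_le : forall m i, (i < k m)%N -> `|u m i| <= C.

Lemma closed_ideals_ge_of_estimate : [set: set R] #<= closed_ideals X.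
Proof.
exact: (closed_ideals_ge k0 v_lin v_le u_le diag_mean_diag1 diag_mean_diag0).
Qed.

End diagonal_operators.

(** * L_p of a probability space *)

Section bounded_functions.
Context {d : measure_display} {T : measurableType d} {R : realType}.

(** Such functions are stable under sums and products and lie in every L_p of a probability space;
    all explicit functions below get their integrability from this predicate. *)
Definition bfun (h : T -> R) :=
  measurable_fun setT h /\ exists M : R, forall x, `|h x| <= M.

Lemma bfun_cst (a : R) : bfun (cst a).
Proof. by split; [exact: measurable_cst|exists `|a|]. Qed.

Lemma bfunD (f g : T -> R) : bfun f -> bfun g -> bfun (fun x => f x + g x).
Proof.
move=> [mf [M fM]] [mg [N gN]]; split; first exact: measurable_funD.
by exists (M + N) => x; rewrite (le_trans (ler_normD _ _))// lerD.
Qed.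

Lemma bfunM (f g : T -> R) : bfun f -> bfun g -> bfun (fun x => f x * g x).
Proof.
move=> [mf [M fM]] [mg [N gN]]; split; first exact: measurable_funM.
by exists (M * N) => x; rewrite normrM ler_pM.
Qed.

Lemma bfunZ (a : R) (g : T -> R) : bfun g -> bfun (fun x => a * g x).
Proof. exact: (bfunM (bfun_cst a)). Qed.

Lemma bfun_sum (I : Type) (r : seq I) (P : pred I) (F : I -> T -> R) :
  (forall i, bfun (F i)) -> bfun (fun x => \sum_(i <- r | P i) F i x).
Proof.
move=> bF; elim: r => [|i r IH].
  by under eq_fun do rewrite big_nil; exact: bfun_cst.
under eq_fun do rewrite big_cons; case: (P i) => //; exact: bfunD.
Qed.

Lemma bfun_powR (f : T -> R) q : 0 < q -> bfun f -> bfun (fun x => `|f x| `^ q).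
Proof.
move=> q0 [mf [M fM]]; split.
  apply: (measurableT_comp (measurable_powR _)); exact: measurableT_comp.
exists (M `^ q) => x; rewrite ger0_norm ?powR_ge0//.
apply: ge0_ler_powR; rewrite ?nnegrE ?(ltW q0)//.
exact: le_trans (fM x).
Qed.

Lemma bfun_bounded (h : T -> R) : bfun h -> [bounded h x | x in setT].
Proof.
move=> [_ [M hM]]; exists M; split; first exact: num_real.
by move=> y My x _; exact: le_trans (hM x) (ltW My).
Qed.

End bounded_functions.

Section Lp_of_probability.
Context {d : measure_display} {T : measurableType d} {R : realType}.
Variable mu : {measure set T -> \bar R}.
Hypothesis mu1 : mu setT = 1%E.

Lemma bfun_integrable (h : T -> R) : bfun h -> mu.-integrable setT (EFin \o h).
Proof.
move=> bh; apply: measurable_bounded_integrable => //.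
- by rewrite mu1 ltry.
- by have [] := bh.
- exact: bfun_bounded.
Qed.

Lemma bRintegralD (f g : T -> R) : bfun f -> bfun g ->
  \int[mu]_x (f x + g x) = \int[mu]_x f x + \int[mu]_x g x.
Proof. by move=> bf bg; apply: RintegralD => //; exact: bfun_integrable. Qed.

Lemma bRintegralZ (a : R) (f : T -> R) : bfun f ->
  \int[mu]_x (a * f x) = a * \int[mu]_x f x.
Proof. by move=> bf; apply: RintegralZl => //; exact: bfun_integrable. Qed.

Lemma bRintegral_cst (a : R) : \int[mu]_x a = a.
Proof. by rewrite Rintegral_cst// mu1 mulr1. Qed.

Lemma bRintegral_sum (I : Type) (r : seq I) (P : pred I) (F : I -> T -> R) :
  (forall i, bfun (F i)) ->
  \int[mu]_x (\sum_(i <- r | P i) F i x) = \sum_(i <- r | P i) \int[mu]_x F i x.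
Proof.
move=> bF; elim: r => [|i r IH].
  rewrite big_nil -[RHS]bRintegral_cst.
  by apply: eq_Rintegral => x _; rewrite big_nil.
rewrite big_cons; under eq_Rintegral do rewrite big_cons.
case: (P i) => //; rewrite bRintegralD ?IH//; exact: bfun_sum.
Qed.

Lemma ler_bRintegral (f g : T -> R) : bfun f -> bfun g ->
  (forall x, f x <= g x) -> \int[mu]_x f x <= \int[mu]_x g x.
Proof.
move=> bf bg fg.
by apply: le_Rintegral => //; exact: bfun_integrable.
Qed.

Section exponent.
Variables (p : R) (p1 : (1%:E <= p%:E)%E).
Local Notation X := (LspaceType mu p1).

Let p0 : 0 < p.
Proof. by move: p1; rewrite lee_fin; apply: lt_le_trans. Qed.

Lemma bfun_Lfun (h : T -> R) : bfun h -> h \in Lfun mu p%:E.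
Proof.
move=> bh; have [mh _] := bh; rewrite inE; apply/andP; split; rewrite inE//.
rewrite /finite_norm/= unlock/=; apply: poweR_lty.
have := bfun_integrable (bfun_powR p0 bh) => /integrableP[_].
apply: le_lt_trans; rewrite le_eqVlt; apply/orP; left; apply/eqP.
by apply: eq_integral => x _ /=; congr EFin; apply/esym/ger0_norm/powR_ge0.
Qed.

(** Total, with default value 0, so that classes of explicit functions are written without carrying
    membership proofs. *)
Definition Lcls (h : T -> R) : X :=
  if pselect (h \in Lfun mu p%:E) is left Ph then Lclass (Lfun_Sub p1 Ph) else 0.

Lemma LclsE (f : LfunType mu p1) : Lcls f = Lclass f.
Proof.
rewrite /Lcls; case: pselect => [Pf|]; last by case; exact: LfunP.
by congr Lclass; apply/val_inj.
Qed.

Lemma Lcls_Sub (f : T -> R) (Pf : f \in Lfun mu p%:E) :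
  Lcls f = Lclass (Lfun_Sub p1 Pf).
Proof. by rewrite -LclsE. Qed.

Lemma Lrepr_Lcls (h : T -> R) : h \in Lfun mu p%:E ->
  (Lrepr (Lcls h) : T -> R) = h %[ae mu].
Proof. by move=> Ph; rewrite (Lcls_Sub Ph); exact: LclassK. Qed.

Lemma Lcls_lin (a : R) (f g : T -> R) :
  f \in Lfun mu p%:E -> g \in Lfun mu p%:E ->
  Lcls (fun x => a * f x + g x) = a *: Lcls f + Lcls g.
Proof.
move=> Pf Pg; rewrite (Lcls_Sub Pf) (Lcls_Sub Pg).
rewrite -[RHS]/(Ladd (Lscale a (Lclass (Lfun_Sub p1 Pf))) _) LclassZ LclassD -LclsE.
by congr Lcls.
Qed.

Lemma Lcls0 : Lcls (cst 0) = 0.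
Proof. by rewrite -[cst 0]/((0 : LfunType mu p1) : T -> R) LclsE. Qed.

Lemma LclsZ (a : R) (f : T -> R) : bfun f -> Lcls (fun x => a * f x) = a *: Lcls f.
Proof.
move=> bf; rewrite -[RHS]addr0 -Lcls0 -Lcls_lin; last 2 first.
- exact: bfun_Lfun.
- exact/bfun_Lfun/bfun_cst.
by congr Lcls; apply/funext => x; rewrite addr0.
Qed.

Lemma LclsD (f g : T -> R) : bfun f -> bfun g ->
  Lcls (fun x => f x + g x) = Lcls f + Lcls g.
Proof.
move=> bf bg; rewrite -[Lcls f]scale1r -Lcls_lin; try exact: bfun_Lfun.
by congr Lcls; apply/funext => x; rewrite mul1r.
Qed.

Lemma Lcls_sum (I : Type) (r : seq I) (P : pred I) (F : I -> T -> R) :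
  (forall i, bfun (F i)) ->
  Lcls (fun x => \sum_(i <- r | P i) F i x) = \sum_(i <- r | P i) Lcls (F i).
Proof.
move=> bF; elim: r => [|i r IH].
  rewrite big_nil -Lcls0; congr Lcls.
  by apply/funext => x; rewrite big_nil.
rewrite big_cons (_ : (fun x => _) = (fun x => if P i
  then F i x + \sum_(j <- r | P j) F j x else \sum_(j <- r | P j) F j x)).
  case: (P i) => //; rewrite LclsD ?IH//; exact: bfun_sum.
by apply/funext => x; rewrite big_cons.
Qed.

Lemma LreprK' (x : X) : Lcls (Lrepr x) = x.
Proof. by rewrite LclsE LreprK. Qed.

Lemma norm_Lcls (h : T -> R) : h \in Lfun mu p%:E ->
  `|Lcls h| = (\int[mu]_x `|h x| `^ p) `^ p^-1.
Proof.
move=> Ph; rewrite (Lcls_Sub Ph).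
have -> : `|Lclass (Lfun_Sub p1 Ph)| = Lpnorm (Lclass (Lfun_Sub p1 Ph)) by [].
rewrite Lpnorm_class unlock/= -fine_poweR; congr (fine (_ `^ _)%E).
Qed.

Lemma norm_Lcls_le (h : T -> R) (a : R) : h \in Lfun mu p%:E -> 0 <= a ->
  \int[mu]_x `|h x| `^ p <= a `^ p -> `|Lcls h| <= a.
Proof.
move=> Ph a0 ha; rewrite norm_Lcls// -[leRHS]powRr1// -(@mulfV _ p) ?gt_eqF//.
rewrite powRrM; apply: ge0_ler_powR; rewrite ?nnegrE ?invr_ge0 ?(ltW p0) ?powR_ge0//.
by apply: Rintegral_ge0 => x _; exact: powR_ge0.
Qed.

(** For bounded [h] the integral is finite, because L_p lies in L_1 on a probability space, and it
    depends only on the class of the representative. *)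
Definition Lpair (x : X) (h : T -> R) : R := \int[mu]_t (Lrepr x t * h t).

Let Lfun_prod_integrable (f h : T -> R) : f \in Lfun mu p%:E -> bfun h ->
  mu.-integrable setT (EFin \o (fun t => f t * h t)).
Proof.
move=> Pf bh; have f1 : f \in Lfun mu 1.
  by apply: Lfun_subset Pf => //; rewrite mu1.
have /Lfun1_integrable fi := f1.
have [mh _] := bh.
by have := integrableMl measurableT fi mh (bfun_bounded bh).
Qed.

Let Lpair_ae (f : T -> R) (x : X) (h : T -> R) : f \in Lfun mu p%:E ->
  (Lrepr x : T -> R) = f %[ae mu] -> bfun h ->
  Lpair x h = \int[mu]_t (f t * h t).
Proof.
move=> Pf xf bh; congr fine; apply: ae_eq_integral => //.
- have /integrableP[] // := Lfun_prod_integrable (LfunP (Lrepr x)) bh.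
- by have /integrableP[] := Lfun_prod_integrable Pf bh.
- by apply: filterS xf => t /(_ I)/= ft _; rewrite ft.
Qed.

Lemma Lpair_Lcls (f h : T -> R) : bfun f -> bfun h ->
  Lpair (Lcls f) h = \int[mu]_t (f t * h t).
Proof.
move=> bf bh; apply: Lpair_ae => //; first exact: bfun_Lfun.
exact/Lrepr_Lcls/bfun_Lfun.
Qed.

Lemma Lpair_lin (a : R) (x y : X) (h : T -> R) : bfun h ->
  Lpair (a *: x + y) h = a * Lpair x h + Lpair y h.
Proof.
move=> bh; have Px := LfunP (Lrepr x); have Py := LfunP (Lrepr y).
have -> : a *: x + y = Lcls (fun t => a * Lrepr x t + Lrepr y t).
  by rewrite Lcls_lin// !LreprK'.
have Pxy : (fun t => a * Lrepr x t + Lrepr y t) \in Lfun mu p%:E.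
  exact: (LfunP (a *: Lrepr x + Lrepr y)).
rewrite (Lpair_ae Pxy)//; last exact: Lrepr_Lcls.
have ix := Lfun_prod_integrable Px bh; have iy := Lfun_prod_integrable Py bh.
rewrite /Lpair -RintegralZl// -RintegralD//; last first.
  by apply: eq_integrable (integrableZl measurableT a ix).
by apply: eq_Rintegral => t _; ring.
Qed.

Lemma Lpair_linr (a : R) (x : X) (f h : T -> R) : bfun f -> bfun h ->
  Lpair x (fun t => a * f t + h t) = a * Lpair x f + Lpair x h.
Proof.
move=> bf bh; have Px := LfunP (Lrepr x).
have i1 := Lfun_prod_integrable Px bf; have i2 := Lfun_prod_integrable Px bh.
rewrite /Lpair -RintegralZl// -RintegralD//; last first.
  by apply: eq_integrable (integrableZl measurableT a i1).
by apply: eq_Rintegral => t _; ring.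
Qed.

Lemma Lpair_sumr (I : Type) (r : seq I) (c : I -> R) (F : I -> T -> R) (x : X) :
  (forall i, bfun (F i)) ->
  Lpair x (fun t => \sum_(i <- r) c i * F i t) = \sum_(i <- r) c i * Lpair x (F i).
Proof.
move=> bF; elim: r => [|i r IH].
  rewrite big_nil /Lpair -[RHS]bRintegral_cst.
  by apply: eq_Rintegral => t _; rewrite big_nil mulr0.
rewrite big_cons -IH -Lpair_linr//; last by apply: bfun_sum => j; exact: bfunZ.
by congr (Lpair x); apply/funext => t; rewrite big_cons.
Qed.

Lemma Lpair_le (q : R) (x : X) (h : T -> R) : 0 < q -> p^-1 + q^-1 = 1 ->
  bfun h -> `|Lpair x h| <= `|x| * (\int[mu]_t `|h t| `^ q) `^ q^-1.
Proof.
move=> q0 pq bh; have Px := LfunP (Lrepr x); have [mh _] := bh.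
have ix := Lfun_prod_integrable Px bh.
apply: le_trans (le_normr_Rintegral measurableT ix) _.
have mx : measurable_fun setT (Lrepr x) by exact: measurable_funPT.
have H := hoelder mu mx mh p0 q0 pq.
rewrite -lee_fin EFinM.
have -> : (`|x|)%:E = Lnorm mu p%:E (EFin \o (Lrepr x : T -> R)).
  by rewrite -finite_norm_fine.
have -> : ((\int[mu]_t `|h t| `^ q) `^ q^-1)%:E = Lnorm mu q%:E (EFin \o h).
  rewrite unlock/= -poweR_EFin; congr (_ `^ _)%E.
  rewrite fineK; last first.
    by apply: integrable_fin_num => //; exact: bfun_integrable (bfun_powR q0 bh).
  by apply: eq_integral.
apply: le_trans H; rewrite Lnorm1 fineK; last first.
  apply: integrable_fin_num => //.
  by apply: eq_integrable (integrable_abse ix).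
by rewrite le_eqVlt; apply/orP; left; apply/eqP/eq_integral.
Qed.

Lemma Lpair_le_of (q : R) (x : X) (h : T -> R) (a : R) : 0 < q -> p^-1 + q^-1 = 1 ->
  bfun h -> 0 <= a -> \int[mu]_t `|h t| `^ q <= a `^ q -> `|Lpair x h| <= `|x| * a.
Proof.
move=> q0 pq bh a0 ha; apply: (le_trans (Lpair_le x q0 pq bh)); rewrite ler_wpM2l//.
rewrite -[leRHS]powRr1// -(@mulfV _ q) ?gt_eqF//.
rewrite powRrM; apply: ge0_ler_powR; rewrite ?nnegrE ?invr_ge0 ?(ltW q0) ?powR_ge0//.
by apply: Rintegral_ge0 => t _; exact: powR_ge0.
Qed.

End exponent.
End Lp_of_probability.

Lemma cvg_powR {R : realType} (p : R) (u : nat -> R) (l : R) : 0 < p ->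
  (forall n, 0 <= u n) -> u n @[n --> \oo] --> l ->
  u n `^ p @[n --> \oo] --> l `^ p.
Proof.
move=> p0 u0 ul; have l0 : 0 <= l.
  rewrite -(cvg_lim _ ul)//; apply: limr_ge; first exact: cvgP ul.
  exact: nearW.
(* For [p < 1] the power is not differentiable at 0; at the limit 0 the tolerance [e ^ (1/p)] works
   directly for every [p]. *)
have [l0'|l0'] := eqVneq l 0.
  rewrite l0' powR0 ?gt_eqF//; rewrite l0' in ul.
  apply/cvgrPdist_le => e e0; have e1 : 0 < e `^ p^-1 by rewrite powR_gt0.
  move/cvgrPdist_le : ul => /(_ _ e1); apply: filterS => n.
  rewrite !sub0r !normrN ger0_norm// ger0_norm ?powR_ge0// => une.
  rewrite -[leRHS]powRr1 ?(ltW e0)// -(@mulVf _ p) ?gt_eqF// powRrM.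
  by apply: ge0_ler_powR; rewrite ?nnegrE ?powR_ge0 ?(ltW p0).
have lp : 0 < l by rewrite lt_neqAle eq_sym l0'.
suff pc : {for l, continuous (fun x => x `^ p)}.
  exact: (@continuous_cvg _ _ _ _ _ _ _ _ pc ul).
apply: differentiable_continuous; apply/derivable1_diffP.
by apply: derivable_powR; rewrite in_itv/= andbT.
Qed.

(** * Completeness of L_p (Riesz-Fischer) *)

Section completeness.
Context {d : measure_display} {T : measurableType d} {R : realType}.
Variable mu : {measure set T -> \bar R}.
Hypothesis mu1 : mu setT = 1%E.
Variables (p : R) (p1 : (1%:E <= p%:E)%E).
Hypothesis p_gt1 : 1 < p.
Local Notation X := (LspaceType mu p1).

Let p0 : 0 < p. Proof. exact: lt_trans p_gt1. Qed.

Let Lfun_sub (f g : T -> R) : f \in Lfun mu p%:E -> g \in Lfun mu p%:E ->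
  (fun t => f t - g t) \in Lfun mu p%:E.
Proof. by move=> Pf Pg; exact: (LfunP (Lfun_Sub p1 Pf - Lfun_Sub p1 Pg)). Qed.

Let Lcls_sub (f g : T -> R) : f \in Lfun mu p%:E -> g \in Lfun mu p%:E ->
  Lcls mu p1 (fun t => f t - g t) = Lcls mu p1 f - Lcls mu p1 g.
Proof.
move=> Pf Pg; rewrite -[Lcls mu p1 f - _]addrC -scaleN1r -Lcls_lin//.
by congr Lcls; apply/funext => t; rewrite mulN1r addrC.
Qed.

Lemma Lp_integral_norm (f : T -> R) : f \in Lfun mu p%:E ->
  (\int[mu]_t (`|f t| `^ p)%:E = (`|Lcls mu p1 f| `^ p)%:E)%E.
Proof.
move=> Pf; rewrite norm_Lcls// -powRrM mulVf ?gt_eqF// powRr1; last first.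
  by apply: Rintegral_ge0 => t _; exact: powR_ge0.
rewrite /Rintegral fineK//; apply: integrable_fin_num => //.
by apply: Lfun_integrable => //; exact: ltW.
Qed.

Lemma Lp_integral_abs (f : T -> R) : f \in Lfun mu p%:E ->
  (\int[mu]_t `|f t|%:E <= `|Lcls mu p1 f|%:E)%E.
Proof.
move=> Pf; have mf : measurable_fun setT f.
  by move: Pf; rewrite inE => /andP[]; rewrite inE.
pose q := (1 - p^-1)^-1.
have pV : p^-1 < 1 by rewrite invf_lt1.
have q0 : 0 < q by rewrite invr_gt0 subr_gt0.
have pq : p^-1 + q^-1 = 1 by rewrite invrK addrC subrK.
have := hoelder mu mf (@measurable_cst _ _ T _ setT (1 : R)) p0 q0 pq.
rewrite Lnorm1; under eq_integral do rewrite /= mulr1.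
move=> /le_trans; apply.
rewrite (_ : EFin \o cst (1 : R) = cst 1%E)// Lnorm_cst1 mu1 poweR1r mule1.
rewrite (_ : `|Lcls mu p1 f| = Lpnorm (Lcls mu p1 f))// (Lcls_Sub p1 Pf) Lpnorm_class.
by rewrite -finite_norm_fine.
Qed.

(** Summability of the increments in L_1 gives convergence almost everywhere, and Fatou's lemma puts
    the limit in L_p at the stated distance. *)
Lemma Lp_limit (w : nat -> X) :
  (forall n, `|w n.+1 - w n| <= 2^-1 ^+ n) ->
  exists l, forall n, `|l - w n| <= 2 * 2^-1 ^+ n.
Proof.
move=> w2; pose f n : T -> R := Lrepr (w n).
have Pf n : f n \in Lfun mu p%:E by exact: LfunP.
have mf n : measurable_fun setT (f n) by exact: measurable_funPT.
have fw n : Lcls mu p1 (f n) = w n by exact: LreprK'.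
pose D n t : R := `|f n.+1 t - f n t|.
have mD n : measurable_fun setT (fun t => (D n t)%:E).
  apply/measurable_EFinP; apply: measurableT_comp => //; exact: measurable_funB.
have D0 n t : (0 <= (D n t)%:E)%E by rewrite lee_fin normr_ge0.
have S0 t : (0 <= \sum_(n <oo) (D n t)%:E)%E by apply: nneseries_ge0.
have fin : {ae mu, forall t, (\sum_(n <oo) (D n t)%:E < +oo)%E}.
  have mS : measurable_fun setT (fun t => \sum_(n <oo) (D n t)%:E)%E.
    apply: ge0_emeasurable_sum => [n t _ _|n _]; last exact: mD.
    by rewrite lee_fin normr_ge0.
  have : mu.-integrable setT (fun t => \sum_(n <oo) (D n t)%:E)%E.
    apply/integrableP; split => //.
    under eq_integral do rewrite (gee0_abs (S0 _)).
    rewrite integral_nneseries//.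
    apply: (@le_lt_trans _ _ (\sum_(n <oo) (2^-1 ^+ n)%:E)%E).
      apply: lee_nneseries => [n _ _|n _]; first exact: integral_ge0.
      apply: le_trans (Lp_integral_abs (Lfun_sub (Pf n.+1) (Pf n))) _.
      by rewrite Lcls_sub// !fw lee_fin.
    have /cvg_lim H : (\sum_(0 <= n < N) (2^-1 ^+ n)%:E)%E @[N --> \oo] --> (2%:E : \bar R).
      under eq_fun do rewrite sumEFin.
      apply/cvg_EFin; first exact: nearW.
      rewrite (_ : fine \o _ = series (geometric 1 2^-1)); last first.
        by apply/funext => n; rewrite seriesEnat; apply: eq_bigr => i _; rewrite /geometric/= mul1r.
      have := @cvg_geometric_series _ 1 (2^-1 : R); rewrite ger0_norm//.
      by rewrite (_ : 1 / (1 - 2^-1) = 2); [apply; rewrite invf_lt1// ltr1n|field].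
    by rewrite H ?ltry.
  move=> /(integrable_ae measurableT); apply: filterS => t /(_ I).
  by rewrite fin_numElt => /andP[].
have cv : {ae mu, forall t, cvgn (f ^~ t)}.
  apply: filterS fin => t ft.
  have cD : cvgn (series (fun n => f n.+1 t - f n t)).
    apply: normed_cvg; apply: (@nondecreasing_is_cvgn _ _).
      apply/nondecreasing_seqP => n; rewrite !/(normed_series_of _) !seriesEnat/= big_nat_recr//= lerDl//.
    have Dfin : (\sum_(n <oo) (D n t)%:E)%E \is a fin_num.
      by rewrite ge0_fin_numE.
    exists (fine (\sum_(n <oo) (D n t)%:E)%E) => _ [n _ <-].
    rewrite -lee_fin fineK// /normed_series_of/= seriesEnat/= -sumEFin.
    exact: nneseries_lim_ge.
  have : cvgn (fun n => f 0%N t + series (fun n => f n.+1 t - f n t) n).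
    by apply: is_cvgD => //; exact: is_cvg_cst.
  rewrite (_ : (fun n => _) = f ^~ t)//; apply/funext => n.
  by rewrite seriesEnat/= telescope_sumr// addrC subrK.
(* The upper limit is measurable and defined everywhere; off the set of convergence, which has full
   measure, its value is immaterial. *)
pose F t := limn_esup (fun n => (f n t)%:E).
pose g t := fine (F t).
have mg : measurable_fun setT g.
  apply: measurableT_comp => //.
  by apply: measurable_fun_limn_esup => n; exact/measurable_EFinP.
have fg : {ae mu, forall t, f n t @[n --> \oo] --> g t}.
  apply: filterS cv => t /cvg_ex[l fl].
  have fl' : (f n t)%:E @[n --> \oo] --> l%:E by apply: cvg_EFin => //; exact: nearW.
  by rewrite /g /F; have [_ ->] := cvg_limn_einf_sup fl'.
have w_le n m : (n <= m)%N -> `|w m - w n| <= 2 * 2^-1 ^+ n.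
  move=> nm; rewrite -(telescope_sumr w nm).
  apply: (le_trans (ler_norm_sum _ _ _)).
  apply: (@le_trans _ _ (\sum_(n <= i < m) 2^-1 ^+ i)); first exact: ler_sum.
  (* [2^-i] is an increment of the sequence [-2 * 2^-i], so the sum telescopes. *)
  rewrite (@eq_bigr _ _ _ _ _ _ _ (fun i => - 2 * 2^-1 ^+ i.+1 - - 2 * 2^-1 ^+ i)).
    rewrite (telescope_sumr (fun i => - 2 * 2^-1 ^+ i) nm).
    have : 0 <= (2^-1 : R) ^+ m by rewrite exprn_ge0.
    lra.
  by move=> i _; rewrite exprS; field.
have g_le n : (\int[mu]_t (`|g t - f n t| `^ p)%:E <= ((2 * 2^-1 ^+ n) `^ p)%:E)%E.
  pose h m t := (`|f m t - f n t| `^ p)%:E.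
  have mh m : measurable_fun setT (h m).
    apply/measurable_EFinP; apply: (measurableT_comp (measurable_powR _)).
    by apply: measurableT_comp => //; exact: measurable_funB.
  have h0 m t : setT t -> (0 <= h m t)%E by rewrite lee_fin powR_ge0.
  have := fatou mu measurableT mh h0.
  have -> : (\int[mu]_t limn_einf (h ^~ t) = \int[mu]_t (`|g t - f n t| `^ p)%:E)%E.
    apply: ae_eq_integral => //.
    - suff : measurable_fun setT (fun t => - limn_esup (fun m => - h m t))%E by [].
      apply: measurableT_comp => //; apply: measurable_fun_limn_esup => m.
      exact: measurableT_comp.
    - apply/measurable_EFinP; apply: (measurableT_comp (measurable_powR _)).
      by apply: measurableT_comp => //; exact: measurable_funB.
    - apply: filterS fg => t fgt _.
      have : h m t @[m --> \oo] --> (`|g t - f n t| `^ p)%:E.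
        apply: cvg_EFin; first exact: nearW.
        apply: cvg_powR => //; apply: cvg_norm.
        by apply: cvgB => //; exact: cvg_cst.
      by move=> /cvg_limn_einf_sup[].
  move=> /le_trans; apply; rewrite limn_einf_lim.
  apply: lime_le; first exact: is_cvg_einfs.
  (* The infimum over the indices from [m] on is tested at [maxn m n], which is at least [n], so
     that [w_le] applies. *)
  apply: nearW => m; apply: (@le_trans _ _ (\int[mu]_t h (maxn m n) t)%E).
    by apply: ereal_inf_lbound; exists (maxn m n) => //=; exact: leq_maxl.
  rewrite Lp_integral_norm; last exact: Lfun_sub.
  rewrite Lcls_sub// !fw lee_fin; apply: ge0_ler_powR; rewrite ?nnegrE ?(ltW p0)//.
  by apply: w_le; exact: leq_maxr.
have Pgf n : (fun t => g t - f n t) \in Lfun mu p%:E.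
  rewrite inE; apply/andP; split; rewrite inE/=; first exact: measurable_funB.
  rewrite /finite_norm unlock/=; apply: poweR_lty.
  exact: le_lt_trans (g_le n) (ltry _).
have Pg : g \in Lfun mu p%:E.
  have -> : g = (fun t => (g t - f 0%N t) + f 0%N t).
    by apply/funext => t; rewrite subrK.
  exact: (LfunP (Lfun_Sub p1 (Pgf 0%N) + Lfun_Sub p1 (Pf 0%N))).
exists (Lcls mu p1 g) => n; rewrite -(fw n) -Lcls_sub//.
apply: norm_Lcls_le => //.
rewrite -lee_fin fineK; first exact: g_le.
by rewrite Lp_integral_norm.
Qed.

Lemma Lp_complete (w : nat -> X) : cauchy (w n @[n --> \oo]) -> cvgn w.
Proof.
move=> /cauchy_ballP cw.
have /choice[N NP] : forall j, exists N, forall m n, (N <= m)%N ->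
    (N <= n)%N -> `|w m - w n| <= 2^-1 ^+ j.
  move=> j.
  have : 0 < (2^-1 : R) ^+ j by rewrite exprn_gt0// invr_gt0.
  move=> /cw[[A B]/= [[a _ aA] [b _ bB]] AB].
  exists (maxn a b) => m n; rewrite !geq_max => /andP[am bm] /andP[an bn].
  have := AB (w m, w n) (conj (aA _ am) (bB _ bn)).
  by rewrite /= -ball_normE/= => /ltW.
(* Partial sums give a monotone majorant: [phi j >= N i] for all [i <= j]. *)
pose phi j := (\sum_(i < j.+1) N i)%N.
have phi_ge j i : (i <= j)%N -> (N i <= phi j)%N.
  by move=> ij; rewrite /phi (bigD1 (Ordinal (ij : i < j.+1)%N))//= leq_addr.
have [l lP] : exists l, forall j, `|l - w (phi j)| <= 2 * 2^-1 ^+ j.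
  by apply: Lp_limit => j; apply: NP; apply: phi_ge; rewrite ?leqnSn.
apply/cvg_ex; exists l; apply/cvgrPdist_le => e e0.
(* [3 = 2 + 1]: the distance from [l] to [w (phi j)], then the Cauchy bound from there to [w n]. *)
have [j je] : exists j, 3 * 2^-1 ^+ j <= e.
  have : (3 * 2^-1 ^+ j : R) @[j --> \oo] --> (3 * 0 : R).
    by apply: cvgMr; apply: cvg_expr; rewrite ger0_norm// invf_lt1// ltr1n.
  rewrite mulr0 => /cvgrPdist_le/(_ e e0)[j _ /(_ j (leqnn j))]/=.
  by rewrite sub0r normrN ger0_norm ?mulr_ge0 ?exprn_ge0//; exists j.
exists (N j) => // n /= jn.
have -> : l - w n = (l - w (phi j)) + (w (phi j) - w n) by rewrite addrA subrK.
apply: (le_trans (ler_normD _ _)); apply: le_trans je.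
have := lP j; have := NP j (phi j) n (phi_ge _ _ (leqnn j)) jn; lra.
Qed.

End completeness.

(** * Rademacher functions and sparse blocks on [0, 1] *)

Section unit_interval.
Context {R : realType}.
Local Notation mu := (lebesgue01 R).
Local Notation T := (measurableTypeR R).

Lemma lebesgue01_itv (a b : R) : 0 <= a -> a <= b -> b <= 1 ->
  mu `[a, b[%classic = (b - a)%:E.
Proof.
move=> a0 ab b1; have -> : mu `[a, b[%classic = lebesgue_measure (`[a, b[%classic `&` `[0, 1]%classic) by [].
rewrite setIidl; last first.
  move=> x /=; rewrite !in_itv/= => /andP[ax xb].
  by rewrite (le_trans a0 ax)/= (le_trans (ltW xb)).
by rewrite lebesgue_measure_itv/= lte_fin; case: ltgtP ab => // -> _; rewrite subrr.
Qed.

Lemma lebesgue01T : mu setT = 1%E.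
Proof.
have -> : mu setT = lebesgue_measure (setT `&` `[0, 1]%classic : set R) by [].
rewrite setTI lebesgue_measure_itv/= lte_fin ltr01.
by rewrite oppr0 adde0.
Qed.

Definition ind (a b : R) (t : T) : R := \1_(`[a, b[%classic : set R) t.

Lemma ind_itv a b (t : R) : ind a b t = (a <= t < b)%R%:R.
Proof.
rewrite /ind indicE; congr (nat_of_bool _)%:R.
by apply/idP/idP; rewrite inE/= in_itv.
Qed.

Lemma bfun_ind (a b : R) : bfun (ind a b).
Proof.
split; first exact: measurable_indic.
by exists 1 => t; rewrite ind_itv ger0_norm// lern1; case: (_ && _).
Qed.

Lemma Rintegral_ind (a b : R) : 0 <= a -> a <= b -> b <= 1 ->
  \int[mu]_t ind a b t = b - a.
Proof.
move=> a0 ab b1; rewrite /Rintegral /ind integral_indic//= setIT.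
by rewrite lebesgue01_itv.
Qed.

(** On [[a, a + l)] this is the index of the cell containing [t] when the interval is cut into [N]
    equal cells: a uniform discrete variable realised on an interval. Elsewhere it is meaningless
    and is always masked by [ind]. *)
Definition cell (a l : R) N (t : R) : nat := Num.truncn (N%:R * ((t - a) / l)).

Lemma cell_ind (a l : R) N (h : nat -> R) (t : R) : 0 < l -> (0 < N)%N ->
  ind a (a + l) t * h (cell a l N t) =
  \sum_(c < N) h c * ind (a + c%:R * (l / N%:R)) (a + c.+1%:R * (l / N%:R)) t.
Proof.
move=> l0 N0; have NR : 0 < N%:R :> R by rewrite ltr0n.
pose y := N%:R * ((t - a) / l).
have cE c : (a + c%:R * (l / N%:R) <= t < a + c.+1%:R * (l / N%:R)) =
    (c%:R <= y < c.+1%:R).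
  have tE : t = a + y * (l / N%:R) by rewrite /y; field; rewrite !gt_eqF.
  rewrite {1 2}tE lerD2l ltrD2l ler_pM2r ?divr_gt0// ltr_pM2r ?divr_gt0//.
have -> : ind a (a + l) t = (0%:R <= y < N%:R)%R%:R.
  rewrite ind_itv; congr (nat_of_bool _)%:R; rewrite /y; congr andb.
    by rewrite pmulr_rge0// pmulr_lge0 ?invr_gt0// subr_ge0.
  by rewrite -{2}[N%:R]mulr1 ltr_pM2l// ltr_pdivrMr// mul1r ltrBlDl.
under eq_bigr do rewrite ind_itv cE.
have [/andP[y0 yN]|yN] := boolP (0%:R <= y < N%:R).
  rewrite mul1r; have cN : (cell a l N t < N)%N by rewrite truncn_lt_nat.
  rewrite (bigD1 (Ordinal cN))//= big1.
    by rewrite (truncn_itv y0) mulr1 addr0.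
  move=> c; rewrite -val_eqE/= eq_sym => cc.
  by rewrite -truncn_eq// (negbTE cc) mulr0.
rewrite mul0r big1// => c _; case: andP => [[cy yc]|]; last by rewrite mulr0.
case/negP: yN; apply/andP; split; first exact: le_trans cy.
by apply: lt_le_trans yc _; rewrite ler_nat.
Qed.

Lemma bfun_cell (a l : R) N (h : nat -> R) : 0 < l -> (0 < N)%N ->
  bfun (fun t : T => ind a (a + l) t * h (cell a l N t)).
Proof.
move=> l0 N0; under eq_fun do rewrite cell_ind//.
by apply: bfun_sum => c; apply: bfunZ; exact: bfun_ind.
Qed.

Lemma Rintegral_cell (a l : R) N (h : nat -> R) :
  0 <= a -> 0 < l -> a + l <= 1 -> (0 < N)%N ->
  \int[mu]_t (ind a (a + l) t * h (cell a l N t)) = l * avg N h.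
Proof.
move=> a0 l0 al1 N0; have NR : 0 < N%:R :> R by rewrite ltr0n.
under eq_Rintegral do rewrite cell_ind//.
rewrite (bRintegral_sum lebesgue01T _ _ (F := fun (c : 'I_N) t =>
  h c * ind (a + c%:R * (l / N%:R)) (a + c.+1%:R * (l / N%:R)) t)); last first.
  by move=> c; apply: bfunZ; exact: bfun_ind.
rewrite /avg mulrCA mulr_sumr mulr_sumr; apply: eq_bigr => c _.
rewrite (bRintegralZ lebesgue01T); last exact: bfun_ind.
have lN : 0 < l / N%:R by rewrite divr_gt0.
rewrite Rintegral_ind.
- by rewrite -[c.+1]addn1 natrD; field; rewrite gt_eqF.
- by rewrite addr_ge0// mulr_ge0// ltW.
- by rewrite lerD2l ler_pM2r// ler_nat.
- apply: le_trans al1; rewrite lerD2l mulrCA ler_piMr ?(ltW l0)//.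
  by rewrite ler_pdivrMr// mul1r ler_nat.
Qed.

(** The Rademacher function of the binary digit [i + 1] of [t]. The indicator confines it to
    [[0, 1)], which makes it a finite combination of indicators of cells. *)
Definition rad i (t : T) : R := ind 0 1 t * sgn3 (Num.truncn (2 ^+ i.+1 * (t : R)) %% 2)%N.

(** [xi] numbers the digits of an [N]-bit integer from the lowest, [rad] those of [t] from the
    highest; hence the index [N - i.+1]. *)
Lemma rad_cell N i (t : R) : (i < N)%N ->
  rad i t = ind 0 (0 + 1) t * xi 1 (cell 0 1 (2 ^ N) t) (N - i.+1)%N.
Proof.
move=> iN; rewrite /rad add0r ind_itv; case: (boolP (0 <= t < 1)); last by rewrite !mul0r.
move=> /andP[t0 t1]; rewrite /xi /cell; congr (_ * sgn3 (_ %% _)%N).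
rewrite subr0 divr1 natrX.
have e0 : 0 <= 2 ^+ i.+1 * t by rewrite mulr_ge0// exprn_ge0.
have e1 : 0 <= 2 ^+ N * t by rewrite mulr_ge0// exprn_ge0.
apply/eqP; rewrite truncn_eq//.
have /andP[h1 h2] := truncn_itv e1; set c := Num.trunc _ in h1 h2 *.
have p0 : 0 < (2 : R) ^+ (N - i.+1) by rewrite exprn_gt0.
have NE : (2 : R) ^+ N = 2 ^+ (N - i.+1) * 2 ^+ i.+1 by rewrite -exprD subnK.
rewrite NE -mulrA in h1 h2.
rewrite muln1.
apply/andP; split.
  rewrite -(ler_pM2l p0); apply: le_trans h1.
  by rewrite -natrX -natrM ler_nat mulnC leq_trunc_div.
rewrite -(ltr_pM2l p0); apply: lt_le_trans h2 _.
by rewrite -natrX -natrM ler_nat mulnC ltn_ceil ?expn_gt0.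
Qed.

Lemma bfun_rad i : bfun (rad i).
Proof.
rewrite (_ : rad i = (fun t : T => ind 0 (0 + 1) t *
  xi 1 (cell 0 1 (2 ^ i.+1) t) (i.+1 - i.+1)%N)).
  by apply: (bfun_cell 0 (fun c => xi 1 c _)) => //; rewrite expn_gt0.
by apply/funext => t; apply: rad_cell.
Qed.

(** [f 0 = 0] handles the points off [[0, 1)], where all [rad] vanish. The coefficients are reversed
    because the digits are numbered from opposite ends. *)
Lemma Rintegral_rad N (a : nat -> R) (f : R -> R) : f 0 = 0 ->
  \int[mu]_t f (\sum_(i < N) a i * rad i t) =
  avg ((2 * 1) ^ N) (fun c => f (\sum_(j < N) a (N - j.+1)%N * xi 1 c j)).
Proof.
move=> f0; pose h c := f (\sum_(j < N) a (N - j.+1)%N * xi 1 c j).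
have N0 : (0 < 2 ^ N)%N by rewrite expn_gt0.
rewrite muln1 -[RHS]mul1r -(@Rintegral_cell 0 1 _ h)// ?add0r//.
apply: eq_Rintegral => t _; rewrite (reindex_inj rev_ord_inj)/= /h.
transitivity (f (\sum_(j < N) a (N - j.+1)%N * (ind 0 (0 + 1) t * xi 1 (cell 0 1 (2 ^ N) t) j))).
  congr f; apply: eq_bigr => j _; rewrite (@rad_cell N) ?ltn_subrL ?(leq_ltn_trans _ (ltn_ord j))//.
  by rewrite subnSK ?ltn_ord// subKn// ltnW.
rewrite add0r ind_itv; case: (_ && _); last first.
  rewrite mul0r big1 ?f0// => j _; by rewrite mul0r mulr0.
by rewrite mul1r; congr f; apply: eq_bigr => j _; rewrite mul1r.
Qed.

Lemma Rintegral_rad2 i j : \int[mu]_t (rad i t * rad j t) = (i == j)%:R.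
Proof.
pose N := (maxn i j).+1; have iN : (i < N)%N by rewrite ltnS leq_maxl.
have jN : (j < N)%N by rewrite ltnS leq_maxr.
have N0 : (0 < 2 ^ N)%N by rewrite expn_gt0.
have i' : (N - i.+1 < N)%N by rewrite ltn_subrL.
have j' : (N - j.+1 < N)%N by rewrite ltn_subrL.
have := @avg_xi2 R 1 N (Ordinal i') (Ordinal j') isT; rewrite invr1 mul1r.
rewrite -val_eqE/= muln1 => H.
transitivity (1 * ((N - i.+1)%N == (N - j.+1)%N)%:R : R).
  rewrite -H -(@Rintegral_cell 0 1 _ (fun c => xi 1 c _ * xi 1 c _))// ?add0r//.
  apply: eq_Rintegral => t _; rewrite !(@rad_cell N)// add0r ind_itv.
  by case: (_ && _); rewrite ?mul0r// !mul1r.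
rewrite mul1r; congr (nat_of_bool _)%:R; apply/eqP/eqP => [|->//].
by move=> /(congr1 (fun x => N - x)%N); rewrite !subKn// => -[].
Qed.

Section blocks.
Variables (s k : nat -> nat).
Hypothesis s0 : forall n, (0 < s n)%N.

Let len n : R := 2^-1 ^+ n.+1.

Let len0 n : 0 < len n. Proof. by rewrite exprn_gt0. Qed.

Let len1 n : len n + len n <= 1.
Proof.
rewrite /len exprS; have : (2^-1 : R) ^+ n <= 1 by rewrite exprn_ile1// invf_le1// ler1n.
lra.
Qed.

Let size n := ((2 * s n) ^ k n)%N.

Let size0 n : (0 < size n)%N. Proof. by rewrite expn_gt0 muln_gt0 s0. Qed.

Let sR n : 0 < (s n)%:R :> R. Proof. by rewrite ltr0n. Qed.

(* The n-th block of functions lives on [2^-(n+1), 2^-n); the factor makes the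
   L_e norm of each blk e n j equal to 1. *)
Definition blk (e : R) n j (t : T) : R :=
  (len n / (s n)%:R) `^ (- e^-1) *
  (ind (len n) (len n + len n) t * xi (s n) (cell (len n) (len n) (size n) t) j).

Lemma bfun_blk e n j : bfun (blk e n j).
Proof. by apply: bfunZ; apply: (bfun_cell (len n) (fun c => xi (s n) c j)). Qed.

Let ind_disjoint n m (t : R) : (n < m)%N ->
  ind (len n) (len n + len n) t * ind (len m) (len m + len m) t = 0.
Proof.
move=> nm; rewrite !ind_itv; case: (boolP (len n <= t < _)); last by rewrite mul0r.
case: (boolP (len m <= t < _)); last by rewrite mulr0.
move=> /andP[_ tm] /andP[nt _]; have : len m + len m <= len n.
  have -> : len m + len m = 2^-1 ^+ m by rewrite /len exprS; field.
  by apply: ler_wiXn2l; rewrite // invf_le1// ler1n.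
by move=> h; have := lt_le_trans tm (le_trans h nt); rewrite ltxx.
Qed.

(** The normalising factor to the power [e] is [s n / len n]; its denominator cancels the length of
    the interval, and the factor [s n] of the moment bounds remains. *)
Lemma Rintegral_blk_block e n (y : nat -> R) : 0 < e ->
  \int[mu]_t `|\sum_(j < k n) y j * blk e n j t| `^ e =
  (s n)%:R * avg ((2 * s n) ^ k n) (fun c => `|\sum_(j < k n) y j * xi (s n) c j| `^ e).
Proof.
move=> e0; pose h c := `|\sum_(j < k n) y j * xi (s n) c j| `^ e.
have ls0 : 0 < len n / (s n)%:R by rewrite divr_gt0.
transitivity (\int[mu]_t ((len n / (s n)%:R)^-1 *
  (ind (len n) (len n + len n) t * h (cell (len n) (len n) (size n) t)))).
  apply: eq_Rintegral => t _; rewrite /h.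
  rewrite (eq_bigr (fun j : 'I_(k n) => ((len n / (s n)%:R) `^ (- e^-1) *
    ind (len n) (len n + len n) t) * (y j * xi (s n) (cell (len n) (len n) (size n) t) j))); last first.
    by move=> j _; rewrite /blk; ring.
  have aE : ((len n / (s n)%:R) `^ (- e^-1)) `^ e = (len n / (s n)%:R)^-1.
    by rewrite -powRrM mulNr mulVf ?gt_eqF// powR_inv1 ?(ltW ls0).
  rewrite -aE -mulr_sumr; set A := (_ / _) `^ _ in aE *.
  have A0 : 0 <= A by exact: powR_ge0.
  rewrite normrM powRM// normrM powRM// (ger0_norm A0).
  rewrite -mulrA; congr (_ * (_ * _)); rewrite ind_itv.
  by case: (_ && _); rewrite ?normr1 ?powR1// normr0 powR0// gt_eqF.
rewrite (bRintegralZ lebesgue01T); last exact: bfun_cell.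
rewrite Rintegral_cell ?(ltW (len0 n))// /h -/(size n).
by field; rewrite !gt_eqF.
Qed.

(** Different blocks have disjoint supports, so the powers add. *)
Lemma Rintegral_blk e L (y : nat -> nat -> R) : 0 < e ->
  \int[mu]_t `|\sum_(n < L) \sum_(j < k n) y n j * blk e n j t| `^ e =
  \sum_(n < L) (s n)%:R * avg ((2 * s n) ^ k n)
    (fun c => `|\sum_(j < k n) y n j * xi (s n) c j| `^ e).
Proof.
move=> e0; pose F n t := \sum_(j < k n) y n j * blk e n j t.
have bF n : bfun (F n) by apply: bfun_sum => j; apply: bfunZ; exact: bfun_blk.
under [RHS]eq_bigr do rewrite -Rintegral_blk_block//.
rewrite -(bRintegral_sum lebesgue01T _ _ (F := fun (n : 'I_L) t => `|F n t| `^ e)); last first.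
  by move=> n; exact: bfun_powR.
apply: eq_Rintegral => t _; rewrite -/(F _ _).
have F0 n : ind (len n) (len n + len n) t = 0 -> F n t = 0.
  by move=> i0; apply: big1 => j _; rewrite /blk i0 mul0r !mulr0.
have p00 : `|0 : R| `^ e = 0 by rewrite normr0 powR0// gt_eqF.
have [[n nt]|nt] := pselect (exists n : 'I_L, ind (len n) (len n + len n) t != 0); last first.
  have Fn0 (n : 'I_L) : F n t = 0.
    by apply: F0; apply: contrapT => nt'; apply: nt; exists n; apply/eqP.
  by rewrite !big1// => n _; rewrite ?Fn0//; exact: Fn0.
have Fn0 (m : 'I_L) : m != n -> F m t = 0.
  move=> mn; apply: F0; apply/eqP; move: mn; rewrite -val_eqE/= neq_ltn.
  have := @ind_disjoint m n t; have := @ind_disjoint n m t => h1 h2.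
  by move=> /orP[/h2|/h1] /eqP; rewrite mulf_eq0 (negbTE nt) ?orbF//= => /eqP->.
rewrite (bigD1 n)//= [X in _ + X]big1 ?addr0; last by move=> m /Fn0.
by rewrite [RHS](bigD1 n)//= [X in _ + X]big1 ?addr0// => m /Fn0 ->.
Qed.

Lemma Rintegral_blk_unit e n j : 0 < e -> (j < k n)%N ->
  \int[mu]_t `|blk e n j t| `^ e = 1.
Proof.
move=> e0 jk; pose y i : R := (i == j)%:R.
have yE (f : nat -> R) : \sum_(i < k n) y i * f i = f j.
  rewrite (bigD1 (Ordinal jk))//= /y eqxx mul1r big1 ?addr0// => i.
  by rewrite -val_eqE/= => /negbTE ->; rewrite mul0r.
have := Rintegral_blk_block n y e0.
under eq_Rintegral do rewrite (yE (fun i => blk e n i _)).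
move=> ->; under eq_avg do rewrite yE.
pose G i (x : R) : R := if i == j then `|x| `^ e else 1.
rewrite (@eq_avg _ _ _ (fun c => \prod_(i < k n) G i (xi (s n) c i))); last first.
  move=> c _; rewrite (bigD1 (Ordinal jk))//= big1; first by rewrite /G eqxx mulr1.
  by move=> i; rewrite -val_eqE/= /G => /negbTE ->.
rewrite avg_xi// (bigD1 (Ordinal jk))//= big1; last first.
  by move=> i; rewrite -val_eqE/= /G => /negbTE ->; field; rewrite gt_eqF.
rewrite /G eqxx normr0 normrN normr1 powR1 powR0 ?gt_eqF//.
by field; rewrite gt_eqF.
Qed.

(** For conjugate exponents the two normalising factors multiply to [s n / len n], which compensates
    both the length and the density. *)
Lemma Rintegral_blk2 e e' n j m i : e^-1 + e'^-1 = 1 -> (j < k n)%N -> (i < k m)%N ->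
  \int[mu]_t (blk e n j t * blk e' m i t) = ((n == m) && (j == i))%:R.
Proof.
move=> ee' jk im; have [nm|nm] := eqVneq n m; last first.
  rewrite -[RHS](bRintegral_cst lebesgue01T 0); apply: eq_Rintegral => t _.
  rewrite /blk; set a := _ `^ _; set b := _ `^ _; set u := xi _ _ _; set v := xi _ _ _.
  have -> : a * (ind (len n) (len n + len n) t * u) * (b * (ind (len m) (len m + len m) t * v)) =
    a * b * u * v * (ind (len n) (len n + len n) t * ind (len m) (len m + len m) t) by ring.
  move: nm; rewrite neq_ltn => /orP[] nm; first by rewrite ind_disjoint// mulr0.
  by rewrite [ind _ _ _ * _]mulrC ind_disjoint// mulr0.
subst m; have ls0 : 0 < len n / (s n)%:R by rewrite divr_gt0.
have ls1 : (len n / (s n)%:R) `^ (- e^-1) * (len n / (s n)%:R) `^ (- e'^-1) =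
    (len n / (s n)%:R)^-1.
  rewrite -powRD; last by rewrite (gt_eqF ls0) implybT.
  by rewrite -opprD ee' powR_inv1// ltW.
transitivity (\int[mu]_t ((len n / (s n)%:R)^-1 * (ind (len n) (len n + len n) t *
    (fun c => xi (s n) c j * xi (s n) c i) (cell (len n) (len n) (size n) t)))).
  apply: eq_Rintegral => t _; rewrite -ls1 /blk ind_itv.
  by case: (_ && _); rewrite /=; ring.
rewrite (bRintegralZ lebesgue01T); last exact: (bfun_cell _ (fun c => xi (s n) c j * xi (s n) c i)).
rewrite (Rintegral_cell (fun c => xi (s n) c j * xi (s n) c i)) ?(ltW (len0 n))//.
have := @avg_xi2 R (s n) (k n) (Ordinal jk) (Ordinal im) (s0 n); rewrite /= => ->.
by rewrite -val_eqE/=; field; rewrite !gt_eqF.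
Qed.

End blocks.
End unit_interval.

(* r n = \sum_(i < n) s i ^ 2 is carried along so that s can outgrow it. *)
Fixpoint rs_seq n : nat * nat :=
  if n is n'.+1 then
    let: (r, s) := rs_seq n' in
    let r' := (r + s ^ 2)%N in (r', n.+1 * (r' + 1) * 16 ^ s)%N
  else (0, 1)%N.

(* s_ n is the inverse density, and k_ n the number, of the sparse signs in the
   n-th block. *)
Definition s_ n := (rs_seq n).2.
Definition k_ n := (s_ n ^ 2)%N.

Lemma rs_seqE n : (rs_seq n).1 = (\sum_(i < n) k_ i)%N.
Proof.
elim: n => [|n IH]; first by rewrite big_ord0.
by rewrite big_ord_recr/= -IH /k_ /s_; case: (rs_seq n).
Qed.

Lemma s_S n : s_ n.+1 = (n.+2 * ((\sum_(i < n.+1) k_ i) + 1) * 16 ^ s_ n)%N.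
Proof. by rewrite -rs_seqE /s_/=; case: (rs_seq n). Qed.

Lemma s_gt0 n : (0 < s_ n)%N.
Proof. by case: n => // n; rewrite s_S !muln_gt0 addn1/= expn_gt0. Qed.

(** This makes the error of the low blocks, their total dimension over [s_ n], at most
    [1 / (n + 1)]. *)
Lemma s_large n : (n.+1 * \sum_(i < n) k_ i <= s_ n)%N.
Proof.
case: n => [|n]; first by rewrite big_ord0.
rewrite s_S -[leqLHS]muln1 leq_mul ?expn_gt0//.
by rewrite leq_mul2l leq_addr orbT.
Qed.

Lemma s_gt n : (n < s_ n)%N.
Proof.
case: n => // n; rewrite s_S -[leqLHS]muln1 leq_mul ?expn_gt0//.
by rewrite leq_pmulr// addn1.
Qed.

Lemma s_exp n : (16 ^ s_ n <= s_ n.+1)%N.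
Proof. by rewrite s_S -[leqLHS]mul1n leq_mul2r muln_gt0 addn1 orbT. Qed.

Lemma s_homo m n : (m <= n)%N -> (s_ m <= s_ n)%N.
Proof.
elim: n => [|n IH]; first by rewrite leqn0 => /eqP->.
rewrite leq_eqVlt => /predU1P[->//|]; rewrite ltnS => /IH /leq_trans; apply.
by apply: leq_trans (s_exp n); apply: ltnW; apply: ltn_expl.
Qed.

(** Here [16 = 4 * 4]: by [s <= 2 ^ s] one factor [4 ^ s] absorbs [s ^ 2], and by [exp 1 <= 4] the
    other absorbs [exp s]. *)
Lemma s_fast (R : realType) m n : (m < n)%N ->
  (s_ m)%:R ^+ 2 * expR (s_ m)%:R <= (s_ n)%:R :> R.
Proof.
move=> mn; apply: (@le_trans _ _ (16 ^ s_ m)%:R); last first.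
  by rewrite ler_nat; apply: leq_trans (s_exp m) _; exact: s_homo.
have e4 : expR 1 <= 4 :> R.
  apply: (@le_trans _ _ (expR (1 / 2 + 1 / 2))); first by rewrite ler_expR; lra.
  have : expR (1 / 2 : R) <= 2 by apply: (le_trans (expR_le_half _)); lra.
  by rewrite expRD; have := expR_gt0 (1 / 2 : R); nra.
have -> : expR (s_ m)%:R = expR 1 ^+ s_ m :> R.
  by rewrite -expRM_natl mulr1.
have -> : (16 ^ s_ m)%:R = (4 : R) ^+ s_ m * 4 ^+ s_ m.
  by rewrite -exprMn -natrM natrX.
apply: ler_pM.
- by rewrite exprn_ge0.
- by rewrite exprn_ge0// expR_ge0.
- rewrite -!natrX ler_nat (_ : 4 = 2 ^ 2)%N// -expnM mulnC expnM leq_exp2r//.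
  by rewrite ltnW// ltn_expl.
- by apply: lerXn2r; rewrite ?nnegrE ?expR_ge0.
Qed.

(** * Moments of Rademacher sums and of sparse sums *)

Section moment_bounds.
Context {R : realType}.
Local Notation mu := (lebesgue01 R).
Local Notation T := (measurableTypeR R).
Variables (q q' C D : R).
Hypotheses (q2 : 2 < q) (qq' : q^-1 + q'^-1 = 1).
Hypotheses (C0 : 0 < C) (qC : forall x : R, `|x| `^ q <= C * (ch x - 1)).
Hypotheses (D0 : 0 < D) (DC : C * 2 `^ q <= D `^ q).

Let q0 : 0 < q. Proof. exact: lt_trans q2. Qed.

Let q'12 : 1 < q' < 2.
Proof.
have := qq'; have qV0 : 0 < q^-1 by rewrite invr_gt0 q0.
have qV2 : q^-1 < 2^-1 by rewrite ltf_pV2 ?posrE.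
move=> eq1; have q'0 : 0 < q' by rewrite -invr_gt0; lra.
have q'1 : q'^-1 < 1^-1 by rewrite invr1; lra.
have q'2 : 2^-1 < q'^-1 by lra.
by move: q'1 q'2; rewrite !ltf_pV2 ?posrE// => -> ->.
Qed.

Let scaleD t : 0 < t -> C * (2 * t) `^ q <= (D * t) `^ q.
Proof.
by move=> t0; rewrite !powRM ?(ltW D0) ?(ltW t0)// mulrA ler_wpM2r// powR_ge0.
Qed.

Definition rv n j : T -> R := rad (\sum_(i < n) k_ i + j)%N.

Lemma bfun_rv n j : bfun (rv n j). Proof. exact: bfun_rad. Qed.

Lemma rv_block_moment m (x : nat -> R) t : 0 < t ->
  \sum_(i < k_ m) x i ^+ 2 <= t ^+ 2 ->
  \int[mu]_w `|\sum_(i < k_ m) x i * rv m i w| `^ q <= (D * t) `^ q.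
Proof.
move=> t0 xt; apply: le_trans (scaleD t0).
pose o := (\sum_(i < m) k_ i)%N; pose N := (o + k_ m)%N.
(* Zero coefficients stand for the Rademacher functions of the earlier blocks; the bound is then
   Khinchin's, that is [moment_gaussian] at [s = 1]. *)
pose a l : R := if (l < o)%N then 0 else x (l - o)%N.
have aE (f : nat -> R -> R) : (forall l, f l 0 = 0) ->
    \sum_(l < N) f l (a l) = \sum_(i < k_ m) f (o + i)%N (x i).
  move=> f0; rewrite /N big_split_ord/= big1 ?add0r => [|i _].
    by apply: eq_bigr => i _; rewrite /a ltnNge leq_addr/= addKn.
  by rewrite /a ltn_ord.
have p00 : `|0 : R| `^ q = 0 by rewrite normr0 powR0// gt_eqF.
have := Rintegral_rad N a (f := fun y => `|y| `^ q) p00.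
have radE w : \sum_(l < N) a l * rad l w = \sum_(i < k_ m) x i * rv m i w.
  by apply: (aE (fun l y => y * rad l w)) => l; rewrite mul0r.
under eq_Rintegral do rewrite radE.
move=> ->; rewrite -[leLHS]mul1r.
apply: (moment_gaussian (s := 1) (a := fun j => a (N - j.+1)%N) _ (ltW q0) qC) => //.
rewrite (reindex_inj rev_ord_inj)/=.
rewrite (eq_bigr (fun l : 'I_N => a l ^+ 2)); last first.
  by move=> l _; rewrite subnSK ?ltn_ord// subKn// ltnW.
by rewrite (aE (fun _ y => y ^+ 2)) => // l; rewrite expr0n.
Qed.

Lemma rv_orthonormal n j m i : (j < k_ n)%N -> (i < k_ m)%N ->
  \int[mu]_w (rv n j w * rv m i w) = ((n == m) && (j == i))%:R.
Proof.
move=> jk im; rewrite Rintegral_rad2; congr (nat_of_bool _)%:R.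
have lt a b l l' : (a < b)%N -> (l < k_ a)%N ->
    (\sum_(i < a) k_ i + l < \sum_(i < b) k_ i + l')%N.
  move=> ab la; apply: ltn_addr; apply: (@leq_trans (\sum_(i < a.+1) k_ i)%N).
    by rewrite big_ord_recr/= ltn_add2l.
  rewrite (big_ord_widen b _ ab) big_mkcond/=; apply: leq_sum => l0 _.
  by case: ifP.
case: (ltngtP n m) => nm /=.
- by apply/negbTE; rewrite neq_ltn lt.
- by apply/negbTE; rewrite neq_ltn (lt _ _ _ _ nm) ?orbT.
- by rewrite nm eqn_add2l.
Qed.

(** Since [q' <= 2], orthonormality suffices: [|F / t|^q' <= 1 + (F / t)^2] has integral at most 2,
    hence at most [2 ^ q']. *)
Lemma rv_full_moment L (y : nat -> nat -> R) t : 0 < t ->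
  \sum_(n < L) \sum_(j < k_ n) y n j ^+ 2 <= t ^+ 2 ->
  \int[mu]_w `|\sum_(n < L) \sum_(j < k_ n) y n j * rv n j w| `^ q' <= (2 * t) `^ q'.
Proof.
move=> t0 yt; have /andP[q'1 q'2] := q'12.
pose F w := \sum_(n < L) \sum_(j < k_ n) y n j * rv n j w.
have bG n : bfun (fun w => \sum_(j < k_ n) y n j * rv n j w).
  by apply: bfun_sum => j; apply: bfunZ; exact: bfun_rv.
have bF : bfun F by exact: bfun_sum.
have F2 : \int[mu]_w (F w * F w) = \sum_(n < L) \sum_(j < k_ n) y n j ^+ 2.
  transitivity (\sum_(n < L) \sum_(j < k_ n) y n j * \int[mu]_w (rv n j w * F w)).
    transitivity (\int[mu]_w \sum_(n < L) \sum_(j < k_ n) y n j * (rv n j w * F w)).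
      apply: eq_Rintegral => w _; rewrite {1}/F mulr_suml; apply: eq_bigr => n _.
      by rewrite mulr_suml; apply: eq_bigr => j _; rewrite mulrA.
    rewrite (bRintegral_sum lebesgue01T _ _ (F := fun (n : 'I_L) w =>
      \sum_(j < k_ n) y n j * (rv n j w * F w))); last first.
      by move=> n; apply: bfun_sum => j; apply/bfunZ/bfunM => //; exact: bfun_rv.
    apply: eq_bigr => n _.
    rewrite (bRintegral_sum lebesgue01T _ _ (F := fun (j : 'I_(k_ n)) w =>
      y n j * (rv n j w * F w))); last first.
      by move=> j; apply/bfunZ/bfunM => //; exact: bfun_rv.
    apply: eq_bigr => j _; rewrite (bRintegralZ lebesgue01T)//.
    by apply: bfunM => //; exact: bfun_rv.
  apply: eq_bigr => n _; apply: eq_bigr => j _; rewrite expr2; congr (_ * _).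
  transitivity (\int[mu]_w \sum_(n' < L) \sum_(j' < k_ n') y n' j' * (rv n j w * rv n' j' w)).
    apply: eq_Rintegral => w _; rewrite /F mulr_sumr; apply: eq_bigr => n' _.
    by rewrite mulr_sumr; apply: eq_bigr => j' _; rewrite mulrCA.
  rewrite (bRintegral_sum lebesgue01T _ _ (F := fun (n' : 'I_L) w =>
    \sum_(j' < k_ n') y n' j' * (rv n j w * rv n' j' w))); last first.
    by move=> n'; apply: bfun_sum => j'; apply/bfunZ/bfunM; exact: bfun_rv.
  have E n' : \int[mu]_w (\sum_(j' < k_ n') y n' j' * (rv n j w * rv n' j' w)) =
      \sum_(j' < k_ n') y n' j' * ((n == n' :> nat) && (j == j' :> nat))%:R.
    rewrite (bRintegral_sum lebesgue01T _ _ (F := fun (j' : 'I_(k_ n')) w =>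
      y n' j' * (rv n j w * rv n' j' w))); last first.
      by move=> j'; apply/bfunZ/bfunM; exact: bfun_rv.
    apply: eq_bigr => j' _; rewrite (bRintegralZ lebesgue01T) ?rv_orthonormal//.
    by apply: bfunM; exact: bfun_rv.
  under eq_bigr do rewrite E.
  rewrite (bigD1 n)//= [X in _ + X]big1 ?addr0 => [|n']; last first.
    by rewrite -val_eqE/= eq_sym => /negbTE ->; apply: big1 => j' _; rewrite mulr0.
  rewrite (bigD1 j)//= !eqxx mulr1 big1 ?addr0// => j'.
  by rewrite -val_eqE/= eq_sym => /negbTE ->; rewrite mulr0.
apply: (@le_trans _ _ (\int[mu]_w (t `^ q' * (1 + (t ^+ 2)^-1 * (F w * F w))))).
  apply: (ler_bRintegral lebesgue01T).
  - by apply: bfun_powR => //; exact: lt_trans q'1.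
  - by apply/bfunZ/bfunD; [exact: bfun_cst|apply/bfunZ/bfunM].
  move=> w; rewrite -/(F w).
  have -> : `|F w| = t * `|F w / t|.
    by rewrite normrM normfV (gtr0_norm t0) mulrC divfK// gt_eqF.
  rewrite powRM ?(ltW t0)// ler_wpM2l ?powR_ge0//.
  have r : 0 <= q' <= 2 by rewrite !ltW// (lt_trans ltr01).
  by apply: (le_trans (powR_le_sqr _ r)); rewrite exprMn exprVn mulrC expr2.
have bFF : bfun (fun w => (t ^+ 2)^-1 * (F w * F w)) by apply/bfunZ/bfunM.
rewrite (bRintegralZ lebesgue01T); last by apply: bfunD => //; exact: bfun_cst.
rewrite (bRintegralD lebesgue01T) ?(bRintegral_cst lebesgue01T)//; last exact: bfun_cst.
rewrite (bRintegralZ lebesgue01T); last exact: bfunM.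
rewrite F2 powRM ?(ltW t0)// [leRHS]mulrC ler_wpM2l ?powR_ge0//.
apply: (@le_trans _ _ 2); last by apply: le1r_powR; rewrite ?ler1n ?ltW.
have : (t ^+ 2)^-1 * (\sum_(n < L) \sum_(j < k_ n) y n j ^+ 2) <= 1.
  by rewrite mulrC ler_pdivrMr ?exprn_gt0// mul1r.
lra.
Qed.

(** Block [n] with squared norm [S] contributes at most [C * 2 ^ q * S ^ (q/2)], and [q > 2] allows
    [S ^ (q/2 - 1) <= t ^ (q - 2)]. What remains is linear in [S] and sums over the blocks. *)
Lemma blk_moment L (y : nat -> nat -> R) t : 0 < t ->
  \sum_(n < L) \sum_(j < k_ n) y n j ^+ 2 <= t ^+ 2 ->
  \sum_(n < L) (s_ n)%:R * avg ((2 * s_ n) ^ k_ n)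
    (fun w => `|\sum_(j < k_ n) y n j * xi (s_ n) w j| `^ q) <= (D * t) `^ q.
Proof.
move=> t0 yt; apply: le_trans (scaleD t0).
have S0 n : 0 <= \sum_(j < k_ n) y n j ^+ 2 by apply: sumr_ge0 => j _; exact: sqr_ge0.
apply: (@le_trans _ _ (\sum_(n < L) C * 2 `^ q * t `^ (q - 2) *
    \sum_(j < k_ n) y n j ^+ 2)).
  apply: ler_sum => n _; set S := \sum_(j < k_ n) y n j ^+ 2.
  (* [moment_gaussian] is applied with [t = sqrt S], which must be positive. *)
  have [SE|Sn0] := eqVneq S 0.
    have y0 (j : 'I_(k_ n)) : y n j = 0.
      apply/eqP; rewrite -sqrf_eq0; apply/eqP.
      by apply: (psumr_eq0P _ SE) => // i _; exact: sqr_ge0.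
    rewrite SE mulr0 (@eq_avg _ _ _ (fun=> 0)) ?avg_cst ?mulr0 ?expn_gt0 ?muln_gt0 ?s_gt0//.
    by move=> w _; rewrite big1 ?normr0 ?powR0 ?gt_eqF// => j _; rewrite y0 mul0r.
  have Sp : 0 < S by rewrite lt_neqAle eq_sym Sn0 S0.
  have rS : 0 < Num.sqrt S by rewrite sqrtr_gt0.
  have St : S <= t ^+ 2.
    apply: le_trans yt; rewrite (bigD1 n)//= lerDl.
    by apply: sumr_ge0 => ? _; exact: S0.
  have rt : Num.sqrt S <= t.
    rewrite -(@ler_pXn2r _ 2) ?nnegrE ?sqrtr_ge0 ?(ltW t0)//.
    by rewrite sqr_sqrtr ?(ltW Sp).
  apply: le_trans (moment_gaussian (t := Num.sqrt S) _ _ qC C0 rS _) _ => //.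
  - exact: s_gt0.
  - exact: ltW.
  - by rewrite sqr_sqrtr ?(ltW Sp).
  rewrite powRM ?sqrtr_ge0// -!mulrA; do 2!(rewrite ler_wpM2l ?powR_ge0 ?(ltW C0)//).
  rewrite -{2}(sqr_sqrtr (ltW Sp)) -powR_mulrn ?sqrtr_ge0//.
  have -> : Num.sqrt S `^ q = Num.sqrt S `^ (q - 2) * Num.sqrt S `^ 2.
    by rewrite -powRD ?subrK// (gt_eqF rS) implybT.
  rewrite ler_wpM2r ?powR_ge0//; apply: ge0_ler_powR; rewrite ?nnegrE ?sqrtr_ge0 ?(ltW t0)//.
  by rewrite subr_ge0 ltW.
rewrite -mulr_sumr; apply: (le_trans (ler_wpM2l _ yt)).
  by rewrite !mulr_ge0 ?powR_ge0// ltW.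
have E : t `^ (q - 2) * t ^+ 2 = t `^ q.
  by rewrite -powR_mulrn ?(ltW t0)// -powRD ?subrK// (gt_eqF t0) implybT.
have -> : C * 2 `^ q * t `^ (q - 2) * t ^+ 2 = C * (2 `^ q * t `^ q).
  by rewrite -E; ring.
by rewrite powRM ?(ltW t0).
Qed.

Lemma eta_cvg0 :
  (n.+1%:R^-1 + n.+1%:R^-1 `^ (2^-1 - q^-1) : R) @[n --> \oo] --> (0 : R).
Proof.
rewrite -[X in _ --> X]addr0; apply: cvgD; first exact: cvg_harmonic.
have th : 0 < 2^-1 - q^-1 by rewrite subr_gt0 ltf_pV2 ?posrE.
rewrite -[X in _ --> X](powR0 (lt0r_neq0 th)).
apply: cvg_powR => //; exact: cvg_harmonic.
Qed.

(** The factor [n \in N] erases block [m] from [b], as [matrix_estimate] demands, and the growth of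
    [s_] turns its two error terms into powers of [1 / (m + 1)]. The constant depends on none of the
    data quantified after it. *)
Lemma block_estimate : exists2 C3, 0 < C3 &
  forall m L (K : R) (b c : nat -> nat -> nat -> R), 0 < K ->
  (forall (x : nat -> R) (y : nat -> nat -> R) (t u : R),
    0 < t -> 0 < u ->
    \sum_(i < k_ m) x i ^+ 2 <= t ^+ 2 ->
    \sum_(n < L) \sum_(j < k_ n) y n j ^+ 2 <= u ^+ 2 ->
    `|\sum_(i < k_ m) \sum_(n < L) \sum_(j < k_ n) x i * y n j * b i n j|
      <= K * (t * u)) ->
  (forall (x : nat -> R) (y : nat -> nat -> R) (t u : R),
    0 < t -> 0 < u ->
    (s_ m)%:R * avg ((2 * s_ m) ^ k_ m)
      (fun w => `|\sum_(i < k_ m) x i * xi (s_ m) w i| `^ q') <= t `^ q' ->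
    \sum_(n < L) (s_ n)%:R * avg ((2 * s_ n) ^ k_ n)
      (fun w => `|\sum_(j < k_ n) y n j * xi (s_ n) w j| `^ q) <= u `^ q ->
    `|\sum_(i < k_ m) \sum_(n < L) \sum_(j < k_ n) x i * y n j * c i n j|
      <= K * (t * u)) ->
  forall N : set nat, ~ N m ->
  `|\sum_(i < k_ m) \sum_(n < L) \sum_(j < k_ n)
     ((n : nat) \in N)%:R * b i n j * c i n j| <=
  (k_ m)%:R * (K ^+ 2 * C3 * (m.+1%:R^-1 + m.+1%:R^-1 `^ (2^-1 - q^-1))).
Proof.
exists (2 * D + 2 * (1 + 64 * C)) => [|m L K b c K0 bK cK N Nm].
  by have := D0; have := C0; lra.
have bK' (x : nat -> R) (y : nat -> nat -> R) (t u : R) : 0 < t -> 0 < u ->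
    \sum_(i < k_ m) x i ^+ 2 <= t ^+ 2 ->
    \sum_(n < L) \sum_(j < k_ n) y n j ^+ 2 <= u ^+ 2 ->
    `|\sum_(i < k_ m) \sum_(n < L) \sum_(j < k_ n)
       x i * y n j * (((n : nat) \in N)%:R * b i n j)| <= K * (t * u).
  move=> t0 u0 xt yu.
  have := bK x (fun n j => (n \in N)%:R * y n j) t u t0 u0 xt.
  have yu' : \sum_(n < L) \sum_(j < k_ n) (((n : nat) \in N)%:R * y n j) ^+ 2 <= u ^+ 2.
    apply: le_trans yu; apply: ler_sum => n _; apply: ler_sum => j _.
    by case: (_ \in N); rewrite ?mul1r// mul0r expr0n sqr_ge0.
  move=> /(_ yu'); apply: le_trans; rewrite le_eqVlt; apply/orP; left; apply/eqP.
  congr `|_|; do 3![apply: eq_bigr => ? _]; ring.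
have bm i j : (m \in N)%:R * b i m j = 0 by rewrite memNset// mul0r.
have H := matrix_estimate q2 qq' C0 qC s_gt0 (@s_fast R) D0 DC
  (b := fun i n j => (n \in N)%:R * b i n j) K0 bK' cK (fun i j => bm i j).
apply: le_trans H _.
rewrite ler_wpM2l// ler_wpM2l//.
  rewrite mulr_ge0// ?sqr_ge0//; have := D0; have := C0; lra.
have sm0 : 0 < (s_ m)%:R :> R by rewrite ltr0n s_gt0.
apply: lerD.
  rewrite ler_pdivrMr// ler_pdivlMl ?ltr0n// -natrM ler_nat; exact: s_large.
have -> : q^-1 - 2^-1 = - (2^-1 - q^-1) by rewrite opprB.
set th := 2^-1 - q^-1; have th0 : 0 <= th by rewrite subr_ge0 lef_pV2 ?posrE// ltW.
rewrite -mulN1r powRrM powR_inv1 ?(ltW sm0)//.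
apply: ge0_ler_powR; rewrite ?nnegrE ?invr_ge0 ?(ltW sm0)//.
by rewrite lef_pV2 ?posrE// ler_nat s_gt.
Qed.

End moment_bounds.

(** * Bilinear forms of operators on explicit functions *)

Section forms.
Context {R : realType}.
Local Notation mu := (lebesgue01 R).
Local Notation T := (measurableTypeR R).
Variables (p p' : R) (p1 : 1 <= p).
Hypotheses (p'0 : 0 < p') (pp' : p^-1 + p'^-1 = 1).
Local Notation X := (Lp01 p1).
Local Notation cls := (@Lcls _ _ _ mu p p1 : (T -> R) -> X).
Local Notation pair := (@Lpair _ _ _ mu p p1 : X -> (T -> R) -> R).

Lemma Lpair_bop_le (V : bop X) (f h : T -> R) (a b : R) : bfun f -> bfun h ->
  0 <= a -> 0 <= b ->
  \int[mu]_t `|f t| `^ p <= a `^ p -> \int[mu]_t `|h t| `^ p' <= b `^ p' ->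
  `|pair (V (cls f)) h| <= opnorm V * (a * b).
Proof.
move=> bf bh a0 b0 fa hb.
apply: (le_trans (Lpair_le_of lebesgue01T (V (cls f)) p'0 pp' bh b0 hb)).
rewrite mulrA ler_wpM2r//; apply: (le_trans (le_opnorm V _)).
rewrite ler_wpM2l ?opnorm_ge0//; apply: norm_Lcls_le => //.
exact: (bfun_Lfun lebesgue01T).
Qed.

Lemma Lcls_comb (I : Type) (r : seq I) (c : I -> R) (F : I -> T -> R) :
  (forall i, bfun (F i)) ->
  cls (fun t => \sum_(i <- r) c i * F i t) = \sum_(i <- r) c i *: cls (F i).
Proof.
move=> bF; rewrite (Lcls_sum lebesgue01T p1 r xpredT (F := fun i t => c i * F i t)).
  by apply: eq_bigr => i _; rewrite (LclsZ lebesgue01T).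
by move=> i; exact: bfunZ.
Qed.

Lemma Lcls_comb2 L (c : nat -> nat -> R) (F : nat -> nat -> T -> R) :
  (forall n j, bfun (F n j)) ->
  cls (fun t => \sum_(n < L) \sum_(j < k_ n) c n j * F n j t) =
  \sum_(n < L) \sum_(j < k_ n) c n j *: cls (F n j).
Proof.
move=> bF; rewrite (Lcls_sum lebesgue01T p1 _ xpredT
  (F := fun (n : 'I_L) t => \sum_(j < k_ n) c n j * F n j t)); last first.
  by move=> n; apply: bfun_sum => j; exact: bfunZ.
by apply: eq_bigr => n _; exact: (Lcls_comb _ (fun j : 'I_(k_ n) => c n j)).
Qed.

Lemma Lpair_comb2 L (c : nat -> nat -> R) (F : nat -> nat -> T -> R) (x : X) :
  (forall n j, bfun (F n j)) ->
  pair x (fun t => \sum_(n < L) \sum_(j < k_ n) c n j * F n j t) =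
  \sum_(n < L) \sum_(j < k_ n) c n j * pair x (F n j).
Proof.
move=> bF.
have bG n : bfun (fun t => \sum_(j < k_ n) c n j * F n j t).
  by apply: bfun_sum => j; exact: bfunZ.
have := Lpair_sumr lebesgue01T (index_enum 'I_L) (fun=> 1) x (fun n : 'I_L => bG n).
under eq_bigr do rewrite mul1r.
under [X in Lpair x X]eq_fun => t do (under eq_bigr do rewrite mul1r).
move=> ->; apply: eq_bigr => n _.
exact: (Lpair_sumr lebesgue01T _ (fun j : 'I_(k_ n) => c n j)).
Qed.

Let pair_sumX (I : Type) (r : seq I) (c : I -> R) (w : I -> X) h : bfun h ->
  pair (\sum_(i <- r) c i *: w i) h = \sum_(i <- r) c i * pair (w i) h.
Proof.
move=> bh; have p0 : pair 0 h = 0.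
  by have := Lpair_lin lebesgue01T (-1) (0 : X) (0 : X) bh; rewrite scaler0 addr0 mulN1r addNr.
elim: r => [|i r IH]; first by rewrite !big_nil.
by rewrite !big_cons (Lpair_lin lebesgue01T)// IH.
Qed.

(** For [p > 2] this supplies the matrix bounded on l_2, and [form_full_block] the one on the sparse
    side; for [p < 2] the two are exchanged. *)
Lemma form_block_full (V : bop X) m L (x : nat -> R) (y : nat -> nat -> R)
    (f : nat -> T -> R) (F : nat -> nat -> T -> R) :
  (forall i, bfun (f i)) -> (forall n j, bfun (F n j)) ->
  \sum_(i < k_ m) \sum_(n < L) \sum_(j < k_ n) x i * y n j * pair (V (cls (f i))) (F n j) =
  pair (V (cls (fun t => \sum_(i < k_ m) x i * f i t)))
    (fun t => \sum_(n < L) \sum_(j < k_ n) y n j * F n j t).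
Proof.
move=> bf bF; rewrite (Lcls_comb _ (fun i : 'I_(k_ m) => x i) (F := fun i : 'I_(k_ m) => f i))//.
rewrite linear_sum (eq_bigr (fun i : 'I_(k_ m) => x i *: V (cls (f i)))); last first.
  by move=> i _; rewrite linearZ.
rewrite pair_sumX; last first.
  by apply: bfun_sum => n; apply: bfun_sum => j; exact: bfunZ.
apply: eq_bigr => i _; rewrite Lpair_comb2// mulr_sumr; apply: eq_bigr => n _.
by rewrite mulr_sumr; apply: eq_bigr => j _; rewrite mulrA.
Qed.

Lemma form_full_block (V : bop X) m L (x : nat -> R) (y : nat -> nat -> R)
    (f : nat -> T -> R) (F : nat -> nat -> T -> R) :
  (forall i, bfun (f i)) -> (forall n j, bfun (F n j)) ->
  \sum_(i < k_ m) \sum_(n < L) \sum_(j < k_ n) x i * y n j * pair (V (cls (F n j))) (f i) =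
  pair (V (cls (fun t => \sum_(n < L) \sum_(j < k_ n) y n j * F n j t)))
    (fun t => \sum_(i < k_ m) x i * f i t).
Proof.
move=> bf bF; rewrite (Lpair_sumr lebesgue01T _ (fun i : 'I_(k_ m) => x i) _ (F := fun i : 'I_(k_ m) => f i))//.
apply: eq_bigr => i _; rewrite Lcls_comb2//.
have -> : V (\sum_(n < L) \sum_(j < k_ n) y n j *: cls (F n j)) =
    \sum_(n < L) 1 *: \sum_(j < k_ n) y n j *: V (cls (F n j)).
  rewrite linear_sum; apply: eq_bigr => n _; rewrite scale1r linear_sum.
  by apply: eq_bigr => j _; rewrite linearZ.
rewrite pair_sumX// mulr_sumr; apply: eq_bigr => n _; rewrite mul1r pair_sumX// mulr_sumr.
by apply: eq_bigr => j _; rewrite mulrA.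
Qed.

(** For [S] nonzero take [t = sqrt S]. For [S = 0] every [t > 0] is admissible, which forces
    [N = 0]. *)
Lemma le_sqr_of_ball (S N M : R) : 0 <= M -> 0 <= N -> 0 <= S ->
  (forall t, 0 < t -> S <= t ^+ 2 -> N <= M * t) -> N ^+ 2 <= M ^+ 2 * S.
Proof.
move=> M0 N0 S0 H; have [SE|Sn0] := eqVneq S 0; last first.
  have Sp : 0 < S by rewrite lt_neqAle eq_sym Sn0.
  have r0 : 0 < Num.sqrt S by rewrite sqrtr_gt0.
  have := H _ r0; rewrite sqr_sqrtr// lexx => /(_ isT) NM.
  rewrite -[X in _ <= _ * X](sqr_sqrtr S0) -exprMn.
  by apply: lerXn2r; rewrite // nnegrE mulr_ge0// ltW.
rewrite SE mulr0 in H *; suff -> : N = 0 by rewrite expr0n.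
apply/eqP; rewrite eq_le N0 andbT leNgt; apply/negP => Np.
(* For this [t] the bound [M * t] is below [N]. *)
have t0 : 0 < N / (2 * (M + 1)) by rewrite divr_gt0// mulr_gt0// ltr_wpDl.
have := H _ t0 (sqr_ge0 _); apply/negP; rewrite -ltNge.
rewrite mulrCA gtr_pMr// ltr_pdivrMr ?mulr_gt0 ?ltr_wpDl//; lra.
Qed.

(** A Bessel inequality by duality: [x] is paired with the combination of the [F n j] whose
    coefficients are the pairings of [x] themselves. *)
Lemma Lpair_sqr_le (L : nat) (F : nat -> nat -> T -> R) (M : R) (x : X) :
  0 <= M -> (forall n j, bfun (F n j)) ->
  (forall (y : nat -> nat -> R) t, 0 < t ->
    \sum_(n < L) \sum_(j < k_ n) y n j ^+ 2 <= t ^+ 2 ->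
    \int[mu]_w `|\sum_(n < L) \sum_(j < k_ n) y n j * F n j w| `^ p' <= (M * t) `^ p') ->
  \sum_(n < L) \sum_(j < k_ n) pair x (F n j) ^+ 2 <= M ^+ 2 * `|x| ^+ 2.
Proof.
move=> M0 bF H; rewrite -exprMn; apply: le_sqr_of_selfbound => [||t t0 xt].
- by rewrite mulr_ge0.
- by apply: sumr_ge0 => n _; apply: sumr_ge0 => j _; exact: sqr_ge0.
have bS : bfun (fun w => \sum_(n < L) \sum_(j < k_ n) pair x (F n j) * F n j w).
  by apply: bfun_sum => n; apply: bfun_sum => j; exact: bfunZ.
have Mt : 0 <= M * t by rewrite mulr_ge0// ltW.
have := Lpair_le_of lebesgue01T x p'0 pp' bS Mt (H (fun n j => pair x (F n j)) t t0 xt).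
rewrite mulrCA mulrA; apply: le_trans; apply: le_trans (ler_norm _).
by rewrite (Lpair_comb2 L (fun n j => pair x (F n j))).
Qed.

Lemma Lcls_sqr_le (L : nat) (F : nat -> nat -> T -> R) (M : R) (y : nat -> nat -> R) :
  0 <= M -> (forall n j, bfun (F n j)) ->
  (forall (y : nat -> nat -> R) t, 0 < t ->
    \sum_(n < L) \sum_(j < k_ n) y n j ^+ 2 <= t ^+ 2 ->
    \int[mu]_w `|\sum_(n < L) \sum_(j < k_ n) y n j * F n j w| `^ p <= (M * t) `^ p) ->
  `|\sum_(n < L) \sum_(j < k_ n) y n j *: cls (F n j)| ^+ 2 <=
  M ^+ 2 * \sum_(n < L) \sum_(j < k_ n) y n j ^+ 2.
Proof.
move=> M0 bF H; apply: le_sqr_of_ball => // [|t t0 yt].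
  by apply: sumr_ge0 => n _; apply: sumr_ge0 => j _; exact: sqr_ge0.
rewrite -Lcls_comb2//; apply: norm_Lcls_le.
- by apply: (bfun_Lfun lebesgue01T) => //; apply: bfun_sum => n; apply: bfun_sum => j; exact: bfunZ.
- by rewrite mulr_ge0// ltW.
- exact: H.
Qed.

End forms.

(** * The lower bound, for p > 2 and for p < 2 *)

Section lower_bound.
Context {R : realType}.
Local Notation mu := (lebesgue01 R).
Local Notation T := (measurableTypeR R).

Lemma moment_constants (q : R) : 2 < q -> exists C D : R,
  [/\ 0 < C, forall x : R, `|x| `^ q <= C * (ch x - 1), 0 < D & C * 2 `^ q <= D `^ q].
Proof.
move=> q2; have [C C0 qC] := powR_le_ch (ltW q2).
have q0 : 0 < q by exact: lt_trans q2.
have c0 : 0 < C * 2 `^ q by rewrite mulr_gt0// powR_gt0.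
exists C, ((C * 2 `^ q) `^ q^-1); split => //; first exact: powR_gt0.
by rewrite -powRrM mulVf ?gt_eqF// powRr1// ltW.
Qed.

Let delta_sum m i (h : nat -> R) : (i < k_ m)%N ->
  \sum_(l < k_ m) (l == i :> nat)%:R * h l = h i.
Proof.
move=> ik; rewrite (bigD1 (Ordinal ik))//= eqxx mul1r big1 ?addr0// => l.
by rewrite -val_eqE/= => /negbTE ->; rewrite mul0r.
Qed.

Let delta_sqr m i : (i < k_ m)%N ->
  \sum_(l < k_ m) ((l == i :> nat)%:R : R) ^+ 2 <= 1 ^+ 2.
Proof.
move=> ik; rewrite (bigD1 (Ordinal ik))//= eqxx !expr1n big1 ?addr0// => l.
by rewrite -val_eqE/= => /negbTE ->; rewrite expr0n.
Qed.

Lemma rv_norm (q C D : R) m i : 2 < q -> 0 < C ->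
  (forall x : R, `|x| `^ q <= C * (ch x - 1)) -> 0 < D -> C * 2 `^ q <= D `^ q ->
  (i < k_ m)%N -> \int[mu]_w `|@rv R m i w| `^ q <= D `^ q.
Proof.
move=> q2 C0 qC D0 DC im.
have := rv_block_moment q2 C0 qC D0 DC (x := fun l => (l == i)%:R) ltr01 (delta_sqr im).
by under eq_Rintegral do rewrite (delta_sum (fun l => rv m l _) im); rewrite mulr1.
Qed.

Lemma closed_ideals_ge_gt2 (p : R) (p1 : 1 <= p) : 2 < p ->
  [set: set R] #<= closed_ideals (Lp01 p1).
Proof.
move=> p2; have p_gt1 : 1 < p by apply: lt_trans p2; rewrite ltr1n.
have p0 : 0 < p by apply: lt_trans p2.
have pV1 : p^-1 < 1 by rewrite invf_lt1.
pose q' := (1 - p^-1)^-1; have q'0 : 0 < q' by rewrite invr_gt0 subr_gt0.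
have pq' : p^-1 + q'^-1 = 1 by rewrite invrK addrC subrK.
have [C [D [C0 qC D0 DC]]] := moment_constants p2.
have [C3 C30 est] := block_estimate p2 pq' C0 qC D0 DC.
pose f := @blk R s_ k_ p; pose g := @blk R s_ k_ q'.
have bf n j : bfun (f n j) by exact: (bfun_blk _ s_gt0).
have bg n j : bfun (g n j) by exact: (bfun_blk _ s_gt0).
have br n j : bfun (@rv R n j) by exact: bfun_rv.
pose al n j (x : Lp01 p1) := @Lpair _ _ _ mu p p1 x (@rv R n j).
pose be n j : Lp01 p1 := @Lcls _ _ _ mu p p1 (f n j).
pose u m i : Lp01 p1 := @Lcls _ _ _ mu p p1 (@rv R m i).
pose v m i (x : Lp01 p1) := @Lpair _ _ _ mu p p1 x (g m i).
(* [2] is the constant of [rv_full_moment] at the conjugate exponent, [D] that of the sparse sums in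
   L_p. [u] has norm at most [D] and [v] at most 1, whence [D + 1]. *)
apply: (@closed_ideals_ge_of_estimate R (Lp01 p1) _ k_ al be (2 ^+ 2) (D ^+ 2)
  _ _ _ _ _ u v (D + 1)).
- exact: (Lp_complete lebesgue01T p_gt1).
- by rewrite exprn_ge0.
- by rewrite exprn_gt0.
- by move=> n j a x y; exact: (Lpair_lin lebesgue01T).
- move=> L x; apply: (Lpair_sqr_le q'0 pq') => // y t t0 yt.
  exact: (rv_full_moment p2 pq').
- move=> L y; apply: Lcls_sqr_le => //; first exact: ltW.
  move=> z t t0 zt; rewrite (Rintegral_blk k_ s_gt0)//.
  exact: (blk_moment p2 C0 qC D0 DC).
- by move=> m; rewrite expn_gt0 s_gt0.
- by move=> m i a x y; exact: (Lpair_lin lebesgue01T).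
- move=> m i x im; apply: (@le_trans _ _ (`|x| * 1)).
    apply: (Lpair_le_of lebesgue01T) pq' _ _ _ => //.
    by rewrite powR1 (Rintegral_blk_unit s_gt0).
  by rewrite mulr1 ler_peMl// lerDr ltW.
- move=> m i n j im jn; rewrite /al /v /u /be !(Lpair_Lcls lebesgue01T)//.
  rewrite rv_orthonormal// (Rintegral_blk2 s_gt0)//.
  by rewrite -natrM mulnb [m == n]eq_sym [i == j]eq_sym andbb.
- exists (fun m => m.+1%:R^-1 + m.+1%:R^-1 `^ (2^-1 - p^-1)); first exact: eta_cvg0.
  (* One constant for both forms: the first is bounded by [opnorm V * (2 * D)], the second by
     [opnorm S]. *)
  move=> S V; pose K := (opnorm S + opnorm V + 1) * (2 * D + 1).
  have oS := opnorm_ge0 S; have oV := opnorm_ge0 V.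
  have K0 : 0 < K by rewrite mulr_gt0//; lra.
  exists (K ^+ 2 * C3); first by rewrite mulr_ge0// ?sqr_ge0// ltW.
  move=> m L N Nm; apply: (est m L K (fun i n j => al n j (V (u m i)))
    (fun i n j => v m i (S (be n j))) K0 _ _ N Nm).
    move=> x y t w t0 w0 xt yw; rewrite form_block_full//.
    have Dt : 0 <= D * t by rewrite mulr_ge0// ltW.
    have w2 : 0 <= 2 * w by rewrite mulr_ge0// ltW.
    apply: (le_trans (Lpair_bop_le q'0 pq' V _ _ Dt w2 _ _)).
    + by apply: bfun_sum => i; exact: bfunZ.
    + by apply: bfun_sum => n; apply: bfun_sum => j; exact: bfunZ.
    + exact: (rv_block_moment p2 C0 qC D0 DC).
    + exact: (rv_full_moment p2 pq').
    rewrite (_ : _ * _ = (opnorm V * (2 * D)) * (t * w)); last by ring.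
    rewrite ler_wpM2r ?mulr_ge0 ?(ltW t0) ?(ltW w0)// /K.
    by apply: ler_pM => //; rewrite ?mulr_ge0 ?(ltW D0)//; lra.
  move=> x y t w t0 w0 xt yw; rewrite form_full_block//.
  apply: (le_trans (Lpair_bop_le q'0 pq' S _ _ (ltW w0) (ltW t0) _ _)).
  + by apply: bfun_sum => n; apply: bfun_sum => j; exact: bfunZ.
  + by apply: bfun_sum => i; exact: bfunZ.
  + by rewrite (Rintegral_blk k_ s_gt0).
  + by rewrite (Rintegral_blk_block k_ s_gt0).
  rewrite [w * t]mulrC ler_wpM2r ?mulr_ge0 ?(ltW t0) ?(ltW w0)// /K.
  by rewrite -[leLHS]mulr1; apply: ler_pM => //; lra.
- move=> m i im; apply: (@le_trans _ _ D); last by rewrite lerDl.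
  apply: norm_Lcls_le => //; first exact: (bfun_Lfun lebesgue01T).
    exact: ltW.
  exact: (rv_norm p2 C0 qC).
Qed.

Lemma closed_ideals_ge_lt2 (p : R) (p1 : 1 <= p) : 1 < p -> p < 2 ->
  [set: set R] #<= closed_ideals (Lp01 p1).
Proof.
move=> p_gt1 p2; have p0 : 0 < p by apply: lt_trans p_gt1.
have pV1 : p^-1 < 1 by rewrite invf_lt1.
pose q := (1 - p^-1)^-1; have q0 : 0 < q by rewrite invr_gt0 subr_gt0.
have pq : p^-1 + q^-1 = 1 by rewrite invrK addrC subrK.
have qp : q^-1 + p^-1 = 1 by rewrite addrC.
have q2 : 2 < q.
  rewrite -ltf_pV2 ?posrE// /q invrK.
  have : 2^-1 < p^-1 by rewrite ltf_pV2 ?posrE.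
  lra.
have [C [D [C0 qC D0 DC]]] := moment_constants q2.
have [C3 C30 est] := block_estimate q2 qp C0 qC D0 DC.
pose f := @blk R s_ k_ q; pose g := @blk R s_ k_ p.
have bf n j : bfun (f n j) by exact: (bfun_blk _ s_gt0).
have bg n j : bfun (g n j) by exact: (bfun_blk _ s_gt0).
have br n j : bfun (@rv R n j) by exact: bfun_rv.
pose al n j (x : Lp01 p1) := @Lpair _ _ _ mu p p1 x (f n j).
pose be n j : Lp01 p1 := @Lcls _ _ _ mu p p1 (@rv R n j).
pose u m i : Lp01 p1 := @Lcls _ _ _ mu p p1 (g m i).
pose v m i (x : Lp01 p1) := @Lpair _ _ _ mu p p1 x (@rv R m i).
(* The constants trade places: [al] is controlled by sparse sums at the conjugate exponent [q], and
   [be] by Rademacher sums in L_p. *)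
apply: (@closed_ideals_ge_of_estimate R (Lp01 p1) _ k_ al be (D ^+ 2) (2 ^+ 2)
  _ _ _ _ _ u v (D + 1)).
- exact: (Lp_complete lebesgue01T p_gt1).
- by rewrite exprn_ge0// ltW.
- by rewrite exprn_gt0.
- by move=> n j a x y; exact: (Lpair_lin lebesgue01T).
- move=> L x; apply: (Lpair_sqr_le q0 pq) => //; first exact: ltW.
  move=> y t t0 yt; rewrite (Rintegral_blk k_ s_gt0)//.
  exact: (blk_moment q2 C0 qC D0 DC).
- move=> L y; apply: Lcls_sqr_le => // z t t0 zt.
  exact: (rv_full_moment q2 qp).
- by move=> m; rewrite expn_gt0 s_gt0.
- by move=> m i a x y; exact: (Lpair_lin lebesgue01T).
- move=> m i x im; apply: (@le_trans _ _ (`|x| * D)).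
    apply: (Lpair_le_of lebesgue01T) pq _ _ _ => //; first exact: ltW.
    exact: (rv_norm q2 C0 qC).
  by rewrite mulrC ler_wpM2r// lerDl.
- move=> m i n j im jn; rewrite /al /v /u /be !(Lpair_Lcls lebesgue01T)//.
  rewrite rv_orthonormal// (Rintegral_blk2 s_gt0)//.
  by rewrite -natrM mulnb [m == n]eq_sym [i == j]eq_sym andbb.
- exists (fun m => m.+1%:R^-1 + m.+1%:R^-1 `^ (2^-1 - q^-1)); first exact: eta_cvg0.
  move=> S V; pose K := (opnorm S + opnorm V + 1) * (2 * D + 1).
  have oS := opnorm_ge0 S; have oV := opnorm_ge0 V.
  have K0 : 0 < K by rewrite mulr_gt0//; lra.
  exists (K ^+ 2 * C3); first by rewrite mulr_ge0// ?sqr_ge0// ltW.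
  move=> m L N Nm.
  (* The matrix bounded on l_2 now comes from [S], so the two factors are exchanged before [est]
     applies. *)
  rewrite (_ : \sum_(i < k_ m) _ = \sum_(i < k_ m) \sum_(n < L) \sum_(j < k_ n)
    ((n : nat) \in N)%:R * v m i (S (be n j)) * al n j (V (u m i))); last first.
    by do 3![apply: eq_bigr => ? _]; rewrite mulrAC.
  apply: (est m L K (fun i n j => v m i (S (be n j)))
    (fun i n j => al n j (V (u m i))) K0 _ _ N Nm).
    move=> x y t w t0 w0 xt yw; rewrite form_full_block//.
    have Dt : 0 <= D * t by rewrite mulr_ge0// ltW.
    have w2 : 0 <= 2 * w by rewrite mulr_ge0// ltW.
    apply: (le_trans (Lpair_bop_le q0 pq S _ _ w2 Dt _ _)).
    + by apply: bfun_sum => n; apply: bfun_sum => j; exact: bfunZ.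
    + by apply: bfun_sum => i; exact: bfunZ.
    + exact: (rv_full_moment q2 qp).
    + exact: (rv_block_moment q2 C0 qC D0 DC).
    rewrite (_ : _ * _ = (opnorm S * (2 * D)) * (t * w)); last by ring.
    rewrite ler_wpM2r ?mulr_ge0 ?(ltW t0) ?(ltW w0)// /K.
    by apply: ler_pM => //; rewrite ?mulr_ge0 ?(ltW D0)//; lra.
  move=> x y t w t0 w0 xt yw; rewrite form_block_full//.
  apply: (le_trans (Lpair_bop_le q0 pq V _ _ (ltW t0) (ltW w0) _ _)).
  + by apply: bfun_sum => i; exact: bfunZ.
  + by apply: bfun_sum => n; apply: bfun_sum => j; exact: bfunZ.
  + by rewrite (Rintegral_blk_block k_ s_gt0).
  + by rewrite (Rintegral_blk k_ s_gt0).
  rewrite ler_wpM2r ?mulr_ge0 ?(ltW t0) ?(ltW w0)// /K.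
  by rewrite -[leLHS]mulr1; apply: ler_pM => //; lra.
- move=> m i im; apply: (@le_trans _ _ 1); last by rewrite lerDr ltW.
  apply: norm_Lcls_le => //; first exact: (bfun_Lfun lebesgue01T).
  by rewrite powR1 (Rintegral_blk_unit s_gt0).
Qed.

End lower_bound.

(** * Counting operators *)

Section continuum.
Context {R : realType}.

(** Digits 0 and 1 in base 3, where, unlike in base 2, distinct digit sequences have distinct
    sums. *)
Definition ternary_sum (A : set nat) n : R := \sum_(i < n) ((i : nat) \in A)%:R * 3^-1 ^+ i.

Lemma ternary_sumS A n :
  ternary_sum A n.+1 = ternary_sum A n + (n \in A)%:R * 3^-1 ^+ n.
Proof. by rewrite /ternary_sum big_ord_recr. Qed.

Lemma ternary_sum_cvg A : cvgn (ternary_sum A).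
Proof.
have t0 i : 0 <= (3^-1 : R) ^+ i by rewrite exprn_ge0.
apply: nondecreasing_is_cvgn.
  apply/nondecreasing_seqP => n; rewrite ternary_sumS lerDl.
  by rewrite mulr_ge0.
exists 2 => _ [n _ <-]; apply: (@le_trans _ _ (\sum_(i < n) 3^-1 ^+ i)).
  by apply: ler_sum => i _; case: (_ \in A); rewrite ?mul1r// mul0r.
have : \sum_(i < n) 3^-1 ^+ i = 3 / 2 * (1 - 3^-1 ^+ n) :> R.
  elim: n => [|n IH]; first by rewrite big_ord0 expr0 subrr mulr0.
  by rewrite big_ord_recr/= IH exprS; field.
by move=> ->; have := t0 n; lra.
Qed.

Lemma ternary_sum_lt (A B : set nat) n0 :
  (forall i, (i < n0)%N -> (i \in A) = (i \in B)) -> n0 \in A -> n0 \notin B ->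
  limn (ternary_sum B) < limn (ternary_sum A).
Proof.
move=> AB n0A n0B; have t0 i : 0 <= (3^-1 : R) ^+ i by rewrite exprn_ge0.
have t1 : 0 < (3^-1 : R) ^+ n0 by rewrite exprn_gt0// invr_gt0.
have base : ternary_sum A n0 = ternary_sum B n0.
  by apply: eq_bigr => i _; rewrite AB.
(* [3^-(n0+n) / 2] is the total weight of the digits still to come, so the lead of [A] never falls
   below half the weight of digit [n0]. *)
have gap n : ternary_sum B (n0.+1 + n) + 3^-1 ^+ n0 / 2 <=
    ternary_sum A (n0.+1 + n) - 3^-1 ^+ (n0 + n) / 2.
  elim: n => [|n IH].
    rewrite !addn0 !ternary_sumS.
    by rewrite base n0A (negbTE n0B) mul1r mul0r; lra.
  rewrite addnS (ternary_sumS A (n0.+1 + n)) (ternary_sumS B (n0.+1 + n)).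
  have -> : (n0 + n.+1 = n0.+1 + n)%N by rewrite addnS.
  have E : (3^-1 : R) ^+ (n0 + n) = 3 * 3^-1 ^+ (n0.+1 + n).
    by rewrite addSn exprS; field.
  rewrite E in IH; have := t0 (n0.+1 + n)%N.
  by case: (_ \in A); case: (_ \in B); rewrite ?mul1r ?mul0r; lra.
have cA := @ternary_sum_cvg A; have cB := @ternary_sum_cvg B.
suff : limn (ternary_sum B) + 3^-1 ^+ n0 / 2 <= limn (ternary_sum A) by lra.
have lB : ternary_sum B n + 3^-1 ^+ n0 / 2 @[n --> \oo] -->
    limn (ternary_sum B) + 3^-1 ^+ n0 / 2 by apply: cvgD => //; exact: cvg_cst.
rewrite -(cvg_lim _ lB)//; apply: ler_lim => //; first exact: cvgP lB.
exists n0.+1 => // n /= n0n; rewrite -(subnKC n0n).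
by apply: (le_trans (gap _)); rewrite lerBlDr lerDl divr_ge0.
Qed.

Lemma set_nat_inj_real : exists g : set nat -> R, injective g.
Proof.
exists (fun A => limn (ternary_sum A)) => A B; apply: contraPP => /eqP AB lAB.
have [n0 n0P] : exists n, (n \in A) != (n \in B).
  apply: contrapT => nAB; apply/negP: AB; rewrite negbK; apply/eqP/seteqP.
  have E n : (n \in A) = (n \in B).
    by apply/eqP; apply: contrapT => /negP nn; apply: nAB; exists n.
  by split=> n /mem_set; [rewrite E|rewrite -E] => /set_mem.
have [n n0' nmin] := @ex_minnP _ (ex_intro (fun n => (n \in A) != (n \in B)) n0 n0P).
have eqn i : (i < n)%N -> (i \in A) = (i \in B).
  by move=> iltn; apply/eqP; apply: contraTT iltn => /nmin; rewrite -leqNgt.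
have [nA|nA] := boolP (n \in A).
  have nB : n \notin B by move: n0'; rewrite nA; case: (_ \in B).
  by have := ternary_sum_lt eqn nA nB; rewrite lAB ltxx.
have nB : n \in B by move: n0'; rewrite (negbTE nA); case: (_ \in B).
have eqn' i : (i < n)%N -> (i \in B) = (i \in A) by move=> /eqn.
by have := ternary_sum_lt eqn' nB nA; rewrite lAB ltxx.
Qed.

(** A countable family of reals is recorded by its Dedekind cuts, together one subset of the
    countable type [I * rat]. *)
Lemma real_family_inj (I : countType) : exists g : (I -> R) -> R, injective g.
Proof.
have [g ginj] := set_nat_inj_real.
pose cuts (f : I -> R) : set nat :=
  [set pickle z | z in [set z : I * rat | ratr z.2 < f z.1]].
exists (g \o cuts) => f f' /ginj ff'; apply/funext => i.
have cut_le (h h' : I -> R) : cuts h = cuts h' -> h i <= h' i.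
  move=> hh'; rewrite leNgt; apply/negP => /rat_in_itvoo[r]; rewrite in_itv/= => /andP[h'r rh].
  have : cuts h (pickle (i, r)) by exists (i, r).
  rewrite hh' => -[z zh' /(pcan_inj pickleK) zE]; move: zh'; rewrite zE/= => /lt_trans/(_ h'r).
  by rewrite ltxx.
by apply/eqP; rewrite eq_le !cut_le.
Qed.

End continuum.

(** * Separability of L_p *)

Section density.
Context {R : realType}.
Local Notation mu := (lebesgue01 R).
Local Notation T := (measurableTypeR R).
Variables (p : R) (p1 : 1 <= p).
Local Notation X := (Lp01 p1).
Local Notation cls := (@Lcls _ _ _ mu p p1 : (T -> R) -> X).

Let p1e : (1%:E <= p%:E)%E := p1.

Let p0 : 0 < p. Proof. exact: lt_le_trans p1. Qed.

(** The index type is countable. Rays are used because they generate the Borel sets and are stable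
    under intersection. *)
Definition step_comb (l : seq (rat * rat)) : X :=
  \sum_(z <- l) ratr z.1 *: cls (\1_(`]ratr z.2, +oo[%classic : set T)).

Definition approximable (x : X) := forall e, 0 < e -> exists l, `|x - step_comb l| <= e.

Lemma approximable_lim x :
  (forall e, 0 < e -> exists2 y, approximable y & `|x - y| <= e) -> approximable x.
Proof.
move=> H e e0; have e2 : 0 < e / 2 by rewrite divr_gt0.
have [y /(_ _ e2)[l yl] xy] := H _ e2; exists l.
rewrite -(subrK y x) -addrA [leRHS](splitr e); apply: (le_trans (ler_normD _ _)).
exact: lerD.
Qed.

Lemma approximable0 : approximable 0.
Proof. by move=> e e0; exists [::]; rewrite /step_comb big_nil subrr normr0 ltW. Qed.

Lemma approximableD x y : approximable x -> approximable y -> approximable (x + y).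
Proof.
move=> Hx Hy e e0; have e2 : 0 < e / 2 by rewrite divr_gt0.
have [l xl] := Hx _ e2; have [l' yl'] := Hy _ e2; exists (l ++ l').
rewrite /step_comb big_cat/= opprD addrACA [leRHS](splitr e).
by apply: (le_trans (ler_normD _ _)); exact: lerD.
Qed.

Lemma approximableZ a x : approximable x -> approximable (a *: x).
Proof.
move=> Hx e e0; have e2 : 0 < e / 2 by rewrite divr_gt0.
have a1 : 0 < `|a| + 1 by rewrite ltr_wpDl.
have [l xl] := Hx _ (divr_gt0 e2 a1).
have d1 : 0 < `|step_comb l| + 1 by rewrite ltr_wpDl.
(* A rational coefficient so close to [a] that replacing [a] by it costs at most [e / 2] on this
   fixed [step_comb l]. *)
have [r] := @rat_in_itvoo R _ _ (ltr_pwDr (divr_gt0 e2 d1) (lexx a)).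
rewrite in_itv/= => /andP[ar ra].
exists [seq (r * z.1, z.2) | z <- l].
have -> : step_comb [seq (r * z.1, z.2) | z <- l] = ratr r *: step_comb l.
  rewrite /step_comb big_map scaler_sumr; apply: eq_bigr => z _ /=.
  by rewrite scalerA rmorphM.
have -> : a *: x - ratr r *: step_comb l =
    a *: (x - step_comb l) + (a - ratr r) *: step_comb l.
  by rewrite scalerBr scalerBl addrA subrK.
apply: (le_trans (ler_normD _ _)); rewrite [leRHS](splitr e) !normrZ; apply: lerD.
  apply: (@le_trans _ _ ((`|a| + 1) * `|x - step_comb l|)); first by rewrite ler_wpM2r// lerDl.
  by rewrite mulrC -ler_pdivlMr.
apply: (@le_trans _ _ (`|a - ratr r| * (`|step_comb l| + 1))); first by rewrite ler_wpM2l// lerDl.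
rewrite -ler_pdivlMr// distrC ger0_norm ?subr_ge0 ?(ltW ar)//.
by rewrite lerBlDl ltW.
Qed.

Lemma approximable_sum (I : Type) (r : seq I) (F : I -> X) :
  (forall i, approximable (F i)) -> approximable (\sum_(i <- r) F i).
Proof.
move=> H; elim: r => [|i r IH]; first by rewrite big_nil; exact: approximable0.
by rewrite big_cons; exact: approximableD.
Qed.

(** Dominated convergence for [|f - f_ n|^p], with the majorant [(2 |g|)^p]. *)
Lemma Lcls_dominated (f_ : nat -> T -> R) (f g : T -> R) :
  (forall n, f_ n \in Lfun mu p%:E) -> f \in Lfun mu p%:E -> g \in Lfun mu p%:E ->
  (forall t, f_ n t @[n --> \oo] --> f t) -> (forall n t, `|f_ n t| <= g t) ->
  (forall n, approximable (cls (f_ n))) -> approximable (cls f).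
Proof.
move=> Pf_ Pf Pg f_f f_g Hf; apply: approximable_lim => e e0.
have mL (h : T -> R) : h \in Lfun mu p%:E -> measurable_fun setT h.
  by rewrite inE => /andP[]; rewrite inE.
have fg t : `|f t| <= g t.
  have nf : `|f_ n t| @[n --> \oo] --> `|f t| by apply: cvg_norm.
  have := limr_le (cvgP _ nf); rewrite (cvg_lim _ nf)//; apply.
  exact: nearW.
have Pd n : (fun t => f t - f_ n t) \in Lfun mu p%:E.
  exact: (LfunP (Lfun_Sub p1e Pf - Lfun_Sub p1e (Pf_ n))).
have i2g : mu.-integrable setT (fun t => (2 `^ p * `|g t| `^ p)%:E).
  have := Lfun_integrable p1 Pg => /(integrableZl measurableT (2 `^ p)).
  by apply: eq_integrable => // t _; rewrite EFinM.
have := @dominated_convergence _ _ _ mu setT measurableT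
  (fun n t => (`|f t - f_ n t| `^ p)%:E) (cst 0%E) (fun t => (2 `^ p * `|g t| `^ p)%:E).
case.
- move=> n; apply/measurable_EFinP/(measurableT_comp (measurable_powR _)).
  by apply: measurableT_comp => //; apply: measurable_funB; exact: mL.
- exact: measurable_cst.
- apply: aeW => t _; apply: cvg_EFin; first exact: nearW.
  rewrite -[X in _ --> X](powR0 (lt0r_neq0 p0)); apply: cvg_powR => //.
  rewrite -(normr0 R) -(subrr (f t)); apply: cvg_norm; apply: cvgB => //; exact: cvg_cst.
- exact: i2g.
- apply: aeW => t n _; rewrite /= lee_fin ger0_norm ?powR_ge0//.
  rewrite -powRM//; apply: ge0_ler_powR; rewrite ?nnegrE ?mulr_ge0 ?(ltW p0)//.
  apply: (le_trans (ler_normB _ _)); rewrite mulr_natl mulr2n.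
  by apply: lerD; apply: le_trans (ler_norm _).
move=> _ _; rewrite integral0 => cv.
have ep : 0 < e `^ p by rewrite powR_gt0.
have /fine_cvg/cvgrPdist_le/(_ _ ep)[n _ /(_ n (leqnn n))] := cv.
rewrite sub0r normrN => /(le_trans (ler_norm _)) H.
exists (cls (f_ n)) => //.
have -> : cls f - cls (f_ n) = cls (fun t => f t - f_ n t).
  rewrite -[LHS]addrC -scaleN1r -Lcls_lin//.
  by congr Lcls; apply/funext => t; rewrite mulN1r addrC.
apply: norm_Lcls_le => //; first exact: ltW.
Qed.

Lemma bfun_indic (A : set T) : measurable A -> bfun (\1_A : T -> R).
Proof.
move=> mA; split; first exact: measurable_indic.
by exists 1 => t; rewrite indicE ger0_norm// lern1; case: (_ \in _).
Qed.

Let Lfun_indic (A : set T) : measurable A -> (\1_A : T -> R) \in Lfun mu p%:E.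
Proof. by move=> mA; exact/(bfun_Lfun lebesgue01T)/bfun_indic. Qed.

Let Lfun_1 : (cst 1 : T -> R) \in Lfun mu p%:E.
Proof. exact/(bfun_Lfun lebesgue01T)/bfun_cst. Qed.

Let indic_le1 (A : set T) t : `|\1_A t| <= 1 :> R.
Proof. by rewrite indicE ger0_norm// lern1; case: (_ \in _). Qed.

(** Rational endpoints tend to [a] from above: the rays are open at [a], so the indicators then
    converge at every point, [a] included. *)
Lemma approximable_ray (a : R) : approximable (cls \1_(`]a, +oo[%classic : set T)).
Proof.
have /choice[q qP] : forall n, exists q : rat, a < ratr q < a + n.+1%:R^-1.
  move=> n; have [|q] := @rat_in_itvoo R a (a + n.+1%:R^-1); first by rewrite ltrDl invr_gt0.
  by rewrite in_itv; exists q.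
apply: (@Lcls_dominated (fun n => \1_(`]ratr (q n), +oo[%classic : set T)) _ (cst 1)) => //.
- by move=> n; exact: Lfun_indic.
- exact: Lfun_indic.
- move=> t; have [ta|at_] := leP t a.
    rewrite (_ : (fun n => _) = (fun=> \1_(`]a, +oo[%classic : set T) t)); first exact: cvg_cst.
    apply/funext => n; rewrite !indicE !memNset//= in_itv/= andbT; apply/negP; rewrite -leNgt//.
    by have /andP[/ltW + _] := qP n; exact: le_trans.
  apply: cvg_near_cst.
  have ta0 : 0 < t - a by rewrite subr_gt0.
  have := @cvg_harmonic R => /cvgrPdist_lt/(_ _ ta0); apply: filterS => n /=.
  rewrite sub0r normrN ger0_norm// => h; rewrite !indicE !mem_set//= in_itv/= andbT//.
  by have /andP[_] := qP n => /lt_trans; apply; rewrite -ltrBrDl.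
- move=> n e e0; exists [:: (1, q n)].
  by rewrite /step_comb big_seq1/= rmorph1 scale1r subrr normr0 ltW.
Qed.

(** Dynkin's theorem for the pi-system of rays. Complements use the constant 1, itself a limit of
    rays; disjoint unions use dominated convergence with majorant 1. *)
Lemma approximable_indic (A : set T) : measurable A -> approximable (cls \1_A).
Proof.
have one : approximable (cls (cst 1)).
  apply: (@Lcls_dominated (fun n => \1_(`](- n%:R), +oo[%classic : set T)) _ (cst 1)) => //.
  - by move=> n; exact: Lfun_indic.
  - move=> t; apply: cvg_near_cst; exists (Num.truncn `|t|).+1 => // n /= tn.
    rewrite indicE mem_set//= in_itv/= andbT ltrNl.
    apply: le_lt_trans (_ : `|t| < n%:R); first by rewrite -normrN ler_norm.
    by apply: lt_le_trans (truncnS_gt _) _; rewrite ler_nat.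
  - by move=> n; exact: approximable_ray.
have mE : @measurable _ T = <<s (@RGenOInfty.G R) >> by exact: RGenOInfty.measurableE.
rewrite mE.
apply: (dynkin_induction mE (P := fun A => approximable (cls \1_A))) => //.
- move=> _ _ [x ->] [y ->]; exists (Num.max x y); apply/seteqP; split=> t /=;
    rewrite !in_itv/= !andbT gt_max; first by case=> -> ->.
  by move=> /andP.
- by rewrite indicT.
- by move=> _ [x ->]; exact: approximable_ray.
- move=> S mS HS.
  have -> : cls \1_(~` S) = cls (cst 1) + -1 *: cls \1_S.
    rewrite addrC -Lcls_lin//; last exact: Lfun_indic.
    congr Lcls; apply/funext => t; rewrite mulN1r addrC /= !indicE in_setC.
    by case: (t \in S); rewrite ?subrr ?subr0.
  by apply: approximableD => //; exact: approximableZ.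
move=> F mF tF HF.
apply: (@Lcls_dominated (fun n t => \sum_(k < n) \1_(F k) t) _ (cst 1)) => //.
- move=> n; apply: (bfun_Lfun lebesgue01T) => //; apply: bfun_sum => k; exact: bfun_indic.
- by apply: Lfun_indic; exact: bigcup_measurable.
- move=> t; apply: cvg_near_cst.
  have [[k _ Fkt]|nF] := pselect ((\bigcup_k F k) t).
    exists k.+1 => // n /= kn; rewrite indicE mem_set; last by exists k.
    rewrite (bigD1 (Ordinal kn))//= indicE mem_set// big1 ?addr0// => i.
    rewrite -val_eqE/= => ik; rewrite indicE memNset// => Fit.
    by rewrite (tF i k I I (ex_intro _ t (conj Fit Fkt))) eqxx in ik.
  exists 0%N => // n _; rewrite indicE memNset// big1// => i _.
  by rewrite indicE memNset// => Fit; apply: nF; exists i.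
- move=> n t; rewrite ger0_norm ?sumr_ge0//.
  have [[k Fkt]|nF] := pselect (exists k : 'I_n, F k t).
    rewrite (bigD1 k)//= [X in _ + X]big1 ?addr0; first exact: le_trans (ler_norm _) (indic_le1 _ _).
    move=> i; rewrite -val_eqE/= => ik; rewrite indicE memNset// => Fit.
    by rewrite (tF i k I I (ex_intro _ t (conj Fit Fkt))) eqxx in ik.
  by rewrite big1// => i _; rewrite indicE memNset// => Fit; apply: nF; exists i.
- move=> n; rewrite (Lcls_sum lebesgue01T p1 _ xpredT (F := fun k : 'I_n => \1_(F k))).
    by apply: approximable_sum => k.
  by move=> k; exact: bfun_indic.
Qed.

Lemma approximable_bfun (f : T -> R) : bfun f -> approximable (cls f).
Proof.
move=> bf; have [mf [M fM]] := bf.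
apply: approximable_lim => e e0; pose N := (Num.truncn e^-1).+1.
have N0 : 0 < N%:R :> R by rewrite ltr0n.
have Ne : N%:R^-1 <= e by rewrite invf_ple// ltW// truncnS_gt.
(* Adding [M] makes the argument nonnegative, so truncation is the floor; [h] takes the lower end of
   the level of width [1 / N] that contains [f t]. *)
pose c t := Num.truncn (N%:R * (f t + M)).
pose B := (Num.truncn (N%:R * (M + M))).+1.
pose S i : set T := [set t | i%:R / N%:R - M <= f t < i.+1%:R / N%:R - M].
have mS i : measurable (S i).
  rewrite (_ : S i = f @^-1` `[i%:R / N%:R - M, i.+1%:R / N%:R - M[%classic).
    by rewrite -[X in measurable X]setTI; apply: mf.
  by apply/seteqP; split=> t /=; rewrite in_itv.
have fM0 t : 0 <= N%:R * (f t + M).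
  by rewrite mulr_ge0// -lerBlDr sub0r lerNl (le_trans _ (fM t))// -normrN ler_norm.
have Sc t i : (t \in S i) = (c t == i).
  rewrite /c truncn_eq//; apply/idP/idP; rewrite inE /S/=.
    move=> /andP[h1 h2]; apply/andP; split.
      by rewrite mulrC -ler_pdivrMr//; lra.
    by rewrite mulrC -ltr_pdivlMr//; lra.
  move=> /andP[]; rewrite mulrC -ler_pdivrMr// -ltr_pdivlMr// => h1 h2.
  by apply/andP; split; lra.
pose h t := \sum_(i < B) (i%:R / N%:R - M) * \1_(S i) t.
have bh : bfun h by apply: bfun_sum => i; apply: bfunZ; exact: bfun_indic.
exists (cls h).
  rewrite (Lcls_sum lebesgue01T p1 _ xpredT (F := fun (i : 'I_B) t => (i%:R / N%:R - M) * \1_(S i) t)).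
    apply: approximable_sum => i; rewrite (LclsZ lebesgue01T); last exact: bfun_indic.
    by apply: approximableZ; exact: approximable_indic.
  by move=> i; apply: bfunZ; exact: bfun_indic.
have hE t : h t = (c t)%:R / N%:R - M.
  have cB : (c t < B)%N.
    rewrite /B ltnS; apply: le_truncn; rewrite ler_wpM2l// lerD2r.
    exact: le_trans (ler_norm _) (fM t).
  rewrite /h (bigD1 (Ordinal cB))//= indicE Sc eqxx mulr1 big1 ?addr0// => i.
  by rewrite -val_eqE/= eq_sym indicE Sc => /negbTE ->; rewrite mulr0.
have fh t : `|f t - h t| <= e.
  apply: le_trans Ne; have /andP[h1 h2] := truncn_itv (fM0 t).
  rewrite hE -/(c t) in h1 h2 *; rewrite ler_norml.
  rewrite mulrC -ler_pdivrMr// in h1; rewrite mulrC -ltr_pdivlMr// -addn1 natrD mulrDl mul1r in h2.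
  by apply/andP; split; lra.
have -> : cls f - cls h = cls (fun t => f t - h t).
  rewrite -[LHS]addrC -scaleN1r -Lcls_lin; try exact: (bfun_Lfun lebesgue01T).
  by congr Lcls; apply/funext => t; rewrite mulN1r addrC.
have bd : bfun (fun t => f t - h t).
  rewrite (_ : (fun t => _) = (fun t => f t + (-1) * h t)); first by apply: bfunD => //; exact: bfunZ.
  by apply/funext => t; rewrite mulN1r.
apply: norm_Lcls_le => //; [exact: (bfun_Lfun lebesgue01T)|exact: ltW|].
rewrite -[leRHS](bRintegral_cst lebesgue01T); apply: (ler_bRintegral lebesgue01T).
- exact: bfun_powR.
- exact: bfun_cst.
by move=> t; apply: ge0_ler_powR; rewrite ?nnegrE ?(ltW p0) ?(ltW e0).
Qed.

(** Truncating [f] to zero where [|f| > n] gives bounded functions dominated by [|f|]. *)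
Lemma approximable_all (x : X) : approximable x.
Proof.
rewrite -[x]LreprK'; set f : T -> R := Lrepr x.
have Pf : f \in Lfun mu p%:E by exact: LfunP.
have mf : measurable_fun setT f by exact: measurable_funPT.
have mA n : measurable [set t | `|f t| <= n%:R].
  rewrite (_ : [set t | _] = (fun t => `|f t|) @^-1` `]-oo, n%:R]%classic).
    rewrite -[X in measurable X]setTI; apply: (measurableT_comp _ mf) => //.
  by apply/seteqP; split=> t /=; rewrite in_itv.
pose f_ n t := f t * \1_[set t | `|f t| <= n%:R] t.
have bf n : bfun (f_ n).
  split; first by apply: measurable_funM => //; exact: measurable_indic.
  exists n%:R => t; rewrite /f_ indicE; have [tn|tn] := boolP (t \in _).
    by rewrite mulr1; rewrite inE in tn.
  by rewrite mulr0 normr0.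
have Pa : (fun t => `|f t|) \in Lfun mu p%:E.
  rewrite inE; apply/andP; split; rewrite inE/=; first exact: measurableT_comp.
  rewrite /finite_norm (_ : EFin \o _ = abse \o (EFin \o f))// Lnorm_abse.
  by move: Pf; rewrite inE => /andP[_]; rewrite inE.
apply: (@Lcls_dominated f_ f (fun t => `|f t|)) => //.
- by move=> n; exact: (bfun_Lfun lebesgue01T).
- move=> t; apply: cvg_near_cst; exists (Num.truncn `|f t|).+1 => // n /= tn.
  rewrite /f_ indicE mem_set ?mulr1//=; apply: ltW; apply: lt_le_trans (truncnS_gt _) _.
  by rewrite ler_nat.
- move=> n t; rewrite /f_ normrM ler_piMr//; exact: indic_le1.
- by move=> n; exact: approximable_bfun.
Qed.

End density.

(** * The upper bound by counting *)

Section upper_bound.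
Context {R : realType} (p : R) (p1 : 1 <= p).

Lemma closed_ideals_le : closed_ideals (Lp01 p1) #<= [set: set R].
Proof.
have [g ginj] := @real_family_inj R (seq (rat * rat) * seq (rat * rat))%type.
(* The distances from the image of each dense element to all dense elements serve as coordinates:
   choosing [z.2] close to the image under [W] shows that equal distances force equal images. *)
pose code (V : bop (Lp01 p1)) :=
  g (fun z => `|V (step_comb p1 z.1) - step_comb p1 z.2|).
have code_inj : injective code.
  move=> V W /ginj VW; apply/bopP => x; apply/eqP; rewrite -subr_eq0 -normr_le0.
  have VWd l : V (step_comb p1 l) = W (step_comb p1 l).
    apply/eqP; rewrite -subr_eq0 -normr_le0; apply/ler_addgt0Pr => e e0.
    have e2 : 0 < e / 2 by rewrite divr_gt0.
    have [l' Wl'] := approximable_all (W (step_comb p1 l)) e2.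
    have := congr1 (fun h => h (l, l')) VW => /= E.
    rewrite -(subrK (step_comb p1 l') (V (step_comb p1 l))) -addrA add0r [leRHS](splitr e).
    apply: (le_trans (ler_normD _ _)); apply: lerD; first by rewrite E.
    by rewrite distrC.
  apply/ler_addgt0Pr => e e0; rewrite add0r.
  pose M := opnorm V + opnorm W + 1.
  have M0 : 0 < M by rewrite ltr_wpDl// addr_ge0// opnorm_ge0.
  have [l xl] := approximable_all x (divr_gt0 e0 M0).
  have -> : V x - W x = V (x - step_comb p1 l) - W (x - step_comb p1 l).
    have subE (U : bop (Lp01 p1)) : U (x - step_comb p1 l) = U x - U (step_comb p1 l).
      exact: linearB.
    by rewrite !subE VWd opprB addrA subrK.
  apply: (le_trans (ler_normB _ _)).
  apply: (le_trans (lerD (le_opnorm V _) (le_opnorm W _))).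
  rewrite -mulrDl; apply: (@le_trans _ _ (M * `|x - step_comb p1 l|)).
    by rewrite ler_wpM2r// lerDl.
  by rewrite mulrC -ler_pdivlMr.
apply: (@inj_card_leP _ _ _ _ (fun I => code @` I)) => // I J _ _ IJ.
by apply/seteqP; split => V IV; [have : (code @` J) (code V) by rewrite -IJ; exists V
  | have : (code @` I) (code V) by rewrite IJ; exists V]; case=> W IW /code_inj <-.
Qed.

End upper_bound.

Theorem corollary10 (R : realType) (p : R) (p_gt1 : 1 < p) (p_neq2 : p <> 2) :
  closed_ideals (Lp01 (ltW p_gt1)) #= [set: set R].
Proof.
rewrite card_eq_le closed_ideals_le/=.
have [p2|p2|//] := ltgtP p 2; last exact: closed_ideals_ge_gt2.
exact: closed_ideals_ge_lt2.
Qed.
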